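(* Let $k$ be a field of characteristic zero, let $X$ be a scheme of finite type over $k$, and let $P\in X$ be a $k$-rational point. If the pointed scheme $(X,P)$ is a principal gradient scheme, then the reduced closed subscheme $X_{\mathrm{red}}$ of $X$ is regular at $P$; that is, the local ring $\mathcal{O}_{X,P}/\operatorname{nil}\mathcal{O}_{X,P}$ is a regular local ring.
   Context: For $f\in k[[x_1,\ldots,x_n]]$, the gradient ideal of $f$ is the ideal $I_{\nabla f}:=\left(\frac{\partial f}{\partial x_1},\ldots,\frac{\partial f}{\partial x_n}\right)\subseteq k[[x_1,\ldots,x_n]]$. An ideal $I\subseteq k[[x_1,\ldots,x_n]]$ is called a gradient ideal if $I=I_{\nabla f}$ for some $f\in k[[x_1,\ldots,x_n]]$. Let $X$ be a scheme of finite type over $k$ and let $P\in X$ be a $k$-rational point. The pointed scheme $(X,P)$ is a gradient scheme if the completion of the local ring $\mathcal{O}_{X,P}$ with respect to its maximal ideal is isomorphic, as a complete local $k$-algebra, to $k[[x_1,\ldots,x_n]]/I$ for some $n$ and some gradient ideal $I\subseteq k[[x_1,\ldots,x_n]]$. If such an $I$ can be taken to be a principal ideal, the gradient scheme $(X,P)$ is called principal. For a ring $R$, $\operatorname{nil}R$ denotes the nilradical of $R$. *)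

(* Defs.v *)
From HB Require Import structures.
From mathcomp Require Import all_boot all_algebra.
From mathcomp Require Import boolp classical_sets topology_structure mpoly.
From mathcomp Require Import ring.

Set Implicit Arguments.
Unset Strict Implicit.
Unset Printing Implicit Defensive.

Import GRing.Theory.
Local Open Scope ring_scope.
Local Open Scope quotient_scope.
Local Open Scope classical_set_scope.

Identity Coercion set_to_fun : set >-> Funclass.

(** * Constructions of commutative rings

    All rings are [comPzRingType]: the zero ring is allowed, as it must be for
    sections over the empty set and for quotients by the unit ideal. *)

(* A set with operations satisfying the axioms of a commutative ring up to an
   equivalence relation; the quotient is a commutative ring.  Quotient rings,
   localizations and stalks are all obtained this way. *)
Record setoid_ring := SetoidRing {
  sr_car :> choiceType;
  sr_eqv : sr_car -> sr_car -> Prop;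
  sr_refl : forall x, sr_eqv x x;
  sr_sym : forall x y, sr_eqv x y -> sr_eqv y x;
  sr_trans : forall y x z, sr_eqv x y -> sr_eqv y z -> sr_eqv x z;
  sr_zero : sr_car;
  sr_one : sr_car;
  sr_opp : sr_car -> sr_car;
  sr_add : sr_car -> sr_car -> sr_car;
  sr_mul : sr_car -> sr_car -> sr_car;
  sr_oppE : forall x x', sr_eqv x x' -> sr_eqv (sr_opp x) (sr_opp x');
  sr_addE : forall x x' y y', sr_eqv x x' -> sr_eqv y y' ->
    sr_eqv (sr_add x y) (sr_add x' y');
  sr_mulE : forall x x' y y', sr_eqv x x' -> sr_eqv y y' ->
    sr_eqv (sr_mul x y) (sr_mul x' y');
  sr_addA : forall x y z,
    sr_eqv (sr_add x (sr_add y z)) (sr_add (sr_add x y) z);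
  sr_addC : forall x y, sr_eqv (sr_add x y) (sr_add y x);
  sr_add0 : forall x, sr_eqv (sr_add sr_zero x) x;
  sr_addN : forall x, sr_eqv (sr_add (sr_opp x) x) sr_zero;
  sr_mulA : forall x y z,
    sr_eqv (sr_mul x (sr_mul y z)) (sr_mul (sr_mul x y) z);
  sr_mulC : forall x y, sr_eqv (sr_mul x y) (sr_mul y x);
  sr_mul1 : forall x, sr_eqv (sr_mul sr_one x) x;
  sr_mulD : forall x y z,
    sr_eqv (sr_mul (sr_add x y) z) (sr_add (sr_mul x z) (sr_mul y z))
}.

Section SetoidRingQuotient.
Variable S : setoid_ring.

Let eqvb (x y : S) : bool := `[< sr_eqv x y >].

Fact eqvb_refl : reflexive eqvb.
Proof. by move=> x; apply/asboolP; apply: sr_refl. Qed.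

Fact eqvb_sym : ssrbool.symmetric eqvb.
Proof. by move=> x y; apply/asboolP/asboolP; apply: sr_sym. Qed.

Fact eqvb_trans : transitive eqvb.
Proof.
by move=> y x z /asboolP xy /asboolP yz; apply/asboolP; apply: sr_trans xy yz.
Qed.

Canonical sr_equiv_rel := EquivRel eqvb eqvb_refl eqvb_sym eqvb_trans.

Definition sr_quot := {eq_quot sr_equiv_rel}.

HB.instance Definition _ := Choice.on sr_quot.

Definition sr_pi (x : S) : sr_quot := \pi_{eq_quot sr_equiv_rel} x.
Definition sr_repr (x : sr_quot) : S := repr (x : {eq_quot sr_equiv_rel}).

Lemma sr_piP x y : sr_pi x = sr_pi y <-> sr_eqv x y.
Proof.
split=> [/eqmodP/asboolP //|xy]; apply/eqmodP; exact/asboolP.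
Qed.

Lemma sr_reprK x : sr_pi (sr_repr x) = x.
Proof. exact: reprK. Qed.

Lemma sr_pi_repr x : sr_eqv (sr_repr (sr_pi x)) x.
Proof. by apply/sr_piP; rewrite sr_reprK. Qed.

Let zeroq := sr_pi (sr_zero S).
Let oneq := sr_pi (sr_one S).
Let oppq x := sr_pi (sr_opp (sr_repr x)).
Let addq x y := sr_pi (sr_add (sr_repr x) (sr_repr y)).
Let mulq x y := sr_pi (sr_mul (sr_repr x) (sr_repr y)).

Let oppqE x : oppq (sr_pi x) = sr_pi (sr_opp x).
Proof. by apply/sr_piP/sr_oppE/sr_pi_repr. Qed.
Let addqE x y : addq (sr_pi x) (sr_pi y) = sr_pi (sr_add x y).
Proof. by apply/sr_piP/sr_addE; apply: sr_pi_repr. Qed.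
Let mulqE x y : mulq (sr_pi x) (sr_pi y) = sr_pi (sr_mul x y).
Proof. by apply/sr_piP/sr_mulE; apply: sr_pi_repr. Qed.

Let addqA : associative addq.
Proof.
move=> x y z; rewrite -(sr_reprK x) -(sr_reprK y) -(sr_reprK z) !addqE.
by apply/sr_piP/sr_addA.
Qed.
Let addqC : commutative addq.
Proof. by move=> x y; apply/sr_piP/sr_addC. Qed.
Let add0q : left_id zeroq addq.
Proof. by move=> x; rewrite -(sr_reprK x) addqE; apply/sr_piP/sr_add0. Qed.
Let addNq : left_inverse zeroq oppq addq.
Proof.
by move=> x; rewrite -(sr_reprK x) oppqE addqE; apply/sr_piP/sr_addN.
Qed.

HB.instance Definition _ :=
  GRing.isZmodule.Build sr_quot addqA addqC add0q addNq.

Let mulqA : associative mulq.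
Proof.
move=> x y z; rewrite -(sr_reprK x) -(sr_reprK y) -(sr_reprK z) !mulqE.
by apply/sr_piP/sr_mulA.
Qed.
Let mulqC : commutative mulq.
Proof. by move=> x y; apply/sr_piP/sr_mulC. Qed.
Let mul1q : left_id oneq mulq.
Proof. by move=> x; rewrite -(sr_reprK x) mulqE; apply/sr_piP/sr_mul1. Qed.
Let mulqDl : left_distributive mulq addq.
Proof.
move=> x y z; rewrite -(sr_reprK x) -(sr_reprK y) -(sr_reprK z).
by rewrite !(addqE, mulqE); apply/sr_piP/sr_mulD.
Qed.

HB.instance Definition _ :=
  GRing.Zmodule_isComPzRing.Build sr_quot mulqA mulqC mul1q mulqDl.

Lemma sr_pi0 : sr_pi (sr_zero S) = 0. Proof. by []. Qed.
Lemma sr_pi1 : sr_pi (sr_one S) = 1. Proof. by []. Qed.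
Lemma sr_piN x : sr_pi (sr_opp x) = - sr_pi x.
Proof. by rewrite -oppqE. Qed.
Lemma sr_piD x y : sr_pi (sr_add x y) = sr_pi x + sr_pi y.
Proof. by rewrite -addqE. Qed.
Lemma sr_piM x y : sr_pi (sr_mul x y) = sr_pi x * sr_pi y.
Proof. by rewrite -mulqE. Qed.

End SetoidRingQuotient.

Section ProductRing.
Variables (I : Type) (R : I -> comPzRingType).

Definition prod_ring := forall i, R i.

HB.instance Definition _ := gen_eqMixin prod_ring.
HB.instance Definition _ := gen_choiceMixin prod_ring.

Let zerop : prod_ring := fun=> 0.
Let onep : prod_ring := fun=> 1.
Let oppp (f : prod_ring) : prod_ring := fun i => - f i.
Let addp (f g : prod_ring) : prod_ring := fun i => f i + g i.
Let mulp (f g : prod_ring) : prod_ring := fun i => f i * g i.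

Let addpA : associative addp.
Proof. by move=> f g h; apply: functional_extensionality_dep => i; apply: addrA. Qed.
Let addpC : commutative addp.
Proof. by move=> f g; apply: functional_extensionality_dep => i; apply: addrC. Qed.
Let add0p : left_id zerop addp.
Proof. by move=> f; apply: functional_extensionality_dep => i; apply: add0r. Qed.
Let addNp : left_inverse zerop oppp addp.
Proof. by move=> f; apply: functional_extensionality_dep => i; apply: addNr. Qed.

HB.instance Definition _ :=
  GRing.isZmodule.Build prod_ring addpA addpC add0p addNp.

Let mulpA : associative mulp.
Proof. by move=> f g h; apply: functional_extensionality_dep => i; apply: mulrA. Qed.
Let mulpC : commutative mulp.
Proof. by move=> f g; apply: functional_extensionality_dep => i; apply: mulrC. Qed.
Let mul1p : left_id onep mulp.
Proof. by move=> f; apply: functional_extensionality_dep => i; apply: mul1r. Qed.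
Let mulpDl : left_distributive mulp addp.
Proof.
by move=> f g h; apply: functional_extensionality_dep => i; apply: mulrDl.
Qed.

HB.instance Definition _ :=
  GRing.Zmodule_isComPzRing.Build prod_ring mulpA mulpC mul1p mulpDl.

End ProductRing.

Record subring (R : comPzRingType) := Subring {
  subring_set :> set R;
  subring1 : subring_set 1;
  subringB : forall x y, subring_set x -> subring_set y -> subring_set (x - y);
  subringM : forall x y, subring_set x -> subring_set y -> subring_set (x * y)
}.

Section SubringType.
Variables (R : comPzRingType) (S : subring R).

Record subring_type := SubringElt {
  subring_val :> R;
  subring_valP : subring_set S subring_val
}.

Lemma subring_val_inj : injective subring_val.
Proof.
by move=> [x Sx] [y Sy] /= xy; subst y; rewrite (Prop_irrelevance Sx Sy).
Qed.

HB.instance Definition _ := gen_eqMixin subring_type.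
HB.instance Definition _ := gen_choiceMixin subring_type.

Fact subring0 : S 0.
Proof. by rewrite -(subrr 1); apply: subringB; apply: subring1. Qed.
Fact subringN x : S x -> S (- x).
Proof. by move=> Sx; rewrite -sub0r; apply: subringB => //; apply: subring0. Qed.
Fact subringD x y : S x -> S y -> S (x + y).
Proof. by move=> Sx Sy; rewrite -(opprK y); apply/subringB/subringN. Qed.

Let zeros := SubringElt subring0.
Let ones := SubringElt (subring1 S).
Let opps x := SubringElt (subringN (subring_valP x)).
Let adds x y := SubringElt (subringD (subring_valP x) (subring_valP y)).
Let muls x y := SubringElt (subringM (subring_valP x) (subring_valP y)).

Let addsA : associative adds.
Proof. by move=> x y z; apply: subring_val_inj; apply: addrA. Qed.
Let addsC : commutative adds.
Proof. by move=> x y; apply: subring_val_inj; apply: addrC. Qed.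
Let add0s : left_id zeros adds.
Proof. by move=> x; apply: subring_val_inj; apply: add0r. Qed.
Let addNs : left_inverse zeros opps adds.
Proof. by move=> x; apply: subring_val_inj; apply: addNr. Qed.

HB.instance Definition _ :=
  GRing.isZmodule.Build subring_type addsA addsC add0s addNs.

Let mulsA : associative muls.
Proof. by move=> x y z; apply: subring_val_inj; apply: mulrA. Qed.
Let mulsC : commutative muls.
Proof. by move=> x y; apply: subring_val_inj; apply: mulrC. Qed.
Let mul1s : left_id ones muls.
Proof. by move=> x; apply: subring_val_inj; apply: mul1r. Qed.
Let mulsDl : left_distributive muls adds.
Proof. by move=> x y z; apply: subring_val_inj; apply: mulrDl. Qed.

HB.instance Definition _ :=
  GRing.Zmodule_isComPzRing.Build subring_type mulsA mulsC mul1s mulsDl.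

Fact subring_val_is_zmod : zmod_morphism subring_val. Proof. by []. Qed.
Fact subring_val_is_monoid : monoid_morphism subring_val. Proof. by []. Qed.
HB.instance Definition _ :=
  GRing.isZmodMorphism.Build subring_type R subring_val subring_val_is_zmod.
HB.instance Definition _ :=
  GRing.isMonoidMorphism.Build subring_type R subring_val subring_val_is_monoid.

End SubringType.

(** * Ideals *)

Record ideal (R : comPzRingType) := Ideal {
  ideal_set :> set R;
  ideal0 : ideal_set 0;
  idealD : forall x y, ideal_set x -> ideal_set y -> ideal_set (x + y);
  idealM : forall a x, ideal_set x -> ideal_set (a * x)
}.

Section IdealTheory.
Variable R : comPzRingType.
Implicit Types (I J : ideal R) (S : set R).

Lemma idealP I J : (forall x, I x <-> J x) -> I = J.
Proof.
move=> eqIJ; have {eqIJ} : ideal_set I = ideal_set J.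
  by apply/seteqP; split=> x /eqIJ.
case: I J => [I I0 ID IM] [J J0 JD JM] /= IJ.
by subst J; congr Ideal; apply: Prop_irrelevance.
Qed.

Lemma idealN I x : I x -> I (- x).
Proof. by rewrite -mulN1r; apply: idealM. Qed.

Lemma idealB I x y : I x -> I y -> I (x - y).
Proof. by move=> Ix Iy; apply/idealD/idealN. Qed.

Definition ideal_top : ideal R.
Proof. by exists setT. Defined.

Definition ideal_gen S : ideal R.
Proof.
exists [set x | forall I, S `<=` I -> I x].
- by move=> I _; apply: ideal0.
- by move=> x y Sx Sy I SI; apply: idealD; [apply: Sx|apply: Sy].
- by move=> a x Sx I SI; apply/idealM/Sx.
Defined.

Definition ideal_mul I J : ideal R :=
  ideal_gen [set z | exists x y, [/\ I x, J y & z = x * y]].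

Definition ideal_exp I (n : nat) : ideal R := iter n (ideal_mul I) ideal_top.

Definition ideal_principal I : Prop := exists f, I = ideal_gen [set f].

Definition maximal_ideal I : Prop :=
  ~ I 1 /\ forall J, I `<=` J -> ~ J 1 -> J = I.

Fact nilpD (x y : R) : (exists n, x ^+ n = 0) -> (exists n, y ^+ n = 0) ->
  exists n, (x + y) ^+ n = 0.
Proof.
move=> [m xm] [n yn]; exists (m + n)%N; rewrite exprDn big1 // => -[i] /= ilt _.
case: (leqP n i) => [ni|ni].
  by rewrite -(subnK ni) [y ^+ _]exprD yn !mulr0 mul0rn.
rewrite (_ : (m + n - i)%N = (n - i + m)%N); last first.
  by rewrite addnC -addnBAC 1?ltnW.
by rewrite exprD xm mulr0 mul0r mul0rn.
Qed.

Definition nilradical : ideal R.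
Proof.
exists [set x | exists n, x ^+ n = 0].
- by exists 1%N; rewrite expr1.
- by move=> x y; apply: nilpD.
- by move=> a x [n xn]; exists n; rewrite exprMn xn mulr0.
Defined.

Definition quot_setoid I : setoid_ring.
Proof.
apply: (@SetoidRing R (fun x y => I (x - y)) _ _ _ 0 1 -%R +%R *%R).
- by move=> x; rewrite subrr; apply: ideal0.
- by move=> x y Ixy; rewrite -opprB; apply: idealN.
- by move=> y x z Ixy Iyz; rewrite -(subrKA y); apply: idealD.
- by move=> x x' Ix; rewrite -opprD; apply: idealN.
- by move=> x x' y y' Ix Iy; rewrite opprD addrACA; apply: idealD.
- move=> x x' y y' Ix Iy.
  have -> : x * y - x' * y' = y * (x - x') + x' * (y - y').
    by rewrite !mulrBr [y * x]mulrC [y * x']mulrC subrKA.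
  by apply: idealD; apply: idealM.
- by move=> x y z; rewrite addrA subrr; apply: ideal0.
- by move=> x y; rewrite [x + y]addrC subrr; apply: ideal0.
- by move=> x; rewrite add0r subrr; apply: ideal0.
- by move=> x; rewrite addNr subrr; apply: ideal0.
- by move=> x y z; rewrite mulrA subrr; apply: ideal0.
- by move=> x y; rewrite mulrC subrr; apply: ideal0.
- by move=> x; rewrite mul1r subrr; apply: ideal0.
- by move=> x y z; rewrite mulrDl subrr; apply: ideal0.
Defined.

Definition quot I : comPzRingType := sr_quot (quot_setoid I).

Definition quot_pi I (x : R) : quot I := @sr_pi (quot_setoid I) x.

Fact quot_pi_is_zmod I : zmod_morphism (quot_pi I).
Proof. by move=> x y; rewrite -sr_piN -sr_piD. Qed.
Fact quot_pi_is_monoid I : monoid_morphism (quot_pi I).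
Proof. by split=> // x y; rewrite -sr_piM. Qed.
HB.instance Definition _ I :=
  GRing.isZmodMorphism.Build R (quot I) (quot_pi I) (@quot_pi_is_zmod I).
HB.instance Definition _ I :=
  GRing.isMonoidMorphism.Build R (quot I) (quot_pi I) (@quot_pi_is_monoid I).

Lemma quot_piP I x y : quot_pi I x = quot_pi I y <-> I (x - y).
Proof. exact: sr_piP. Qed.

End IdealTheory.

Record prime_ideal (R : comPzRingType) := PrimeIdeal {
  prime_ideal_ideal :> ideal R;
  prime_ideal1 : ~ prime_ideal_ideal 1;
  prime_idealM : forall x y, prime_ideal_ideal (x * y) ->
    prime_ideal_ideal x \/ prime_ideal_ideal y
}.

(** * Local rings *)

Definition is_local (R : comPzRingType) (m : ideal R) : Prop :=
  maximal_ideal m /\ forall m', maximal_ideal m' -> m' = m.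

Definition noetherian (R : comPzRingType) : Prop :=
  forall I : ideal R, exists r (g : 'I_r -> R), I = ideal_gen (range g).

(* [p 0 < p 1 < ... < p d] is a strictly increasing chain of primes. *)
Definition prime_chain (R : comPzRingType) (d : nat)
    (p : nat -> prime_ideal R) : Prop :=
  forall i, (i < d)%N -> p i `<=` p i.+1 /\ ~ (p i.+1 `<=` p i).

Definition krull_dim (R : comPzRingType) (d : nat) : Prop :=
  (exists p : nat -> prime_ideal R, prime_chain d p) /\
  forall e (p : nat -> prime_ideal R), prime_chain e p -> (e <= d)%N.

(* A Noetherian local ring whose maximal ideal is generated by [dim R]
   elements. *)
Definition regular_local_ring (R : comPzRingType) : Prop :=
  noetherian R /\
  exists m : ideal R, is_local m /\
  exists2 d, krull_dim R d &
    exists g : 'I_d -> R, m = ideal_gen (range g).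

(** * Completion: the inverse limit of the rings [R / m ^ n] *)

Section Completion.
Variables (R : comPzRingType) (m : ideal R).

(* [s n.+1] and [s n] have a common representative, that is, [s n] is the image
   of [s n.+1] under the projection. *)
Definition coherent (s : prod_ring (fun n => quot (ideal_exp m n))) : Prop :=
  forall n, exists2 a, s n.+1 = quot_pi _ a & s n = quot_pi _ a.

Definition coherent_subring :
  subring (prod_ring (fun n => quot (ideal_exp m n))).
Proof.
exists coherent.
- by move=> n; exists 1.
- move=> s t sC tC n; have [a sa sa'] := sC n; have [b tb tb'] := tC n.
  exists (a - b); rewrite rmorphB /=.
    by rewrite -sa -tb.
  by rewrite -sa' -tb'.
- move=> s t sC tC n; have [a sa sa'] := sC n; have [b tb tb'] := tC n.
  exists (a * b); rewrite rmorphM /=.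
    by rewrite -sa -tb.
  by rewrite -sa' -tb'.
Defined.

Definition completion : comPzRingType := subring_type coherent_subring.

Definition to_completion (x : R) : completion :=
  @SubringElt _ coherent_subring (fun n => quot_pi _ x)
    (fun n => ex_intro2 _ _ x erefl erefl).

End Completion.

(** * Localization at a prime ideal *)

Section Localization.
Variables (R : comPzRingType) (p : prime_ideal R).

Record fraction := Fraction {
  fnum : R;
  fden : R;
  fdenP : ~ p fden
}.
HB.instance Definition _ := gen_eqMixin fraction.
HB.instance Definition _ := gen_choiceMixin fraction.

Definition fraction_eqv (x y : fraction) : Prop :=
  exists2 u, ~ p u & u * (fnum x * fden y) = u * (fnum y * fden x).

Fact prime_compl_mul x y : ~ p x -> ~ p y -> ~ p (x * y).
Proof. by move=> px py /prime_idealM []. Qed.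

Definition fraction_opp x := Fraction (- fnum x) (@fdenP x).
Definition fraction_add x y :=
  Fraction (fnum x * fden y + fnum y * fden x)
    (prime_compl_mul (@fdenP x) (@fdenP y)).
Definition fraction_mul x y :=
  Fraction (fnum x * fnum y) (prime_compl_mul (@fdenP x) (@fdenP y)).

Fact fraction_eqv_eq x y :
  fnum x * fden y = fnum y * fden x -> fraction_eqv x y.
Proof. by move=> e; exists 1; [exact: prime_ideal1 | rewrite e]. Qed.

Definition localization_setoid : setoid_ring.
Proof.
apply: (@SetoidRing fraction fraction_eqv _ _ _ (Fraction 0 (@prime_ideal1 _ p))
  (Fraction 1 (@prime_ideal1 _ p)) fraction_opp fraction_add fraction_mul).
- by move=> x; apply: fraction_eqv_eq.
- by move=> x y [u pu e]; exists u.
- move=> [b t pt] [a s ps] [c r pr] [u pu /= e] [v pv /= e'].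
  exists (u * v * t); first by do 2?apply: prime_compl_mul.
  rewrite /=.
  have -> : u * v * t * (a * r) = v * r * (u * (a * t)) by ring.
  have -> : u * v * t * (c * s) = u * s * (v * (c * t)) by ring.
  by rewrite e -e'; ring.
- move=> [a s ps] [b t pt] [u pu /= e]; exists u => //=.
  by rewrite !mulNr !mulrN e.
- move=> [a s ps] [b t pt] [c r pr] [d q pq] [u pu /= e] [v pv /= e'].
  exists (u * v); first exact: prime_compl_mul.
  rewrite /=.
  have -> : u * v * ((a * r + c * s) * (t * q)) =
    v * r * q * (u * (a * t)) + u * s * t * (v * (c * q)) by ring.
  by rewrite e e'; ring.
- move=> [a s ps] [b t pt] [c r pr] [d q pq] [u pu /= e] [v pv /= e'].
  exists (u * v); first exact: prime_compl_mul.
  rewrite /=.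
  have -> : u * v * ((a * c) * (t * q)) =
    (u * (a * t)) * (v * (c * q)) by ring.
  by rewrite e e'; ring.
- by move=> x y z; apply: fraction_eqv_eq => /=; ring.
- by move=> x y; apply: fraction_eqv_eq => /=; ring.
- by move=> x; apply: fraction_eqv_eq => /=; ring.
- by move=> x; apply: fraction_eqv_eq => /=; ring.
- by move=> x y z; apply: fraction_eqv_eq => /=; ring.
- by move=> x y; apply: fraction_eqv_eq => /=; ring.
- by move=> x; apply: fraction_eqv_eq => /=; ring.
- by move=> x y z; apply: fraction_eqv_eq => /=; ring.
Defined.

Definition localization : comPzRingType := sr_quot localization_setoid.

Definition frac (a s : R) (ps : ~ p s) : localization :=
  @sr_pi localization_setoid (Fraction a ps).

End Localization.

(** * Ringed spaces *)

Record opens (X : topologicalType) := Opens {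
  opens_set :> set X;
  opensP : open opens_set
}.

Definition opensT (X : topologicalType) : opens X := Opens (@openT X).

Definition opensI (X : topologicalType) (U V : opens X) : opens X :=
  Opens (openI (opensP U) (opensP V)).

Lemma opensIl (X : topologicalType) (U V : opens X) : opensI U V `<=` U.
Proof. exact: subIsetl. Qed.

Lemma opensIr (X : topologicalType) (U V : opens X) : opensI U V `<=` V.
Proof. exact: subIsetr. Qed.

Definition opens_preimage (X Y : topologicalType) (f : X -> Y)
    (cf : continuous f) (V : opens Y) : opens X :=
  Opens (proj1 (@continuousP _ _ f) cf V (opensP V)).

Record ringed_space := RingedSpace {
  rs_space :> topologicalType;
  rs_sect : opens rs_space -> comPzRingType;
  rs_res : forall (U V : opens rs_space), V `<=` U ->
    {rmorphism rs_sect U -> rs_sect V};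
  rs_res_id : forall (U : opens rs_space) (UU : U `<=` U) s, rs_res UU s = s;
  rs_res_comp : forall (U V W : opens rs_space) (VU : V `<=` U) (WV : W `<=` V)
    (WU : W `<=` U) s,
    rs_res WV (rs_res VU s) = rs_res WU s;
  rs_separated : forall (U : opens rs_space) (I : Type) (V : I -> opens rs_space)
    (VU : forall i, V i `<=` U), U `<=` \bigcup_i V i ->
    forall s t, (forall i, rs_res (VU i) s = rs_res (VU i) t) -> s = t;
  rs_glue : forall (U : opens rs_space) (I : Type) (V : I -> opens rs_space)
    (VU : forall i, V i `<=` U), U `<=` \bigcup_i V i ->
    forall s : forall i, rs_sect (V i),
    (forall i j, rs_res (@opensIl _ (V i) (V j)) (s i) =
       rs_res (@opensIr _ (V i) (V j)) (s j)) ->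
    exists t, forall i, rs_res (VU i) t = s i
}.

Section Stalk.
Variables (X : ringed_space) (P : X).

Record local_section := LocalSection {
  ls_dom : opens X;
  ls_domP : ls_dom P;
  ls_sect : rs_sect ls_dom
}.
HB.instance Definition _ := gen_eqMixin local_section.
HB.instance Definition _ := gen_choiceMixin local_section.

Definition same_germ (s t : local_section) : Prop :=
  exists (W : opens X) (Ws : W `<=` ls_dom s) (Wt : W `<=` ls_dom t),
    W P /\ rs_res Ws (ls_sect s) = rs_res Wt (ls_sect t).

Definition ls_map2 (op : forall U : opens X, rs_sect U -> rs_sect U -> rs_sect U)
    (s t : local_section) : local_section :=
  @LocalSection (opensI (ls_dom s) (ls_dom t)) (conj (ls_domP s) (ls_domP t))
    (op _ (rs_res (@opensIl _ _ _) (ls_sect s))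
          (rs_res (@opensIr _ _ _) (ls_sect t))).

Fact same_germ_on (s t : local_section) (W : opens X) : W P ->
  W `<=` ls_dom s -> W `<=` ls_dom t ->
  (forall (Ws : W `<=` ls_dom s) (Wt : W `<=` ls_dom t),
     rs_res Ws (ls_sect s) = rs_res Wt (ls_sect t)) -> same_germ s t.
Proof. by move=> WP Ws Wt e; exists W, Ws, Wt. Qed.

Fact res_map2 (op : forall U : opens X, rs_sect U -> rs_sect U -> rs_sect U)
  (opE : forall (U V : opens X) (VU : V `<=` U) a b,
     rs_res VU (op U a b) = op V (rs_res VU a) (rs_res VU b))
  (s t : local_section) (W : opens X) (Ws : W `<=` ls_dom s)
  (Wt : W `<=` ls_dom t) (Wst : W `<=` ls_dom (ls_map2 op s t)) :
  rs_res Wst (ls_sect (ls_map2 op s t)) =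
  op W (rs_res Ws (ls_sect s)) (rs_res Wt (ls_sect t)).
Proof. by rewrite /= opE !rs_res_comp. Qed.

Definition ls_cst (a : rs_sect (opensT X)) : local_section :=
  @LocalSection (opensT X) I a.
Definition ls_opp (s : local_section) : local_section :=
  LocalSection (ls_domP s) (- ls_sect s).
Definition ls_add := ls_map2 (fun U a b => a + b).
Definition ls_mul := ls_map2 (fun U a b => a * b).

Let resD (s t : local_section) (W : opens X) (Ws : W `<=` ls_dom s)
    (Wt : W `<=` ls_dom t) (Wst : W `<=` ls_dom (ls_add s t)) :
  rs_res Wst (ls_sect (ls_add s t)) =
  rs_res Ws (ls_sect s) + rs_res Wt (ls_sect t).
Proof. by apply: res_map2 => U V VU a b; rewrite rmorphD. Qed.

Let resM (s t : local_section) (W : opens X) (Ws : W `<=` ls_dom s)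
    (Wt : W `<=` ls_dom t) (Wst : W `<=` ls_dom (ls_mul s t)) :
  rs_res Wst (ls_sect (ls_mul s t)) =
  rs_res Ws (ls_sect s) * rs_res Wt (ls_sect t).
Proof. by apply: res_map2 => U V VU a b; rewrite rmorphM. Qed.

Let resN (s : local_section) (W : opens X) (Ws : W `<=` ls_dom s)
    (Wo : W `<=` ls_dom (ls_opp s)) :
  rs_res Wo (ls_sect (ls_opp s)) = - rs_res Ws (ls_sect s).
Proof. by rewrite /= rmorphN (Prop_irrelevance Wo Ws). Qed.

Fact same_germ_refl s : same_germ s s.
Proof.
exists (ls_dom s), (@subset_refl _ _), (@subset_refl _ _).
by split=> //; apply: ls_domP.
Qed.

Fact same_germ_sym s t : same_germ s t -> same_germ t s.
Proof. by move=> [W [Ws [Wt [WP e]]]]; exists W, Wt, Ws. Qed.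

Fact same_germ_trans t s u : same_germ s t -> same_germ t u -> same_germ s u.
Proof.
move=> [W [Ws [Wt [WP e]]]] [V [Vt [Vu [VP e']]]].
apply: (@same_germ_on _ _ (opensI W V)) => //=.
- by move=> x [/Ws].
- by move=> x [_ /Vu].
move=> WVs WVu.
have WVt : opensI W V `<=` ls_dom t by move=> x [/Wt].
have WVW : opensI W V `<=` W by move=> x [].
have WVV : opensI W V `<=` V by move=> x [].
rewrite -(rs_res_comp Ws WVW WVs) e (rs_res_comp Wt WVW WVt).
by rewrite -(rs_res_comp Vt WVV WVt) e' (rs_res_comp Vu WVV WVu).
Qed.

Fact same_germ_opp s s' : same_germ s s' -> same_germ (ls_opp s) (ls_opp s').
Proof.
move=> [W [Ws [Ws' [WP e]]]]; apply: (@same_germ_on _ _ W) => // Wo Wo'.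
by rewrite (resN Ws) (resN Ws') e.
Qed.

Fact same_germ_add s s' t t' : same_germ s s' -> same_germ t t' ->
  same_germ (ls_add s t) (ls_add s' t').
Proof.
move=> [W [Ws [Ws' [WP e]]]] [V [Vt [Vt' [VP e']]]].
have WVW : opensI W V `<=` W by move=> x [].
have WVV : opensI W V `<=` V by move=> x [].
have Us := subset_trans WVW Ws; have Us' := subset_trans WVW Ws'.
have Ut := subset_trans WVV Vt; have Ut' := subset_trans WVV Vt'.
apply: (@same_germ_on _ _ (opensI W V)) => //.
- by move=> x Ux; split; [apply: Us|apply: Ut].
- by move=> x Ux; split; [apply: Us'|apply: Ut'].
move=> U1 U2; rewrite (resD Us Ut) (resD Us' Ut').
by rewrite -(rs_res_comp Ws WVW) -(rs_res_comp Vt WVV) e e' !rs_res_comp.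
Qed.

Fact same_germ_mul s s' t t' : same_germ s s' -> same_germ t t' ->
  same_germ (ls_mul s t) (ls_mul s' t').
Proof.
move=> [W [Ws [Ws' [WP e]]]] [V [Vt [Vt' [VP e']]]].
have WVW : opensI W V `<=` W by move=> x [].
have WVV : opensI W V `<=` V by move=> x [].
have Us := subset_trans WVW Ws; have Us' := subset_trans WVW Ws'.
have Ut := subset_trans WVV Vt; have Ut' := subset_trans WVV Vt'.
apply: (@same_germ_on _ _ (opensI W V)) => //.
- by move=> x Ux; split; [apply: Us|apply: Ut].
- by move=> x Ux; split; [apply: Us'|apply: Ut'].
move=> U1 U2; rewrite (resM Us Ut) (resM Us' Ut').
by rewrite -(rs_res_comp Ws WVW) -(rs_res_comp Vt WVV) e e' !rs_res_comp.
Qed.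

(* Ring identities are checked on the intersection of three domains. *)
Let dom3 s t u : opens X := opensI (opensI (ls_dom s) (ls_dom t)) (ls_dom u).
Let dom31 s t u : dom3 s t u `<=` ls_dom s. Proof. by move=> x [[]]. Qed.
Let dom32 s t u : dom3 s t u `<=` ls_dom t. Proof. by move=> x [[]]. Qed.
Let dom33 s t u : dom3 s t u `<=` ls_dom u. Proof. by move=> x []. Qed.
Let dom3P s t u : dom3 s t u P.
Proof. by split; [split|]; apply: ls_domP. Qed.

Definition stalk_setoid : setoid_ring.
Proof.
apply: (@SetoidRing local_section same_germ same_germ_refl same_germ_sym
  same_germ_trans (ls_cst 0) (ls_cst 1) ls_opp ls_add ls_mul
  same_germ_opp same_germ_add same_germ_mul).
- move=> s t u; apply: (same_germ_on (@dom3P s t u)).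
  + by move=> x [[]].
  + by move=> x [[]].
  move=> W1 W2; rewrite (resD (@dom31 s t u)) => [|W3]; first by move=> x [[]].
  rewrite (resD (@dom32 s t u) (@dom33 s t u)).
  rewrite (resD _ (@dom33 s t u)) => [|W4]; first by move=> x [[]].
  by rewrite (resD (@dom31 s t u) (@dom32 s t u)) addrA.
- move=> s t; apply: (same_germ_on (@dom3P s t t)).
  + by move=> x [[]].
  + by move=> x [[]].
  move=> W1 W2; rewrite (resD (@dom31 s t t) (@dom32 s t t)).
  by rewrite (resD (@dom32 s t t) (@dom31 s t t)) addrC.
- move=> s; apply: (same_germ_on (ls_domP s)) => // W1 W2.
  by rewrite (@resD (ls_cst 0) _ _ (@subsetT _ _) W2) /= rmorph0 add0r.
- move=> s; apply: (same_germ_on (ls_domP s)) => // W1 W2.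
  have ss := @subset_refl _ (ls_dom s).
  by rewrite (@resD (ls_opp s) s _ ss ss) /= -rmorphD addNr !rmorph0.
- move=> s t u; apply: (same_germ_on (@dom3P s t u)).
  + by move=> x [[]].
  + by move=> x [[]].
  move=> W1 W2; rewrite (resM (@dom31 s t u)) => [|W3]; first by move=> x [[]].
  rewrite (resM (@dom32 s t u) (@dom33 s t u)).
  rewrite (resM _ (@dom33 s t u)) => [|W4]; first by move=> x [[]].
  by rewrite (resM (@dom31 s t u) (@dom32 s t u)) mulrA.
- move=> s t; apply: (same_germ_on (@dom3P s t t)).
  + by move=> x [[]].
  + by move=> x [[]].
  move=> W1 W2; rewrite (resM (@dom31 s t t) (@dom32 s t t)).
  by rewrite (resM (@dom32 s t t) (@dom31 s t t)) mulrC.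
- move=> s; apply: (same_germ_on (ls_domP s)) => // W1 W2.
  by rewrite (@resM (ls_cst 1) _ _ (@subsetT _ _) W2) /= rmorph1 mul1r.
- move=> s t u; apply: (same_germ_on (@dom3P s t u)).
  + by move=> x [[]].
  + by move=> x [[]].
  move=> W1 W2; rewrite (resM _ (@dom33 s t u)) => [|W3]; first by move=> x [[]].
  rewrite (resD (@dom31 s t u) (@dom32 s t u)).
  rewrite (@resD (ls_mul s u)) => [||W4 W5]; [by move=> x [[]]..|].
  rewrite (resM (@dom31 s t u) (@dom33 s t u)).
  by rewrite (resM (@dom32 s t u) (@dom33 s t u)) mulrDl.
Defined.

Definition stalk : comPzRingType := sr_quot stalk_setoid.

Definition germ (U : opens X) (UP : U P) (s : rs_sect U) : stalk :=
  @sr_pi stalk_setoid (LocalSection UP s).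

End Stalk.

Definition is_unit (R : comPzRingType) (x : R) : Prop := exists y, x * y = 1.

(* Morphisms of locally ringed spaces.  A homomorphism between local rings is
   local iff it reflects units. *)
Record morphism (X Y : ringed_space) := Morphism {
  mor_fun :> X -> Y;
  mor_cont : continuous mor_fun;
  mor_sharp : forall V : opens Y,
    {rmorphism rs_sect V -> rs_sect (opens_preimage mor_cont V)};
  mor_sharp_res : forall (U V : opens Y) (VU : V `<=` U)
    (fVU : opens_preimage mor_cont V `<=` opens_preimage mor_cont U) s,
    mor_sharp V (rs_res VU s) = rs_res fVU (mor_sharp U s);
  mor_local : forall (P : X) (V : opens Y) (VP : V (mor_fun P)) (s : rs_sect V),
    is_unit (germ (U := opens_preimage mor_cont V) VP (mor_sharp V s)) ->
    is_unit (germ VP s)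
}.

Arguments mor_cont {X Y} _.

(* [j] is an isomorphism of [Y] onto an open subspace of [X]. *)
Definition open_immersion (Y X : ringed_space) (j : morphism Y X) : Prop :=
  [/\ injective j,
      forall U : set Y, open U -> open (j @` U) &
      forall W : opens X, W `<=` range j -> bijective (mor_sharp j W)].

Record locally_ringed_space := LocallyRingedSpace {
  lrs_ringed_space :> ringed_space;
  lrs_max : forall P : lrs_ringed_space, ideal (stalk P);
  lrs_local : forall P : lrs_ringed_space, is_local (lrs_max P)
}.

(** * The spectrum of a ring *)

Section Spec.
Variable A : comPzRingType.

Definition spec := prime_ideal A.

HB.instance Definition _ := gen_eqMixin spec.
HB.instance Definition _ := gen_choiceMixin spec.

(* Complements of the sets [V(S) = {p | S `<=` p}]. *)
Definition zariski_open (U : set spec) : Prop :=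
  exists S : set A, U = [set p : spec | ~ (S `<=` p)].

Lemma zariski_openP (U : set spec) : zariski_open U <->
  forall p, U p -> exists2 f, ~ p f & forall q : spec, ~ q f -> U q.
Proof.
split=> [[S ->] p /existsNP[f /not_implyP[Sf pf]]|HU].
  by exists f => // q qf; apply/existsNP; exists f; apply/not_implyP.
exists [set f | forall q : spec, ~ q f -> U q]; apply/seteqP; split=> p.
  move=> /HU[f pf fU]; apply/existsNP; exists f; exact/not_implyP.
by move=> /existsNP[f /not_implyP[fU /fU]].
Qed.

Fact zariski_openT : zariski_open setT.
Proof. by apply/zariski_openP=> p _; exists 1 => //; apply: prime_ideal1. Qed.

Fact zariski_openI : setI_closed zariski_open.
Proof.
move=> U V /zariski_openP UP /zariski_openP VP; apply/zariski_openP.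
move=> p [/UP[f pf fU] /VP[g pg gV]]; exists (f * g).
  exact: prime_compl_mul.
move=> q qfg; split; [apply: fU|apply: gV] => qf; apply: qfg.
  by rewrite mulrC; apply: idealM.
exact: idealM.
Qed.

Fact zariski_open_bigU (I : Type) (F : I -> set spec) :
  (forall i, zariski_open (F i)) -> zariski_open (\bigcup_i F i).
Proof.
move=> FP; apply/zariski_openP => p [i _ Fip].
have /zariski_openP/(_ _ Fip)[f pf fF] := FP i.
by exists f => // q /fF; exists i.
Qed.

HB.instance Definition _ := isOpenTopological.Build spec
  zariski_openT zariski_openI zariski_open_bigU.

Section SpecSections.
Variable U : opens spec.

Definition spec_germs : comPzRingType :=
  prod_ring (fun x : {p : spec | U p} => localization (sval x)).

Definition locally_fraction (s : spec_germs) : Prop :=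
  forall x : {p | U p}, exists V : opens spec, [/\ V (sval x), V `<=` U &
    exists a f, forall y : {p | U p}, V (sval y) ->
      exists yf : ~ sval y f, s y = frac a yf].

Definition spec_subring : subring spec_germs.
Proof.
exists locally_fraction.
- move=> x; exists U; split; [exact: svalP|exact: subset_refl|].
  by exists 1, 1 => y _; exists (@prime_ideal1 _ (sval y)).
- move=> s t sP tP x; have [V [Vx VU [a [f sE]]]] := sP x.
  have [W [Wx WU [b [g tE]]]] := tP x.
  exists (opensI V W); split=> [//|y [/VU]//|].
  exists (a * g + - b * f), (f * g) => y [/sE[yf sy] /tE[yg ty]].
  exists (prime_compl_mul yf yg).
  rewrite -[(s - t) y]/(s y - t y) sy ty /frac.
  by rewrite -(@sr_piN (localization_setoid _)) -(@sr_piD (localization_setoid _)).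
- move=> s t sP tP x; have [V [Vx VU [a [f sE]]]] := sP x.
  have [W [Wx WU [b [g tE]]]] := tP x.
  exists (opensI V W); split=> [//|y [/VU]//|].
  exists (a * b), (f * g) => y [/sE[yf sy] /tE[yg ty]].
  exists (prime_compl_mul yf yg).
  rewrite -[(s * t) y]/(s y * t y) sy ty /frac.
  by rewrite -(@sr_piM (localization_setoid _)).
Defined.

Definition spec_sect : comPzRingType := subring_type spec_subring.

(* The section [a / 1]. *)
Fact spec_const_subproof (a : A) : spec_subring
  (fun x : {p | U p} => frac a (@prime_ideal1 _ (sval x))).
Proof.
move=> x; exists U; split; [exact: svalP|exact: subset_refl|].
by exists a, 1 => y _; exists (@prime_ideal1 _ (sval y)).
Qed.

Definition spec_const (a : A) : spec_sect := SubringElt (spec_const_subproof a).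

End SpecSections.

Section SpecRestriction.
Variables (U V : opens spec) (VU : V `<=` U).

Let incl (x : {p | V p}) : {p | U p} := exist _ (sval x) (VU (svalP x)).

Fact spec_res_subproof (s : spec_sect U) :
  spec_subring V (fun x : {p | V p} => subring_val s (incl x)).
Proof.
move=> x; have [W [Wx WU [a [f sE]]]] := subring_valP s (incl x).
exists (opensI V W); split; first by split=> //; exact: svalP.
  by move=> y [].
by exists a, f => y [_ Wy]; apply: (sE (incl y)).
Qed.

Definition spec_res (s : spec_sect U) : spec_sect V :=
  SubringElt (spec_res_subproof s).

Fact spec_res_is_zmod : zmod_morphism spec_res.
Proof. by move=> s t; apply: subring_val_inj. Qed.
Fact spec_res_is_monoid : monoid_morphism spec_res.
Proof. by split=> [|s t]; apply: subring_val_inj. Qed.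
HB.instance Definition _ :=
  GRing.isZmodMorphism.Build (spec_sect U) (spec_sect V) spec_res
    spec_res_is_zmod.
HB.instance Definition _ :=
  GRing.isMonoidMorphism.Build (spec_sect U) (spec_sect V) spec_res
    spec_res_is_monoid.

End SpecRestriction.

Fact spec_sect_ext (U : opens spec) (s t : spec_sect U) :
  (forall p (Up : U p), subring_val s (exist _ p Up) =
     subring_val t (exist _ p Up)) -> s = t.
Proof.
move=> st; apply: subring_val_inj.
by apply: functional_extensionality_dep => -[p Up]; apply: st.
Qed.

Fact spec_val_irr (U : opens spec) (s : spec_sect U) p (Up Up' : U p) :
  subring_val s (exist _ p Up) = subring_val s (exist _ p Up').
Proof. by rewrite (Prop_irrelevance Up Up'). Qed.

Definition spec_ringed_space : ringed_space.
Proof.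
apply: (@RingedSpace spec spec_sect
  (fun U V VU => spec_res VU : {rmorphism spec_sect U -> spec_sect V})).
- by move=> U UU s; apply: spec_sect_ext => p Up /=; apply: spec_val_irr.
- by move=> U V W VU WV WU s; apply: spec_sect_ext => p Wp /=; apply: spec_val_irr.
- move=> U I V VU UV s t st; apply: spec_sect_ext => p Up.
  have [i _ Vip] := UV p Up.
  have /(congr1 (fun s : spec_sect (V i) => subring_val s (exist _ p Vip))) := st i.
  by rewrite /= (spec_val_irr s _ Up) (spec_val_irr t _ Up).
- move=> U I V VU UV s sE.
  have idx (p : {p | U p}) : {i | V i (sval p)}.
    by apply: cid; have [i _ Vip] := UV _ (svalP p); exists i.
  pose t (p : {p | U p}) := subring_val (s (sval (idx p)))
    (exist (V (sval (idx p))) (sval p) (svalP (idx p))).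
  have tE p (Up : U p) i (Vip : V i p) :
      t (exist _ p Up) = subring_val (s i) (exist _ p Vip).
    rewrite /t /=; case: (idx _) => j /= Vjp.
    have /(congr1 (fun s : spec_sect (opensI (V j) (V i)) =>
      subring_val s (exist _ p (conj Vjp Vip)))) := sE j i.
    by move=> /= ij; apply: etrans (etrans _ ij) _; apply: spec_val_irr.
  have tP : spec_subring U t.
    move=> x; have [i _ Vix] := UV _ (svalP x).
    have [W [Wx WV [a [f sf]]]] := subring_valP (s i) (exist _ (sval x) Vix).
    exists W; split=> //; first by move=> y /WV/VU.
    exists a, f => -[p Up] Wp; have [yf syf] := sf (exist _ p (WV _ Wp)) Wp.
    by exists yf; rewrite (tE _ _ i (WV _ Wp)).
  exists (SubringElt tP) => i0; apply: spec_sect_ext => p Vip.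
  exact: tE.
Defined.

End Spec.

Arguments spec_const {A} U a.

(** * Schemes *)

Record scheme := Scheme {
  scheme_lrs :> locally_ringed_space;
  scheme_affine : forall P : scheme_lrs,
    exists (A : comPzRingType) (j : morphism (spec_ringed_space A) scheme_lrs),
      open_immersion j /\ range j P
}.

Section SchemesOverAField.
Variables (k : fieldType) (X : scheme) (f : morphism X (spec_ringed_space k)).

(* The [k]-algebra structure of [O_X(X)] given by [f].  The restriction only
   identifies the open set [f @^-1` setT] with [setT]. *)
Definition scalar (c : k) : rs_sect (opensT X) :=
  rs_res (U := opens_preimage (mor_cont f) (opensT _)) (V := opensT X)
    (@subset_refl _ setT)
    (mor_sharp f (opensT _) (spec_const _ c)).

Definition stalk_scalar (P : X) (c : k) : stalk P :=
  germ (U := opensT X) I (scalar c).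

Definition algebra_finite_type (A : comPzRingType) (h : {rmorphism k -> A}) :=
  exists m (phi : {rmorphism {mpoly k[m]} -> A}),
    (forall c, phi c%:MP = h c) /\ forall a, exists p, phi p = a.

(* [X] is covered by finitely many open affine subschemes [Spec A_i], where
   [A_i] is a finitely generated algebra for the [k]-algebra structure induced
   by [f]. *)
Definition scheme_finite_type : Prop :=
  exists N (A : 'I_N -> comPzRingType)
    (j : forall i, morphism (spec_ringed_space (A i)) X),
  [/\ forall i, open_immersion (j i),
      forall P : X, exists i, range (j i) P &
      forall i, exists h : {rmorphism k -> A i},
        (forall c, mor_sharp (j i) (opensT X) (scalar c) = spec_const _ (h c)) /\
        algebra_finite_type h].

Definition rational_point (P : X) : Prop :=
  bijective (fun c : k => quot_pi (lrs_max P) (stalk_scalar P c)).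

End SchemesOverAField.

(** * Power series *)

Section PowerSeries.
Variables (R : comNzRingType) (n : nat).

(* [R[[x_1, ..., x_n]]]; a series is the function giving the coefficient of
   each monomial. *)
Definition pseries := 'X_{1..n} -> R.

Implicit Types f g h : pseries.

HB.instance Definition _ := gen_eqMixin pseries.
HB.instance Definition _ := gen_choiceMixin pseries.

Definition psC (c : R) : pseries := fun m => if m == 0%MM then c else 0.

Let addps f g : pseries := fun m => f m + g m.
Let oppps f : pseries := fun m => - f m.
Let mulps f g : pseries := fun m =>
  \sum_(k : 'X_{1..n < (mdeg m).+1, (mdeg m).+1} | m == (k.1 + k.2)%MM)
    f k.1 * g k.2.

Let addpsA : associative addps.
Proof. by move=> f g h; apply: funext => m; apply: addrA. Qed.
Let addpsC : commutative addps.
Proof. by move=> f g; apply: funext => m; apply: addrC. Qed.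
Let add0ps : left_id (fun=> 0) addps.
Proof. by move=> f; apply: funext => m; apply: add0r. Qed.
Let addNps : left_inverse (fun=> 0) oppps addps.
Proof. by move=> f; apply: funext => m; apply: addNr. Qed.

HB.instance Definition _ :=
  GRing.isZmodule.Build pseries addpsA addpsC add0ps addNps.

(* Truncation, used to transfer the ring axioms from polynomials. *)
Let tr (N : nat) f : {mpoly R[n]} := \sum_(m : 'X_{1..n < N}) f m *: 'X_[m].

Let trE N f m : (mdeg m < N)%N -> (tr N f)@_m = f m.
Proof. exact: mcoeff_mpoly. Qed.

Let mulpsE f g (p q : {mpoly R[n]}) m :
  (forall k, (mdeg k <= mdeg m)%N -> p@_k = f k) ->
  (forall k, (mdeg k <= mdeg m)%N -> q@_k = g k) ->
  mulps f g m = (p * q)@_m.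
Proof.
move=> pf qg; rewrite mcoeffM /mulps; apply: eq_bigr => -[k1 k2] _ /=.
by rewrite pf ?qg // -ltnS bmdeg.
Qed.

Let mulps_tr N f g m : (mdeg m < N)%N -> mulps f g m = (tr N f * tr N g)@_m.
Proof.
by move=> mN; apply: mulpsE => l lm; apply/trE/(leq_ltn_trans lm).
Qed.

Let mulpsA : associative mulps.
Proof.
move=> f g h; apply: funext => m; pose N := (mdeg m).+1.
rewrite (@mulpsE _ _ (tr N f) (tr N g * tr N h)); first last.
- by move=> l lm; rewrite -mulps_tr.
- by move=> l lm; rewrite trE.
rewrite (@mulpsE _ _ (tr N f * tr N g) (tr N h)) ?mulrA // => l lm.
  by rewrite -mulps_tr.
by rewrite trE.
Qed.
Let mulpsC : commutative mulps.
Proof. by move=> f g; apply: funext => m; rewrite !(mulps_tr _ _ (ltnSn _)) mulrC. Qed.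
Let mul1ps : left_id (psC 1) mulps.
Proof.
move=> f; apply: funext => m; pose N := (mdeg m).+1.
rewrite (@mulpsE _ _ 1 (tr N f)); first by rewrite mul1r trE.
  by move=> l _; rewrite mcoeff1 /psC; case: eqP.
by move=> l lm; rewrite trE.
Qed.
Let mulpsDl : left_distributive mulps addps.
Proof.
move=> f g h; apply: funext => m; rewrite /mulps /addps -big_split /=.
by apply: eq_bigr => l _; rewrite mulrDl.
Qed.
Let oneps_neq0 : psC 1 != 0.
Proof.
apply/eqP => /(congr1 (fun f : pseries => f 0%MM)); rewrite /psC eqxx.
by move/eqP; rewrite oner_eq0.
Qed.

HB.instance Definition _ := GRing.Zmodule_isComNzRing.Build pseries
  mulpsA mulpsC mul1ps mulpsDl oneps_neq0.

Definition psderiv (i : 'I_n) f : pseries :=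
  fun m => f (m + U_(i))%MM *+ (m i).+1.

Definition gradient_ideal_of f : ideal pseries :=
  ideal_gen (range (fun i : 'I_n => psderiv i f)).

Definition gradient_ideal (I : ideal pseries) : Prop :=
  exists f, I = gradient_ideal_of f.

End PowerSeries.

(** * Gradient schemes *)

Section GradientSchemes.
Variables (k : fieldType) (X : scheme) (f : morphism X (spec_ringed_space k)).
Variable P : X.

(* The completed local ring at [P] is isomorphic to [k[[x_1, ..., x_n]] / I] as
   a [k]-algebra.  Such an isomorphism of rings maps the maximal ideal onto the
   maximal ideal, hence is a homeomorphism for the adic topologies. *)
Definition complete_presentation (n : nat) (I : ideal (pseries k n)) : Prop :=
  exists phi : {rmorphism completion (lrs_max P) -> quot I},
    bijective phi /\
    forall c, phi (to_completion _ (stalk_scalar f P c)) = 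
      quot_pi I (psC c : pseries k n).

Definition gradient_scheme : Prop :=
  exists n (I : ideal (pseries k n)),
    gradient_ideal I /\ complete_presentation I.

Definition principal_gradient_scheme : Prop :=
  exists n (I : ideal (pseries k n)),
    [/\ gradient_ideal I, complete_presentation I & ideal_principal I].

End GradientSchemes.

(* Main.v *)
From HB Require Import structures.
Require Import Defs.
From mathcomp Require Import all_boot all_order all_algebra.
From mathcomp Require Import boolp classical_sets topology_structure mpoly.
From mathcomp Require Import ring zify.

(** The proof has a formal part, on power series, and an algebraic part, which
    brings the result back from the completion to the local ring.

    Formal part.  Suppose that the partial derivatives of [f] generate a
    principal ideal [(g)] of [S = k[[x_1, ..., x_n]]], nonzero and proper.  As
    [S] is a local domain, one of them, say [d_i f], generates [(g)], and the
    others are [d_l f = a_l d_i f].  Thus [f] is constant along the formal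
    vector fields [d_l - a_l d_i].  A series is determined by its restriction
    to [x_l = 0] and its image under such a vector field, and every restriction
    extends to a series that is constant along it ([flow_unique],
    [flow_exists]).  Starting from the restriction of [f - f(0)] to the
    [x_i]-axis, which is a unit times a power of [x_i], one finds that
    [f - f(0)] is a unit times a power of a parameter [y].  Hence [(g) = (y ^ e.+1)]
    ([principal_gradient_ideal]); in suitable coordinates this is the ideal of
    a power of a variable ([regular_data_power]).

    Back to the local ring.  The local ring [R] at the point is a localization
    at the origin of an algebra generated by finitely many coordinates
    ([point_local_presentation]), and the isomorphism of its completion with
    [S / (g)] reflects the powers of the maximal ideal
    ([completion_lift_relation]).  The reduction of [S / (y ^ e.+1)] is
    [S / (y)], which is regular of dimension [n - 1]; what has to be shown is
    that the reduction of [R] is no larger, that is, if [e > 0], that some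
    nilpotent element of [R] corresponds to a unit times [y].  Here one needs
    that [R] is of finite type: a relation [g0] between the coordinates whose value is a unit times
    [y ^ e.+1] is differentiated [e] times by a derivation of the polynomial
    ring that kills the remaining relations.  In characteristic zero the value
    becomes a unit times [y] ([nilpotent_of_order_one]).

    Consequently the maximal ideal of the reduction of [R] is generated by
    [n - 1] elements (or [n], if [g = 0]), while prime ideals of [S] generated
    by variables give a chain of primes of this length in [R]
    ([lift_prime_chain]).  That no chain is longer follows by counting
    dimensions ([chain_length_le]): independent monomials attached to a chain of
    length [h] number [L ^ h], and they live in a quotient by a power of the
    maximal ideal with exponent linear in [L].  The Noetherian input, Hilbert's
    basis theorem ([hilbert_basis]) and a uniform Artin-Rees bound
    ([artin_rees_colon]), also yields Krull's intersection theorem and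
    Nakayama's lemma. *)

Set Implicit Arguments.
Unset Strict Implicit.
Unset Printing Implicit Defensive.

Import Order.TTheory GRing.Theory.
Local Open Scope ring_scope.
Local Open Scope classical_set_scope.

(** * Polynomial rings over a field are Noetherian *)

Lemma mpoly_ring_ind (R : nzRingType) n (Q : {mpoly R[n]} -> Prop) :
  (forall c, Q c%:MP) -> (forall i, Q 'X_i) ->
  (forall p q, Q p -> Q q -> Q (p + q)) ->
  (forall p q, Q p -> Q q -> Q (p * q)) -> forall p, Q p.
Proof.
move=> QC QX QD QM p; elim/mpolyind: p => [|c m p _ _ Qp].
  by rewrite -mpolyC0.
apply: (QD) => //; rewrite -mul_mpolyC; apply: (QM) => //.
rewrite mpolyXE_id; apply: (big_ind Q) => [||i _]; last 1 first.
- elim: (m i) => [|k IH]; first by rewrite expr0 -mpolyC1; apply: QC.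
  by rewrite exprS; apply: (QM).
- by rewrite -mpolyC1; apply: QC.
- exact: QM.
Qed.

(** From any position on, the minimum of the remaining values is attained; the
    successive positions of such minima give the subsequence. *)
Lemma nondecreasing_subseq (u : nat -> nat) :
  exists s : nat -> nat, (forall i j, (i < j)%N -> (s i < s j)%N) /\
    forall i j, (i <= j)%N -> (u (s i) <= u (s j))%N.
Proof.
have next N : {j | (N <= j)%N & forall i, (N <= i)%N -> (u j <= u i)%N}.
  apply: cid2.
  have ex : exists v, `[< exists2 j, (N <= j)%N & u j = v >].
    by exists (u N); apply/asboolP; exists N.
  case: (ex_minnP ex) => v /asboolP[j Nj <-] vmin; exists j => // i Ni.
  by apply: vmin; apply/asboolP; exists i.
pose s := fix s n := if n is n'.+1 then s2val (next (s n').+1)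
                     else s2val (next 0%N).
have sS n : (s n < s n.+1)%N by rewrite /=; case: (next _).
have s_incr i j : (i < j)%N -> (s i < s j)%N.
  elim: j => // j IH; rewrite ltnS leq_eqVlt => /predU1P[->|/IH ij] //.
  exact: ltn_trans ij (sS j).
have smin n i : (s n <= i)%N -> (u (s n) <= u i)%N.
  case: n => [|n] /=; case: (next _) => j Nj jmin /= ji; apply: jmin => //.
  exact: leq_trans Nj ji.
exists s; split=> // i j; rewrite leq_eqVlt => /predU1P[->|ij] //.
by apply: smin; apply/ltnW/s_incr.
Qed.

(** Dickson's lemma: subsequences along which one more exponent is nondecreasing
    are extracted for all variables in turn. *)
Lemma dickson n (f : nat -> 'X_{1..n}) : exists i j, (i < j)%N /\ (f i <= f j)%MM.
Proof.
suff H (l : seq 'I_n) : exists s : nat -> nat,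
    (forall i j, (i < j)%N -> (s i < s j)%N) /\
    forall k, k \in l -> forall i j, (i <= j)%N -> (f (s i) k <= f (s j) k)%N.
  have [s [s_incr smono]] := H (enum 'I_n).
  exists (s 0%N), (s 1%N); split; first exact: s_incr.
  by apply/mnm_lepP => k; apply: smono; rewrite ?mem_enum.
elim: l => [|k l [s [s_incr smono]]]; first by exists id.
have [t [t_incr tmono]] := nondecreasing_subseq (fun i => f (s i) k).
exists (s \o t); split=> [i j ij|k' /predU1P[->|k'l] i j ij] /=.
- exact/s_incr/t_incr.
- exact: tmono.
- apply: smono => //; move: ij; rewrite leq_eqVlt => /predU1P[->|/t_incr/ltnW] //.
Qed.

Definition mpoly_span (k : nzRingType) n (l : seq {mpoly k[n]})
    (p : {mpoly k[n]}) : Prop :=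
  exists c : nat -> {mpoly k[n]}, p = \sum_(i < size l) c i * l`_i.

Lemma mpoly_span_mem (k : nzRingType) n (l : seq {mpoly k[n]}) i :
  (i < size l)%N -> mpoly_span l l`_i.
Proof.
move=> il; exists (fun j => if j == i then 1 else 0).
rewrite (bigD1 (Ordinal il)) //= eqxx mul1r big1 ?addr0 // => j.
by rewrite -val_eqE /= => /negPf->; rewrite mul0r.
Qed.

Lemma mpoly_spanD (k : nzRingType) n (l : seq {mpoly k[n]}) p q :
  mpoly_span l p -> mpoly_span l q -> mpoly_span l (p + q).
Proof.
move=> [c ->] [d ->]; exists (fun i => c i + d i).
by rewrite -big_split; apply: eq_bigr => i _; rewrite mulrDl.
Qed.

Lemma mpoly_spanM (k : nzRingType) n (l : seq {mpoly k[n]}) a p :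
  mpoly_span l p -> mpoly_span l (a * p).
Proof.
move=> [c ->]; exists (fun i => a * c i).
by rewrite mulr_sumr; apply: eq_bigr => i _; rewrite mulrA.
Qed.

(** One step of multivariate division: [a * q] cancels the leading term of [p]. *)
Lemma mlead_cancel (k : fieldType) n (p q : {mpoly k[n]}) :
  q != 0 -> p != 0 -> (mlead q <= mlead p)%MM ->
  exists a, p - a * q != 0 -> (mlead (p - a * q)%R < mlead p)%O.
Proof.
move=> q0 p0 qp; have lq : mleadc q != 0 by rewrite mleadc_eq0.
have lp : mleadc p != 0 by rewrite mleadc_eq0.
pose c := mleadc p / mleadc q; have c0 : c != 0 by rewrite mulf_neq0 ?invr_neq0.
pose m := (mlead p - mlead q)%MM.
have a0 : c *: 'X_[m] != 0 :> {mpoly k[n]}.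
  by rewrite -msupp_eq0 msuppMCX.
have la : mlead (c *: 'X_[m] : {mpoly k[n]}) = m by rewrite mleadZ ?mleadXm.
have laq : mlead (c *: 'X_[m] * q) = mlead p by rewrite mleadM // la submK.
exists (c *: 'X_[m]); set r := p - _ => r0.
have le_r : (mlead r <= mlead p)%O.
  by apply: le_trans (mleadB_le _ _) _; rewrite laq leUx lexx.
rewrite lt_neqAle le_r andbT; apply/eqP => er.
have : mleadc r = 0.
  rewrite er mcoeffB -[X in _ - (_ * _)@_X](submK qp) -/m -scalerAl mcoeffZ.
  rewrite [_ * q]mulrC mcoeffMX /c.
  by rewrite divfK // subrr.
by move/eqP; rewrite mleadc_eq0 (negPf r0).
Qed.

(** Hilbert's basis theorem.  Otherwise one can choose successively elements of
    [W] outside the ideal generated by the previous ones, with minimal leading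
    monomial among the elements of the ideal generated by [W]; by Dickson's
    lemma one of these leading monomials divides a later one, which contradicts
    minimality. *)
Theorem hilbert_basis (k : fieldType) n (W : set {mpoly k[n]}) :
  exists l : seq {mpoly k[n]}, (forall i, (i < size l)%N -> W l`_i) /\
    forall p, W p -> mpoly_span l p.
Proof.
pose spanW p := exists l, (forall i, (i < size l)%N -> W l`_i) /\ mpoly_span l p.
have spanWD p q : spanW p -> spanW q -> spanW (p + q).
  move=> [l [lW [c ->]]] [l' [l'W [c' ->]]]; exists (l ++ l'); split=> [i il|].
    rewrite nth_cat; case: ltnP => [/lW//|li]; apply: l'W.
    by rewrite ltn_subLR // -size_cat.
  exists (fun i => if (i < size l)%N then c i else c' (i - size l)%N).
  rewrite size_cat big_split_ord /=; congr (_ + _); apply: eq_bigr => i _.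
    by rewrite nth_cat ltn_ord.
  by rewrite nth_cat ltnNge leq_addr /= addKn.
have spanWM a p : spanW p -> spanW (a * p).
  by move=> [l [lW sp]]; exists l; split=> //; apply: mpoly_spanM.
have spanWW p : W p -> spanW p.
  move=> Wp; exists [:: p]; split=> [[]//|].
  exact: (@mpoly_span_mem _ _ [:: p] 0).
apply: contrapT => noL.
have noL' (l : seq {mpoly k[n]}) : (forall i, (i < size l)%N -> spanW l`_i) ->
    exists2 p, spanW p & ~ mpoly_span l p.
  move=> lW; apply: contrapT => nex; apply: noL.
  have : exists l', (forall i, (i < size l')%N -> W l'`_i) /\
      forall i, (i < size l)%N -> mpoly_span l' l`_i.
    elim: l lW {nex} => [|q l IH] lW; first by exists [::].
    have [l1 [l1W sq]] := lW 0%N isT.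
    have [i il|l2 [l2W sl]] := IH; first exact: (lW i.+1).
    exists (l1 ++ l2); split=> [i il|[_|i il]].
    - rewrite nth_cat; case: ltnP => [/l1W//|li]; apply: l2W.
      by rewrite ltn_subLR // -size_cat.
    - have [c ->] := sq; exists (fun i => if (i < size l1)%N then c i else 0).
      rewrite size_cat big_split_ord /= [X in _ = _ + X]big1 => [|i _].
        by rewrite addr0; apply: eq_bigr => i _; rewrite nth_cat ltn_ord.
      by rewrite ltnNge leq_addr mul0r.
    - have [c /= ->] := sl i il.
      exists (fun i => if (i < size l1)%N then 0 else c (i - size l1)%N).
      rewrite size_cat big_split_ord /= [X in _ = X + _]big1 => [|j _].
        rewrite add0r; apply: eq_bigr => j _.
        by rewrite nth_cat ltnNge leq_addr /= addKn.
      by rewrite ltn_ord mul0r.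
  move=> [l' [l'W sl]]; exists l'; split=> // p /spanWW sp.
  have /contrapT[c ->] : ~ ~ mpoly_span l p by move=> np; apply: nex; exists p.
  apply: (big_ind (mpoly_span l')) => [|x y|i _].
  - by exists (fun=> 0); rewrite big1 // => i _; rewrite mul0r.
  - exact: mpoly_spanD.
  - by apply/mpoly_spanM/sl.
have step (l : seq {mpoly k[n]}) : (forall i, (i < size l)%N -> spanW l`_i) ->
    exists p, [/\ spanW p, ~ mpoly_span l p &
      forall q, spanW q -> ~ mpoly_span l q -> (mlead p <= mlead q)%O].
  move=> /noL'[p sp np]; move: {2}(mlead p) (erefl (mlead p)) => m.
  elim/(well_founded_ind (@ltom_wf n)): m p sp np => m IH p sp np mp.
  have [[q [sq nq qm]]|none] :=
    pselect (exists q, [/\ spanW q, ~ mpoly_span l q & (mlead q < m)%O]).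
    exact: (IH _ qm q).
  exists p; split=> // q sq nq; rewrite mp leNgt; apply/negP => qm.
  by apply: none; exists q.
pose good (l : seq {mpoly k[n]}) := forall i, (i < size l)%N -> spanW l`_i.
pose next (L : {l | good l}) := cid (step (sval L) (svalP L)).
have good_rcons (L : {l | good l}) : good (rcons (sval L) (sval (next L))).
  move=> i; rewrite size_rcons ltnS nth_rcons leq_eqVlt.
  by case: ltnP => [/(svalP L)//|_]; rewrite orbF => ->; case: (svalP (next L)).
pose L := fix L i := if i is j.+1 then exist good _ (good_rcons (L j))
                     else exist good [::] (fun i (e : (i < 0)%N) => False_ind _ (notF e)).
pose p i := sval (next (L i)).
have pP i : [/\ spanW (p i), ~ mpoly_span (sval (L i)) (p i) &
   forall q, spanW q -> ~ mpoly_span (sval (L i)) q -> (mlead (p i) <= mlead q)%O].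
  exact: (svalP (next (L i))).
have sizeL i : size (sval (L i)) = i by elim: i => //= i IH; rewrite size_rcons IH.
have nthL i j : (i < j)%N -> (sval (L j))`_i = p i.
  elim: j => //= j IH; rewrite ltnS nth_rcons sizeL leq_eqVlt => /predU1P[->|ij].
    by rewrite ltnn eqxx.
  by rewrite ij IH.
have [i [j [ij leij]]] := dickson (fun i => mlead (p i)).
have pspan : mpoly_span (sval (L j)) (p i).
  by rewrite -(nthL _ _ ij); apply: mpoly_span_mem; rewrite sizeL.
have p0 i' : p i' != 0.
  apply/eqP => e; have [_ + _] := pP i'; apply; rewrite e.
  by exists (fun=> 0); rewrite big1 // => ? _; rewrite mul0r.
have [a lt_a] := mlead_cancel (p0 i) (p0 j) leij.
have [sj nj minj] := pP j; have [si _ _] := pP i.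
have nq : ~ mpoly_span (sval (L j)) (p j - a * p i).
  move=> sq; apply: nj; rewrite -(subrK (a * p i) (p j)).
  by apply: mpoly_spanD => //; apply: mpoly_spanM.
have sq : spanW (p j - a * p i).
  by apply: spanWD => //; rewrite -mulNr; apply: spanWM.
have q0 : p j - a * p i != 0.
  apply/eqP => e; apply: nq; rewrite e.
  by exists (fun=> 0); rewrite big1 // => ? _; rewrite mul0r.
by have := lt_a q0; rewrite ltNge minj.
Qed.

Lemma mpoly_hom_eq (R : nzRingType) n (S : pzRingType)
    (f g : {rmorphism {mpoly R[n]} -> S}) :
  (forall c, f c%:MP = g c%:MP) -> (forall i, f 'X_i = g 'X_i) -> f =1 g.
Proof.
move=> fgC fgX; elim/mpoly_ring_ind => [c|i|p q ep eq|p q ep eq] //.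
  by rewrite !rmorphD ep eq.
by rewrite !rmorphM ep eq.
Qed.

(** * Local rings of finitely generated algebras at a rational point *)

Arguments ideal_exp : simpl never.
Arguments ideal_gen : simpl never.
Arguments ideal_set : simpl never.

Section IdealFacts.
Variable R : comPzRingType.
Implicit Types (I J : ideal R) (x y : R).

Lemma ideal_gen_sub (S : set R) x : S x -> ideal_gen S x.
Proof. by move=> Sx I; apply. Qed.

Lemma ideal_sum (T : Type) (l : seq T) (P : pred T) (F : T -> R) I :
  (forall i, P i -> I (F i)) -> I (\sum_(i <- l | P i) F i).
Proof. by move=> IF; apply: big_ind => //; [apply: ideal0|apply: idealD]. Qed.

Lemma idealMr I a x : I x -> I (x * a).
Proof. by rewrite mulrC; apply: idealM. Qed.

Lemma ideal_genP (T : finType) (g : T -> R) x :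
  ideal_gen (range g) x <-> exists c : T -> R, x = \sum_i c i * g i.
Proof.
split=> [gx|[c ->]]; last first.
  by apply: ideal_sum => i _; apply/idealM/ideal_gen_sub; exists i.
have @J : ideal R.
  exists [set x : R | exists c : T -> R, x = \sum_i c i * g i].
  - by exists (fun=> 0); rewrite big1 // => i _; rewrite mul0r.
  - move=> _ _ [c ->] [d ->]; exists (fun i => c i + d i).
    by rewrite -big_split; apply: eq_bigr => i _; rewrite mulrDl.
  - move=> a _ [c ->]; exists (fun i => a * c i).
    by rewrite mulr_sumr; apply: eq_bigr => i _; rewrite mulrA.
apply: (gx J) => _ [i _ <-]; exists (fun j => (j == i)%:R).
rewrite (bigD1 i) //= eqxx mul1r big1 ?addr0 // => j /negPf->.
by rewrite mul0r.
Qed.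

Lemma ideal_gen1P g x : ideal_gen [set g] x <-> exists c, x = c * g.
Proof.
split=> [gx|[c ->]]; last exact/idealM/ideal_gen_sub.
have @J : ideal R.
  exists [set x : R | exists c, x = c * g].
  - by exists 0; rewrite mul0r.
  - by move=> _ _ [c ->] [d ->]; exists (c + d); rewrite mulrDl.
  - by move=> a _ [c ->]; exists (a * c); rewrite mulrA.
by apply: (gx J) => _ ->; exists 1; rewrite mul1r.
Qed.

Lemma ideal_expS I s x y : I x -> ideal_exp I s y -> ideal_exp I s.+1 (x * y).
Proof. by move=> Ix Iy; apply: ideal_gen_sub; exists x, y. Qed.

Lemma ideal_exp_ind I J s :
  (forall x y, I x -> ideal_exp I s y -> J (x * y)) ->
  forall z, ideal_exp I s.+1 z -> J z.
Proof. by move=> IJ z; apply=> _ [x [y [Ix Iy ->]]]; apply: IJ. Qed.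

Lemma ideal_exp_le I s t : (s <= t)%N ->
  forall x, ideal_exp I t x -> ideal_exp I s x.
Proof.
elim: s t => [|s IH] [|t] // st x; apply: ideal_exp_ind => a b Ia Ib.
exact/ideal_expS/(IH t).
Qed.

Definition ideal_colon I y : ideal R.
Proof.
exists [set x : R | I (x * y)].
- by rewrite /mkset mul0r; apply: ideal0.
- by move=> a b Ia Ib; rewrite /mkset mulrDl; apply: idealD.
- by move=> a b Ib; rewrite /mkset -mulrA; apply: idealM.
Defined.

Lemma ideal_expM I s t x y :
  ideal_exp I s x -> ideal_exp I t y -> ideal_exp I (s + t) (x * y).
Proof.
elim: s x => [|s IH] x Ix Iy; first exact: idealM.
apply: (ideal_exp_ind (J := ideal_colon (ideal_exp I (s.+1 + t)) y)) Ix => a b Ia Ib.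
by change (ideal_exp I (s.+1 + t) (a * b * y)); rewrite -mulrA; apply: (@ideal_expS I (s + t)) => //; apply: IH.
Qed.

Lemma ideal_exp1 I x : I x -> ideal_exp I 1 x.
Proof. by move=> Ix; rewrite -[x]mulr1; apply: ideal_expS. Qed.

Lemma ideal_exp1E I x : ideal_exp I 1 x -> I x.
Proof. by apply: ideal_exp_ind => a b Ia _; apply: idealMr. Qed.

Lemma ideal_expX I x s : I x -> ideal_exp I s (x ^+ s).
Proof.
by move=> Ix; elim: s => [//|s IH]; rewrite exprS; apply: ideal_expS.
Qed.

Lemma unit_ideal I x : is_unit x -> I x -> I 1.
Proof. by move=> [y <-] Ix; apply: idealMr. Qed.

Lemma unit_cancel I x y : is_unit x -> I (x * y) -> I y.
Proof.
by move=> [z xz] Ixy; rewrite -[y]mul1r -xz mulrAC mulrC; apply: idealM.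
Qed.

End IdealFacts.

(** A local ring [R] whose elements are fractions [phi p / phi q] of polynomials
    with [q] not vanishing at the origin: a localization at the origin of an
    algebra generated by the coordinates [phi 'X_i]. *)
Record local_presentation (k : fieldType) N (R : comPzRingType) (m : ideal R)
    (phi : {rmorphism {mpoly k[N]} -> R}) : Prop := LocalPresentation {
  lp_one : ~ m 1;
  lp_unit : forall x, ~ m x -> is_unit x;
  lp_var : forall i, m (phi 'X_i);
  lp_frac : forall r, exists p q, q@_0%MM != 0 /\ phi q * r = phi p
}.

Section LocalPresentation.
Variables (k : fieldType) (N : nat) (R : comPzRingType) (m : ideal R).
Variables (phi : {rmorphism {mpoly k[N]} -> R}) (lp : local_presentation m phi).

Let phiD p q : phi (p + q) = phi p + phi q. Proof. exact: rmorphD. Qed.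
Let phiM p q : phi (p * q) = phi p * phi q. Proof. exact: rmorphM. Qed.
Let phi0 : phi 0 = 0. Proof. exact: rmorph0. Qed.
Let phi_sum (I : Type) (l : seq I) P F :
  phi (\sum_(i <- l | P i) F i) = \sum_(i <- l | P i) phi (F i).
Proof. exact: rmorph_sum. Qed.

Lemma scalar_unit (c : k) : c != 0 -> is_unit (phi c%:MP).
Proof. by move=> c0; exists (phi c^-1%:MP); rewrite -rmorphM -mpolyCM divff // rmorph1. Qed.

Lemma mpoly_const_split (p : {mpoly k[N]}) :
  exists c, p = (p@_0%MM)%:MP + \sum_i c i * 'X_i.
Proof.
elim/mpoly_ring_ind: p => [a|i|p q [c ep] [d eq]|p q [c ep] [d eq]].
- exists (fun=> 0); rewrite big1 ?addr0 => [|i _]; last by rewrite mul0r.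
  by rewrite mcoeffC eqxx mulr1.
- exists (fun j => (j == i)%:R); rewrite (bigD1 i) //= eqxx mul1r big1 => [|j /negPf->].
    by rewrite addr0 mcoeffX mnm1_eq0 mpolyC0 add0r.
  by rewrite mul0r.
- exists (fun i => c i + d i); rewrite mcoeffD mpolyCD {1}ep {1}eq addrACA.
  by rewrite -big_split; congr (_ + _); apply: eq_bigr => i _; rewrite mulrDl.
- exists (fun i => (p@_0%MM)%:MP * d i + c i * q).
  rewrite (_ : (p * q)@_0%MM = p@_0%MM * q@_0%MM) ?mpolyCM; last exact: rmorphM.
  under eq_bigr do rewrite mulrDl -mulrA mulrAC.
  rewrite big_split /= -mulr_sumr -mulr_suml addrA -mulrDr -eq -mulrDl.
  by rewrite -ep.
Qed.

Lemma lp_const p : m (phi p - phi (p@_0%MM)%:MP).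
Proof.
have [c {1}->] := mpoly_const_split p; rewrite rmorphD addrAC subrr add0r.
rewrite rmorph_sum; apply: ideal_sum => i _.
by rewrite rmorphM; apply/idealM/(lp_var lp).
Qed.

Lemma lp_memE p : m (phi p) <-> p@_0%MM = 0.
Proof.
split=> [mp|p0].
  apply/eqP; apply: contrapT => /negP p0; apply: (lp_one lp).
  apply: unit_ideal (scalar_unit p0) _.
  by rewrite -[phi _](subKr (phi p)); apply: idealB => //; apply: lp_const.
by rewrite -[phi p]subr0 -phi0 -mpolyC0 -p0; apply: lp_const.
Qed.

Lemma lp_unitP q : q@_0%MM != 0 -> is_unit (phi q).
Proof. by move=> /eqP q0; apply: (lp_unit lp) => mq; apply: q0; apply/lp_memE. Qed.

Lemma mcoeff0M (p q : {mpoly k[N]}) : (p * q)@_0%MM = p@_0%MM * q@_0%MM.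
Proof. exact: rmorphM. Qed.

Lemma lp_residue r : exists c : k, m (r - phi c%:MP).
Proof.
have [p [q [q0 e]]] := lp_frac lp r; exists (p@_0%MM / q@_0%MM).
apply: (unit_cancel (lp_unitP q0)); rewrite mulrBr e -rmorphM -rmorphB; apply/lp_memE.
rewrite mcoeffB; apply/eqP; rewrite subr_eq0; apply/eqP.
by rewrite mcoeff0M mpolyCK mulrCA divff // mulr1.
Qed.

Lemma lp_mem_frac r : m r -> exists p q,
  [/\ q@_0%MM != 0, phi q * r = phi p & p@_0%MM = 0].
Proof.
move=> mr; have [p [q [q0 e]]] := lp_frac lp r; exists p, q; split=> //.
by apply/lp_memE; rewrite -e; apply: idealM.
Qed.

Lemma lp_noetherian : noetherian R.
Proof.
move=> I; have [l [lI lspan]] := hilbert_basis [set p | I (phi p)].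
exists (size l), (fun i => phi l`_i); apply: idealP => r; split=> [Ir|].
  have [p [q [q0 e]]] := lp_frac lp r.
  apply: (unit_cancel (lp_unitP q0)); rewrite e.
  have [|c ->] := lspan p; first by rewrite /= -e; apply: idealM.
  rewrite rmorph_sum; apply/ideal_genP; exists (fun i : 'I_(size l) => phi (c i)).
  by apply: eq_bigr => i _; rewrite rmorphM.
move=> /ideal_genP[c ->]; apply: ideal_sum => i _; apply: idealM.
exact: lI.
Qed.

(** The Rees algebra is presented by doubling the variables: the first copy maps
    to the degree zero part, the second copy to generators of the maximal ideal
    in degree one. *)

Definition rees_fold (F : {mpoly k[N + N]}) : {mpoly k[N]} :=
  mmap (@mpolyC N k)
    (fun v : 'I_(N + N) => match split v with inl i => 'X_i | inr i => 'X_i end) F.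
HB.instance Definition _ := GRing.RMorphism.copy rees_fold (mmap (@mpolyC N k)
    (fun v : 'I_(N + N) => match split v with inl i => 'X_i | inr i => 'X_i end)).

Definition rees_grade (F : {mpoly k[N + N]}) : {poly {mpoly k[N + N]}} :=
  mmap (polyC \o @mpolyC (N + N) k)
    (fun v => match split v with inl i => ('X_v)%:P | inr i => 'X * ('X_v)%:P end) F.
HB.instance Definition _ := GRing.RMorphism.copy rees_grade
  (mmap (polyC \o @mpolyC (N + N) k)
    (fun v => match split v with inl i => ('X_v)%:P | inr i => 'X * ('X_v)%:P end)).

Definition rees_homog s F := rees_grade F = F%:P * 'X^s.

Definition rees_lift (p : {mpoly k[N]}) : {mpoly k[N + N]} :=
  mmap (@mpolyC (N + N) k) (fun i : 'I_N => 'X_(lshift N i)) p.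
HB.instance Definition _ := GRing.RMorphism.copy rees_lift
  (mmap (@mpolyC (N + N) k) (fun i : 'I_N => 'X_(lshift N i))).

Let foldD F G : rees_fold (F + G) = rees_fold F + rees_fold G.
Proof. exact: rmorphD. Qed.
Let foldM F G : rees_fold (F * G) = rees_fold F * rees_fold G.
Proof. exact: rmorphM. Qed.
Let fold0 : rees_fold 0 = 0.
Proof. exact: rmorph0. Qed.
Let gradeD F G : rees_grade (F + G) = rees_grade F + rees_grade G.
Proof. exact: rmorphD. Qed.
Let gradeM F G : rees_grade (F * G) = rees_grade F * rees_grade G.
Proof. exact: rmorphM. Qed.
Let grade0 : rees_grade 0 = 0.
Proof. exact: rmorph0. Qed.
Let fold_sum (I : Type) (l : seq I) P F :
  rees_fold (\sum_(i <- l | P i) F i) = \sum_(i <- l | P i) rees_fold (F i).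
Proof. exact: rmorph_sum. Qed.
Let grade_sum (I : Type) (l : seq I) P F :
  rees_grade (\sum_(i <- l | P i) F i) = \sum_(i <- l | P i) rees_grade (F i).
Proof. exact: rmorph_sum. Qed.
Lemma rees_foldC c : rees_fold c%:MP = c%:MP. Proof. exact: mmapC. Qed.
Lemma rees_gradeC c : rees_grade c%:MP = (c%:MP)%:P. Proof. exact: mmapC. Qed.
Lemma rees_foldX v : rees_fold 'X_v =
  match split v with inl i => 'X_i | inr i => 'X_i end.
Proof. by rewrite /rees_fold mmapX mmap1U. Qed.
Lemma rees_gradeX v : rees_grade 'X_v =
  match split v with inl i => ('X_v)%:P | inr i => 'X * ('X_v)%:P end.
Proof. by rewrite /rees_grade mmapX mmap1U. Qed.

Lemma rees_lift_fold p : rees_fold (rees_lift p) = p.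
Proof.
apply: (mpoly_hom_eq (f := rees_fold \o rees_lift) (g := idfun)) => [c|i].
  by rewrite /= /rees_lift mmapC rees_foldC.
by rewrite /= /rees_lift mmapX mmap1U rees_foldX (unsplitK (inl i)).
Qed.

Lemma rees_lift_homog p : rees_homog 0 (rees_lift p).
Proof.
rewrite /rees_homog expr0 mulr1.
apply: (mpoly_hom_eq (f := rees_grade \o rees_lift) (g := polyC \o rees_lift)).
  by move=> c; rewrite /= /rees_lift mmapC rees_gradeC.
by move=> i; rewrite /= /rees_lift mmapX mmap1U rees_gradeX (unsplitK (inl i)).
Qed.

Lemma rees_homogM s t F G :
  rees_homog s F -> rees_homog t G -> rees_homog (s + t) (F * G).
Proof.
by rewrite /rees_homog gradeM => -> ->; rewrite mulrACA -polyCM -exprD.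
Qed.

Lemma rees_homogD s F G :
  rees_homog s F -> rees_homog s G -> rees_homog s (F + G).
Proof. by rewrite /rees_homog gradeD => -> ->; rewrite -mulrDl -polyCD. Qed.

Lemma rees_coef_mem F s : ideal_exp m s (phi (rees_fold (rees_grade F)`_s)).
Proof.
elim/mpoly_ring_ind: F s => [c|v|F G IF IG|F G IF IG] s.
- rewrite rees_gradeC coefC; case: eqP => [->|_] //=.
  by rewrite fold0 phi0; apply: (ideal0 (ideal_exp m s)).
- rewrite rees_gradeX; case: splitP => i vi.
    rewrite coefC; case: eqP => [->|_] //=.
    by rewrite fold0 phi0; apply: (ideal0 (ideal_exp m s)).
  rewrite coefXM; case: s => [//|s]; rewrite /= coefC.
  case: eqP => [->|_]; last by rewrite fold0 phi0; apply: (ideal0 (ideal_exp m _)).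
  rewrite rees_foldX; apply: ideal_exp1.
  by case: splitP => j _; apply: (lp_var lp).
- rewrite gradeD coefD foldD phiD.
  by apply: (@idealD _ (ideal_exp m s)); [exact: IF|exact: IG].
- rewrite gradeM coefM fold_sum phi_sum.
  apply: ideal_sum => i _.
  rewrite foldM phiM; have := ideal_expM (IF i) (IG (s - i)%N).
  by rewrite subnKC // -ltnS.
Qed.

Lemma ideal_exp_rees s r : ideal_exp m s r ->
  exists q F, [/\ q@_0%MM != 0, rees_homog s F & phi q * r = phi (rees_fold F)].
Proof.
elim: s r => [|s IH] r.
  move=> _; have [p [q [q0 e]]] := lp_frac lp r; exists q, (rees_lift p).
  by split=> //; [apply: rees_lift_homog|rewrite rees_lift_fold].
have @J : ideal R.
  exists [set r : R | exists q F,
     [/\ q@_0%MM != 0, rees_homog s.+1 F & phi q * r = phi (rees_fold F)]].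
  - exists 1, 0; rewrite mcoeff1 eqxx oner_neq0 mulr0 fold0 phi0; split=> //.
    by rewrite /rees_homog grade0 mul0r.
  - move=> x y [q [F [q0 hF e]]] [q' [F' [q'0 hF' e']]].
    exists (q * q'), (rees_lift q' * F + rees_lift q * F'); split.
    + by rewrite mcoeff0M mulf_neq0.
    + apply: rees_homogD; rewrite -[s.+1]add0n; apply: rees_homogM => //;
        exact: rees_lift_homog.
    + rewrite foldD phiD !foldM.
      by rewrite !phiM !rees_lift_fold -e -e'; ring.
  - move=> a x [q [F [q0 hF e]]]; have [p' [q' [q'0 e']]] := lp_frac lp a.
    exists (q' * q), (rees_lift p' * F); split.
    + by rewrite mcoeff0M mulf_neq0.
    + by rewrite -[s.+1]add0n; apply: rees_homogM => //; apply: rees_lift_homog.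
    + rewrite foldM !phiM rees_lift_fold -e -e'; ring.
apply: (ideal_exp_ind (J := J)) => x y /lp_mem_frac[p [q [q0 e p0]]].
move=> /IH[q' [F [q'0 hF e']]].
have [c ep] := mpoly_const_split p; rewrite p0 mpolyC0 add0r in ep.
exists (q * q'), ((\sum_i rees_lift (c i) * 'X_(rshift N i)) * F); split.
- by rewrite mcoeff0M mulf_neq0.
- rewrite -add1n; apply: rees_homogM => //.
  apply: (big_ind (rees_homog 1)) => [||i _].
  + by rewrite /rees_homog grade0 mul0r.
  + exact: rees_homogD.
  + rewrite -[1%N]add0n; apply: rees_homogM; first exact: rees_lift_homog.
    by rewrite /rees_homog rees_gradeX (unsplitK (inr i)) mulrC.
- rewrite foldM !phiM mulrACA e e' ep; congr (phi _ * _).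
  rewrite fold_sum; apply: eq_bigr => i _.
  by rewrite foldM rees_lift_fold rees_foldX (unsplitK (inr i)).
Qed.

(** A uniform Artin-Rees bound for colon ideals.  The products [x r] modulo [I]
    of order [s] are represented by elements of degree [s] of the Rees algebra;
    the ideal that all of these generate is generated by finitely many of
    them, and [c] is the largest of their degrees. *)
Theorem artin_rees_colon (I : ideal R) (x : R) : exists c, forall s r a,
  I a -> ideal_exp m s (x * r - a) ->
  exists2 r', I (x * r') & ideal_exp m (s - c) (r - r').
Proof.
pose W : set {mpoly k[N + N]} := [set F | (exists s, rees_homog s F) /\
   exists r, I (phi (rees_fold F) - x * r)].
have [l [lW lspan]] := hilbert_basis W.
have degl i : exists s, (i < size l)%N -> rees_homog s l`_i.
  by have [/lW[[s hs] _]|_] := ltnP i (size l); [exists s|exists 0%N].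
have rl i : exists r, (i < size l)%N -> I (phi (rees_fold l`_i) - x * r).
  by have [/lW[_ [r Ir]]|_] := ltnP i (size l); [exists r|exists 0].
have [d degd] := choice degl; have [y Iy] := choice rl.
exists (\max_(i < size l) d i) => s r a Ia mxr.
have [q [F [q0 hF eF]]] := ideal_exp_rees mxr.
have [|g eFg] := lspan F.
  split; first by exists s.
  exists (phi q * r); rewrite -eF mulrBr mulrCA addrAC subrr add0r.
  exact/idealN/idealM.
have [qi qqi] := lp_unitP q0.
(* The components of degree [s - d i] of the coefficients suffice. *)
pose G i := if (d i <= s)%N then (rees_grade (g i))`_(s - d i) else 0.
have eF' : F = \sum_(i < size l) G i * l`_i.
  have := congr1 (fun P : {poly _} => P`_s) hF.
  rewrite coefMXn ltnn subnn coefC eqxx => <-.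
  rewrite eFg grade_sum coef_sum; apply: eq_bigr => i _.
  rewrite gradeM (degd _ (ltn_ord i)) mulrA coefMXn /G.
  by case: ltnP => [_|_]; rewrite ?mul0r // coefMC.
pose r0 := \sum_(i < size l) phi (rees_fold (G i)) * y i.
have mr0 : ideal_exp m (s - \max_(i < size l) d i) r0.
  apply: ideal_sum => i _; apply: idealMr; rewrite /G.
  case: leqP => _; last by rewrite fold0 phi0; apply: (ideal0 (ideal_exp m _)).
  apply: ideal_exp_le (rees_coef_mem _ _); apply: leq_sub2l.
  exact: (leq_bigmax i).
exists (r - qi * r0); last by rewrite subKr; apply: idealM.
apply: (unit_cancel (lp_unitP q0)).
have -> : phi q * (x * (r - qi * r0)) =
  (phi q * (x * r - a) - x * r0) + phi q * a - (phi q * qi - 1) * (x * r0) by ring.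
rewrite qqi subrr mul0r subr0; apply: idealD; last exact: idealM.
rewrite eF eF' /r0 fold_sum phi_sum mulr_sumr -sumrB.
apply: ideal_sum => i _; rewrite foldM phiM mulrCA -mulrBr; apply: idealM; exact: Iy.
Qed.

(** Krull's intersection theorem.  The Artin-Rees bound for [x * 1] gives an
    element [r], congruent to [1] modulo [m] and hence a unit, with [x * r] in
    [I]. *)
Lemma krull_intersection (I : ideal R) x :
  (forall s, exists2 a, I a & ideal_exp m s (x - a)) -> I x.
Proof.
move=> xI; have [c cP] := artin_rees_colon I x.
have [a Ia xa] := xI c.+1; rewrite -[x]mulr1 in xa.
have [r Ixr] := cP _ _ _ Ia xa; rewrite subSnn => /ideal_exp1E m1r.
have : is_unit r.
  by apply: (lp_unit lp) => mr; apply: (lp_one lp); rewrite -(subrK r 1); apply: idealD.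
by move=> ur; apply: (unit_cancel ur); rewrite mulrC.
Qed.

Lemma krull_zero x : (forall s, ideal_exp m s x) -> x = 0.
Proof.
move=> mx; have : ideal_gen [set 0] x.
  apply: krull_intersection => s; exists 0; first exact: ideal0.
  by rewrite subr0.
by move=> /ideal_gen1P[c ->]; rewrite mulr0.
Qed.

(** Nakayama's lemma for the maximal ideal: the hypothesis improves itself to all
    powers of [m], so that Krull's intersection theorem applies. *)
Lemma nakayama_max (I : ideal R) : (forall x, I x -> m x) ->
  (forall x, m x -> exists2 a, I a & ideal_exp m 2 (x - a)) ->
  forall x, m x -> I x.
Proof.
move=> Im mI.
have step s : forall x, ideal_exp m s.+1 x ->
    exists2 a, I a & ideal_exp m s.+2 (x - a).
  elim: s => [|s IH] x; first by move=> /ideal_exp1E/mI.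
  have @J : ideal R.
    exists [set x : R | exists2 a, I a & ideal_exp m s.+3 (x - a)].
    - by exists 0; rewrite ?subrr; apply: ideal0.
    - move=> y z [a Ia ya] [b Ib zb]; exists (a + b); first exact: idealD.
      by rewrite opprD addrACA; apply: idealD.
    - move=> c y [a Ia ya]; exists (c * a); first exact: idealM.
      by rewrite -mulrBr; apply: idealM.
  apply: (ideal_exp_ind (J := J)) => y z my /IH[a Ia za].
  exists (y * a); first exact: idealM.
  by rewrite -mulrBr; apply: ideal_expS.
move=> x mx; apply: krull_intersection; elim=> [|s [a Ia xa]].
  by exists 0; first exact: ideal0.
case: s xa => [|s] xa.
  by exists 0; rewrite ?subr0; [apply: ideal0|apply: ideal_exp1].
have [b Ib xab] := step _ _ xa; exists (a + b); first exact: idealD.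
by rewrite opprD addrA.
Qed.

End LocalPresentation.

(** * An upper bound for the length of chains of primes *)

Definition ideal_add (R : comPzRingType) (I J : ideal R) : ideal R.
Proof.
exists [set x : R | exists a b, [/\ I a, J b & x = a + b]].
- by exists 0, 0; rewrite addr0; split=> //; apply: ideal0.
- move=> _ _ [a [b [Ia Jb ->]]] [a' [b' [Ia' Jb' ->]]].
  by exists (a + a'), (b + b'); rewrite addrACA; split=> //; apply: idealD.
- move=> c _ [a [b [Ia Jb ->]]].
  by exists (c * a), (c * b); rewrite mulrDr; split=> //; apply: idealM.
Defined.

Section IdealAdd.
Variables (R : comPzRingType).
Implicit Types (I J : ideal R).

Lemma ideal_addP I J x : ideal_add I J x <-> exists2 a, I a & J (x - a).
Proof.
split=> [[a [b [Ia Jb ->]]]|[a Ia Jb]].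
  by exists a => //; rewrite addrC addKr.
by exists a, (x - a); split=> //; rewrite addrC subrK.
Qed.

Lemma ideal_addl I J x : I x -> ideal_add I J x.
Proof. by move=> Ix; apply/ideal_addP; exists x; rewrite ?subrr //; apply: ideal0. Qed.

Lemma ideal_addr I J x : J x -> ideal_add I J x.
Proof. by move=> Jx; apply/ideal_addP; exists 0; rewrite ?subr0 //; apply: ideal0. Qed.

Lemma ideal_addS I J I' J' : (forall x, I x -> I' x) -> (forall x, J x -> J' x) ->
  forall x, ideal_add I J x -> ideal_add I' J' x.
Proof.
move=> II' JJ' x /ideal_addP[a /II' Ia /JJ' Jb].
by apply/ideal_addP; exists a.
Qed.

End IdealAdd.

Section LinearAlgebra.
Variables (k : fieldType) (R : comPzRingType) (sc : {rmorphism k -> R}).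
Implicit Types (I : ideal R) (l : seq R).

Definition lincomb l (c : nat -> k) : R := \sum_(i < size l) sc (c i) * l`_i.

Definition indep_mod I l : Prop :=
  forall c, I (lincomb l c) -> forall i, (i < size l)%N -> c i = 0.

Definition spans_mod I l : Prop := forall r, exists c, I (r - lincomb l c).

Lemma lincomb_cat l l' c :
  lincomb (l ++ l') c = lincomb l c + lincomb l' (fun i => c (size l + i)%N).
Proof.
rewrite /lincomb size_cat big_split_ord /=; congr (_ + _).
  by apply: eq_bigr => i _; rewrite nth_cat ltn_ord.
by apply: eq_bigr => i _; rewrite nth_cat ltnNge leq_addr /= addKn.
Qed.

Lemma lincomb_map x l c : lincomb (map ( *%R x) l) c = x * lincomb l c.
Proof.
rewrite /lincomb size_map mulr_sumr; apply: eq_bigr => i _.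
by rewrite (nth_map 0) // mulrCA.
Qed.

Lemma eq_lincomb l c c' : (forall i, (i < size l)%N -> c i = c' i) ->
  lincomb l c = lincomb l c'.
Proof. by move=> e; apply: eq_bigr => i _; rewrite e. Qed.

Lemma indep_modS I (J : ideal R) l : (forall x, I x -> J x) -> indep_mod J l -> indep_mod I l.
Proof. by move=> IJ Jl c Ic; apply: Jl; apply: IJ. Qed.

Lemma spans_modS I (J : ideal R) l : (forall x, I x -> J x) -> spans_mod I l -> spans_mod J l.
Proof. by move=> IJ Il r; have [c Ic] := Il r; exists c; apply: IJ. Qed.

(** The matrix expressing [l] through [l'] would otherwise have a kernel, whose
    elements are relations between the elements of [l]. *)
Lemma indep_leq_spans I l l' :
  indep_mod I l -> spans_mod I l' -> (size l <= size l')%N.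
Proof.
move=> indl spanl; rewrite leqNgt; apply/negP => lt_l.
have [M IM] := choice (fun i => spanl l`_i).
pose A : 'M[k]_(size l, size l') := \matrix_(i, j) M i j.
have : kermx A != 0.
  rewrite -mxrank_eq0 mxrank_ker subn_eq0 -ltnNge.
  exact: leq_ltn_trans (rank_leq_col A) lt_l.
move=> /rowV0Pn[v /sub_kermxP vA /negP v0]; apply: v0; apply/eqP/rowP => i.
pose c j := if insub j is Some i then v 0 i else 0 : k.
have cE (j : 'I_(size l)) : c j = v 0 j by rewrite /c valK.
rewrite mxE -cE; apply: (indl c) => //.
have -> : lincomb l c = \sum_(j < size l) sc (v 0 j) * (l`_j - lincomb l' (M j)).
  under [RHS]eq_bigr do rewrite mulrBr; rewrite sumrB -[LHS]subr0; congr (_ - _).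
    by apply: eq_bigr => j _; rewrite cE.
  under eq_bigr do rewrite mulr_sumr; rewrite exchange_big big1 // => j _ /=.
  have /rowP/(_ j) := vA; rewrite !mxE => vAj.
  under eq_bigr do rewrite mulrA -rmorphM.
  rewrite -mulr_suml -rmorph_sum (eq_bigr (fun i0 => v 0 i0 * A i0 j)) ?vAj.
    by rewrite rmorph0 mul0r.
  by move=> i0 _; rewrite mxE.
by apply: ideal_sum => j _; apply: idealM.
Qed.

End LinearAlgebra.

Section ChainBound.
Variables (k : fieldType) (N : nat) (R : comPzRingType) (m : ideal R).
Variables (phi : {rmorphism {mpoly k[N]} -> R}) (lp : local_presentation m phi).

Let sc : {rmorphism k -> R} := phi \o @mpolyC N k.

Lemma prime_sub_max (p : prime_ideal R) x : p x -> m x.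
Proof.
move=> px; apply: contrapT => /(lp_unit lp) ux.
exact/(@prime_ideal1 _ p)/(unit_ideal ux).
Qed.

(** A relation between elements of [W] and multiples of [x], with [x] in [q] but
    not in [p], is first reduced modulo [q], which kills the multiples of [x],
    and then divided by [x] modulo [p], at the cost of the order [c]. *)
Lemma indep_mod_prime_step (p : prime_ideal R) (q : ideal R) x c :
  (forall y, p y -> q y) -> ~ p x -> q x ->
  (forall s r a, p a -> ideal_exp m s (x * r - a) ->
     exists2 r', p (x * r') & ideal_exp m (s - c) (r - r')) ->
  forall s W Z, indep_mod sc (ideal_add q (ideal_exp m s)) W ->
    indep_mod sc (ideal_add p (ideal_exp m (s - c))) Z ->
    indep_mod sc (ideal_add p (ideal_exp m s)) (W ++ map ( *%R x) Z).
Proof.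
move=> pq px qx ar s W Z indW indZ d; rewrite lincomb_cat lincomb_map => pd.
have W0 : forall i, (i < size W)%N -> d i = 0.
  apply: indW; rewrite -(addrK (x * lincomb sc Z (fun i => d (size W + i)%N)) (lincomb sc W d)).
  apply: idealB; first exact: ideal_addS pd.
  by apply: ideal_addl; apply: idealMr.
have eW : lincomb sc W d = 0.
  by apply: big1 => i _; rewrite W0 // rmorph0 mul0r.
rewrite eW add0r in pd; have /ideal_addP[a pa xa] := pd.
have [r' pxr' rr'] := ar _ _ _ pa xa.
have Z0 : forall i, (i < size Z)%N -> d (size W + i)%N = 0.
  apply: (indZ (fun i => d (size W + i)%N)).
  by apply/ideal_addP; exists r' => //; case: (prime_idealM pxr').
move=> i; rewrite size_cat size_map; case: (ltnP i (size W)) => [/W0//|Wi lti].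
by rewrite -(subnKC Wi) Z0 // ltn_subLR.
Qed.

(** The independent elements are the products of powers, with exponents below
    [L], of elements [x_j] of [p_(j+1)] outside [p_j].  Each of the at most
    [L] divisions by [x_j] costs the constant order given by the Artin-Rees
    bound, so that the order needed depends linearly on [L]. *)
Lemma chain_indep e (p : nat -> prime_ideal R) : prime_chain e p ->
  exists C, forall L, exists l, size l = (L ^ e)%N /\
    indep_mod sc (ideal_add (p 0%N) (ideal_exp m (C * L).+1)) l.
Proof.
move=> chain; suff H j : (j <= e)%N -> exists C, forall L, exists l,
    size l = (L ^ j)%N /\
    indep_mod sc (ideal_add (p (e - j)%N) (ideal_exp m (C * L).+1)) l.
  by have [//|C CP] := H e; exists C => L; have := CP L; rewrite subnn.
elim: j => [|j IH] je.
  exists 0%N => L; exists [:: 1]; split=> // c.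
  rewrite /lincomb big_ord1 /= mulr1 => /ideal_addP[a pa ca].
  have mc : m (sc (c 0%N)).
    rewrite -(subrK a (sc _)); apply: idealD; first exact: ideal_exp1E ca.
    exact: prime_sub_max pa.
  by case=> // _; move/(lp_memE lp): mc; rewrite mpolyCK.
have [C CP] := IH (ltnW je).
have ej : (e - j = (e - j.+1).+1)%N by rewrite subnSK.
have [pq /existsNP[x /not_implyP[qx px]]] := chain (e - j.+1)%N ltac:(lia).
have [c ar] := artin_rees_colon lp (p (e - j.+1)%N) x.
exists (C + c)%N => L; have [W [sW indW]] := CP L.
suff [l [sl indl]] : exists l, size l = (L * L ^ j)%N /\ indep_mod sc
    (ideal_add (p (e - j.+1)%N) (ideal_exp m (C * L + L * c).+1)) l.
  by exists l; rewrite sl expnS mulnDl [(c * L)%N]mulnC.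
elim: {1 4}L => [|b [l [sl indl]]]; first by exists [::].
exists (W ++ map ( *%R x) l); split.
  by rewrite size_cat size_map sl sW mulSn.
apply: (indep_mod_prime_step pq px qx ar).
  rewrite ej in indW; apply: indep_modS indW => y; apply: ideal_addS => // z.
  by apply: ideal_exp_le; rewrite ltnS leq_addr.
apply: indep_modS indl => y; apply: ideal_addS => // z.
by apply: ideal_exp_le; lia.
Qed.

(** The spanning elements are the monomials in [us] with exponents below [s]:
    modulo the first generator [u] the monomials in the others suffice, and
    the quotient by [u] is divided out [s] times. *)
Lemma generators_span s (us : seq R) : (forall i, (i < size us)%N -> m us`_i) ->
  forall K : ideal R,
  (forall r, m r ->
     foldl (fun K u => ideal_add K (ideal_gen [set u])) K us r) ->
  exists l, size l = (s ^ size us)%N /\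
    spans_mod sc (ideal_add K (ideal_exp m s)) l.
Proof.
elim: us => [|u us IH] mus K mK.
  exists [:: 1]; split=> // r; have [c mc] := lp_residue lp r.
  exists (fun=> c); rewrite /lincomb big_ord1 mulr1.
  by apply: ideal_addl; apply: mK.
have [i ius|W [sW spanW]] := IH _ _ mK; first exact: (mus i.+1).
have mu : m u := mus 0%N isT.
have [l [sl spanl]] : exists l, size l = (s * s ^ size us)%N /\
   spans_mod sc (ideal_add (ideal_add K (ideal_gen [set u ^+ s])) (ideal_exp m s)) l.
  elim: {1 3}s => [|b [l [sl spanl]]].
    exists [::]; split=> // r; exists (fun=> 0); apply: ideal_addl.
    apply/ideal_addr/ideal_gen1P; exists (r - lincomb sc [::] (fun=> 0)).
    by rewrite expr0 mulr1.
  exists (W ++ map ( *%R u) l); split; first by rewrite size_cat size_map sl sW mulSn.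
  move=> r; have [c /ideal_addP[a /ideal_addP[a0 Ka0 /ideal_gen1P[x ax]] ra]] := spanW r.
  have [c' xc'] := spanl x.
  exists (fun i => if (i < size W)%N then c i else c' (i - size W)%N).
  rewrite lincomb_cat lincomb_map (@eq_lincomb _ _ sc W _ c); last by move=> i ->.
  rewrite (@eq_lincomb _ _ sc l _ c') => [|i _]; last first.
    by rewrite ltnNge leq_addr addKn.
  have -> : r - (lincomb sc W c + u * lincomb sc l c') =
    (r - lincomb sc W c - a) + (a0 + u * (x - lincomb sc l c')).
    have {1}-> : a = x * u + a0 by rewrite -ax subrK.
    by ring.
  apply: idealD; first exact: ideal_addr.
  apply: idealD; first exact/ideal_addl/ideal_addl.
  move/ideal_addP: xc' => [y /ideal_addP[y0 Ky0 /ideal_gen1P[z yz]] my].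
  apply/ideal_addP; exists (u * y); last by rewrite -mulrBr; apply: idealM.
  apply/ideal_addP; exists (u * y0); first exact: idealM.
  by rewrite -mulrBr yz; apply/ideal_gen1P; exists z; rewrite exprS mulrCA.
exists l; rewrite sl expnS; split=> //; apply: spans_modS spanl => y.
move=> /ideal_addP[a /ideal_addP[a0 Ka0 /ideal_gen1P[z az]] ya].
apply/ideal_addP; exists a0 => //.
rewrite -(subrK a y) -addrA az; apply: idealD => //; apply: idealM.
exact: ideal_expX.
Qed.

(** A longer chain would give, for each [L > 0], at least [L ^ d.+1] independent
    elements in a space of dimension [O(L ^ d)]. *)
Lemma chain_length_le (K : ideal R) d (u : 'I_d -> R) : (forall i, m (u i)) ->
  (forall r, m r -> exists c : 'I_d -> R, K (r - \sum_i c i * u i)) ->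
  forall e (p : nat -> prime_ideal R), (forall x, K x -> p 0%N x) ->
  prime_chain e p -> (e <= d)%N.
Proof.
move=> mu mK e p Kp chain; rewrite leqNgt; apply/negP => lt_de.
have [C CP] := chain_indep chain.
pose us := [seq u i | i <- enum 'I_d].
have sus : size us = d by rewrite size_map size_enum_ord.
have foldE (l : seq 'I_d) (K' : ideal R) (c : 'I_d -> R) r :
    K' (r - \sum_(i <- l) c i * u i) ->
    foldl (fun K u => ideal_add K (ideal_gen [set u])) K' [seq u i | i <- l] r.
  elim: l K' => [|i l IH] K' /=; first by rewrite big_nil subr0.
  rewrite big_cons => Kr; apply: IH; apply/ideal_addP.
  exists (r - (c i * u i + \sum_(j <- l) c j * u j)) => //.
  apply/ideal_gen1P; exists (c i); ring.
have [||C' C'P] := @generators_span (C * ((C + 1) ^ d).+1).+1 us _ (p 0%N).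
- by move=> i ilt; have /mapP[j _ ->] := mem_nth 0 ilt; apply: mu.
- move=> r /mK[c Kc]; apply: (foldE _ _ c); apply: Kp.
  by rewrite big_enum.
have [W [sW indW]] := CP ((C + 1) ^ d).+1.
have := indep_leq_spans indW C'P.2; rewrite sW C'P.1 sus.
set L := ((C + 1) ^ d).+1; apply/negP; rewrite -ltnNge.
apply: (@leq_ltn_trans (((C + 1) * L) ^ d)%N).
  case: (posnP d) => [->//|d0]; rewrite leq_exp2r //; lia.
apply: (@leq_trans (L ^ d.+1)); last by rewrite leq_pexp2l.
by rewrite expnMn expnS ltn_pmul2r ?expn_gt0.
Qed.

End ChainBound.

(** * Formal power series *)

Section PowerSeries.
Variables (k : fieldType) (n : nat).
Local Notation S := (pseries k n).
Implicit Types (f g h : S) (m l : 'X_{1..n}) (i j : 'I_n).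

Lemma psDE f g m : (f + g) m = f m + g m. Proof. by []. Qed.
Lemma psNE f m : (- f) m = - f m. Proof. by []. Qed.
Lemma ps0E m : (0 : S) m = 0. Proof. by []. Qed.
Lemma ps1E m : (1 : S) m = psC 1 m. Proof. by []. Qed.

Lemma psBE f g m : (f - g) m = f m - g m.
Proof. by []. Qed.

Lemma ps_sumE (T : Type) (r : seq T) (P : pred T) (F : T -> S) m :
  (\sum_(a <- r | P a) F a) m = \sum_(a <- r | P a) F a m.
Proof. by apply: (big_morph (fun f : S => f m)). Qed.

Lemma psME f g m : (f * g) m =
  \sum_(c : 'X_{1..n < (mdeg m).+1, (mdeg m).+1} | m == (c.1 + c.2)%MM)
     f c.1 * g c.2.
Proof. by []. Qed.

(** A coefficient of a product depends only on truncations of the factors, so it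
    can be computed with polynomials. *)
Lemma psM_coef f g m (p q : {mpoly k[n]}) :
  (forall l, (mdeg l <= mdeg m)%N -> p@_l = f l) ->
  (forall l, (mdeg l <= mdeg m)%N -> q@_l = g l) -> (f * g) m = (p * q)@_m.
Proof.
move=> pf qg; rewrite mcoeffM psME; apply: eq_bigr => -[c1 c2] _ /=.
by rewrite pf ?qg // -ltnS bmdeg.
Qed.

Definition ps_trunc s f : {mpoly k[n]} := \sum_(m : 'X_{1..n < s}) f m *: 'X_[m].

Lemma ps_truncE s f m : (mdeg m < s)%N -> (ps_trunc s f)@_m = f m.
Proof. exact: mcoeff_mpoly. Qed.

Lemma psM_trunc s f g m : (mdeg m < s)%N ->
  (f * g) m = (ps_trunc s f * ps_trunc s g)@_m.
Proof. by move=> ms; apply: psM_coef => l lm; apply/ps_truncE/(leq_ltn_trans lm). Qed.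

Fact psC_is_zmod : zmod_morphism (@psC k n).
Proof.
move=> a b; apply: funext => m; rewrite psBE /psC.
by case: eqP => //; rewrite subrr.
Qed.

Lemma psC_mulE c f m : (psC c * f : S) m = c * f m.
Proof.
rewrite (@psM_coef _ _ _ c%:MP (ps_trunc (mdeg m).+1 f)); first last.
- by move=> l lm; rewrite ps_truncE.
- by move=> l _; rewrite mcoeffC /psC; case: eqP; rewrite ?mulr1 ?mulr0.
by rewrite mcoeffCM ps_truncE.
Qed.

Fact psC_is_monoid : monoid_morphism (@psC k n).
Proof.
split=> // a b; apply: funext => m; rewrite psC_mulE /psC.
by case: eqP; rewrite ?mulr0.
Qed.

HB.instance Definition _ :=
  GRing.isZmodMorphism.Build k S (@psC k n) psC_is_zmod.
HB.instance Definition _ :=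
  GRing.isMonoidMorphism.Build k S (@psC k n) psC_is_monoid.

Lemma ps_coef0M f g : (f * g) 0%MM = f 0%MM * g 0%MM.
Proof.
by rewrite (@psM_trunc 1) ?mdeg0 // mcoeff0M !ps_truncE ?mdeg0.
Qed.

Lemma ps_coef0X f s : (f ^+ s) 0%MM = f 0%MM ^+ s.
Proof.
by elim: s => [|s IH]; rewrite ?exprS ?ps_coef0M ?IH // !expr0 ps1E /psC eqxx.
Qed.

Definition psX i : S := fun m => if m == U_(i)%MM then 1 else 0.

Lemma psX_mulE i f m :
  (psX i * f) m = if m i is 0%N then 0 else f (m - U_(i))%MM.
Proof.
rewrite mulrC (@psM_coef _ _ _ (ps_trunc (mdeg m).+1 f) 'X_i); first last.
- by move=> l _; rewrite mcoeffX /psX eq_sym; case: eqP.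
- by move=> l lm; rewrite ps_truncE.
case mi: (m i) => [|e].
  rewrite mcoeffM big1 // => -[c1 c2] /= /eqP em; rewrite mcoeffX.
  case: eqP => [e2|_]; last by rewrite mulr0.
  have := congr1 (fun l : 'X_{1..n} => l i) em.
  by rewrite mi mnmDE -e2 mnm1E eqxx addn1.
have le_im : (U_(i) <= m)%MM by rewrite lep1mP mi.
rewrite -{1}(submK le_im) addmC mcoeffMX ps_truncE //.
by rewrite ltnS mdegB.
Qed.

(** ** Order of vanishing *)

Definition ord_ge s f : Prop := forall m, (mdeg m < s)%N -> f m = 0.

Lemma ord_ge0 f : ord_ge 0 f. Proof. by []. Qed.

Lemma ord_ge1 f : ord_ge 1 f <-> f 0%MM = 0.
Proof.
split=> [|f0 m]; first by apply; rewrite mdeg0.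
by rewrite ltnS leqn0 mdeg_eq0 => /eqP->.
Qed.

Lemma ord_ge_zero s : ord_ge s 0. Proof. by []. Qed.

Lemma ord_ge_le s t f : (s <= t)%N -> ord_ge t f -> ord_ge s f.
Proof. by move=> st tf m ms; apply/tf/(leq_trans ms). Qed.

Lemma ord_geD s f g : ord_ge s f -> ord_ge s g -> ord_ge s (f + g).
Proof. by move=> sf sg m ms; rewrite psDE sf // sg // addr0. Qed.

Lemma ord_geN s f : ord_ge s f -> ord_ge s (- f).
Proof. by move=> sf m ms; rewrite psNE sf // oppr0. Qed.

Lemma ord_geB s f g : ord_ge s f -> ord_ge s g -> ord_ge s (f - g).
Proof. by move=> sf sg; apply/ord_geD/ord_geN. Qed.

Lemma ord_ge_sum (T : Type) (r : seq T) (P : pred T) (F : T -> S) (s : nat) :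
  (forall a, P a -> ord_ge s (F a)) -> ord_ge s (\sum_(a <- r | P a) F a).
Proof. by move=> sF; apply: big_ind => //; apply: ord_geD. Qed.

Lemma ord_geM s t f g : ord_ge s f -> ord_ge t g -> ord_ge (s + t) (f * g).
Proof.
move=> sf tg m ms; rewrite psME big1 // => -[c1 c2] /= /eqP em.
case: (ltnP (mdeg c1) s) => [c1s|c1s]; first by rewrite sf ?mul0r.
rewrite tg ?mulr0 //; have /= := congr1 (@mdeg n) em; rewrite mdegD => edeg.
rewrite edeg in ms; rewrite -(ltn_add2l s); by apply: leq_ltn_trans ms; rewrite leq_add2r.
Qed.

Lemma ord_ge_mull s f g : ord_ge s g -> ord_ge s (f * g).
Proof. by rewrite -[s]add0n; apply: ord_geM. Qed.

Lemma ord_geX s t f : ord_ge s f -> ord_ge (s * t) (f ^+ t).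
Proof.
move=> sf; elim: t => [|t IH]; first by rewrite muln0.
by rewrite exprS mulnS; apply: ord_geM.
Qed.

Lemma ord_ge_X i : ord_ge 1 (psX i).
Proof. by apply/ord_ge1; rewrite /psX eq_sym mnm1_eq0. Qed.

Lemma ord_ge_eq0 f : (forall s, ord_ge s f) -> f = 0.
Proof. by move=> sf; apply: funext => m; apply: (sf (mdeg m).+1). Qed.

Lemma ord_ge_trunc_eq s f g :
  ord_ge s (f - g) -> forall m, (mdeg m < s)%N -> f m = g m.
Proof. by move=> fg m ms; apply/eqP; rewrite -subr_eq0 -psBE fg. Qed.

(** The coefficient of a monomial involves only the terms up to its degree. *)
Lemma ps_series (H : nat -> S) : (forall a, ord_ge a (H a)) ->
  exists G : S, forall s, ord_ge s (G - \sum_(i < s) H i).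
Proof.
move=> sH; exists (fun m => \sum_(i < (mdeg m).+1) H i m) => s m ms.
rewrite psBE ps_sumE -!(big_mkord xpredT (fun a => H a m)).
rewrite (big_cat_nat _ (n := (mdeg m).+1) (p := s)) //= opprD addrA subrr add0r.
rewrite big_nat_cond big1 ?oppr0 // => i /andP[/andP[mi _] _].
exact: sH.
Qed.

Lemma ps_unit f : f 0%MM != 0 -> exists g, f * g = 1.
Proof.
move=> f0; pose h := 1 - psC (f 0%MM)^-1 * f.
have h0 : ord_ge 1 h.
  by apply/ord_ge1; rewrite /h psBE psC_mulE mulVf // ps1E /psC eqxx subrr.
have [|G GP] := @ps_series (fun a => h ^+ a).
  by move=> a; rewrite -[a in ord_ge a]mul1n; apply: ord_geX.
exists (psC (f 0%MM)^-1 * G); apply/eqP; rewrite -subr_eq0; apply/eqP.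
apply: ord_ge_eq0 => s.
have -> : f * (psC (f 0%MM)^-1 * G) - 1 =
   (1 - h) * (G - \sum_(i < s) h ^+ i) - h ^+ s.
  rewrite mulrBr -[X in _ = _ - X * \sum_(i < s) _ - _]opprB mulNr -subrX1.
  by move: (h ^+ s) => hs; rewrite /h; ring.
apply: ord_geB; first exact: ord_ge_mull.
by rewrite -[s in ord_ge s]mul1n; apply: ord_geX.
Qed.

(** For a monomial order, the terms of [f] and [g] with least monomials [a] and
    [b] give the only contribution to the coefficient of [a + b] in [f g]. *)
Lemma ps_domain f g : f * g = 0 -> f = 0 \/ g = 0.
Proof.
move=> fg0; apply: contrapT => /not_orP[f0 g0].
have low h : h <> 0 -> exists2 m, h m != 0 & forall l, (l < m)%O -> h l = 0.
  move=> h0; have [m hm] : exists m, h m != 0.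
    apply: contrapT => nh; apply: h0; apply: funext => m; apply/eqP.
    by apply: contrapT => /negP hm; apply: nh; exists m.
  elim/(well_founded_ind (@ltom_wf n)): m hm => m IH hm.
  have [[l lm hl]|none] := pselect (exists2 l, (l < m)%O & h l != 0).
    exact: IH hl.
  exists m => // l lm; apply/eqP; apply: contrapT => /negP hl.
  by apply: none; exists l.
have [a fa fl] := low f f0; have [b gb gl] := low g g0.
have : (f * g) (a + b)%MM = f a * g b.
  have la : (mdeg a < (mdeg (a + b)%MM).+1)%N by rewrite ltnS mdegD leq_addr.
  have lb : (mdeg b < (mdeg (a + b)%MM).+1)%N by rewrite ltnS mdegD leq_addl.
  rewrite psME (bigD1 (BMultinom la, BMultinom lb)) //= big1 ?addr0 //.
  move=> -[c1 c2] /= /andP[ec]; rewrite xpair_eqE negb_and => nc.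
  case: (ltgtP (c1 : 'X_{1..n}) a) => [/fl->|ac|ec1]; first by rewrite mul0r.
    rewrite gl ?mulr0 // ltNge; apply/negP => bc.
    by move: ec; rewrite (lt_eqF (ltmc_le_add ac bc)).
  case/orP: nc => /eqP[]; apply: val_inj => //=.
  by move: ec; rewrite ec1 => /eqP/addmI/esym.
by rewrite fg0 ps0E => /esym/eqP; rewrite mulf_eq0 (negPf fa) (negPf gb).
Qed.

Lemma ps_mulI f g h : f <> 0 -> f * g = f * h -> g = h.
Proof.
move=> f0 /eqP; rewrite -subr_eq0 -mulrBr => /eqP/ps_domain[//|/eqP].
by rewrite subr_eq0 => /eqP.
Qed.

Lemma psX_neq0 i : psX i <> 0.
Proof.
move=> /(congr1 (fun f : S => f U_(i)%MM)).
by rewrite /psX eqxx ps0E => /eqP; rewrite oner_eq0.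
Qed.

Lemma ps_expf_neq0 f s : f <> 0 -> f ^+ s <> 0.
Proof.
move=> f0; elim: s => [|s IH]; first by apply/eqP; rewrite expr0 oner_eq0.
by rewrite exprS => /ps_domain[].
Qed.

Lemma ps_divX i f : (forall m, m i = 0%N -> f m = 0) -> exists g, f = psX i * g.
Proof.
move=> fi; exists (fun m => f (m + U_(i))%MM); apply: funext => m.
rewrite psX_mulE; case mi: (m i) => [|e]; first exact: fi.
by rewrite submK // lep1mP mi.
Qed.

(** Each term is attributed to one of the variables occurring in it. *)
Lemma ord_ge_split s f : ord_ge s.+1 f ->
  exists F, f = \sum_i psX i * F i /\ forall i, ord_ge s (F i).
Proof.
move=> sf; pose var m := [pick i | m i != 0%N].
exists (fun i m => if var (m + U_(i))%MM == Some i then f (m + U_(i))%MM else 0).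
split=> [|i m ms]; last first.
  by case: eqP => // _; apply: sf; rewrite mdegD mdeg1 addn1.
have XF i m : (psX i * (fun m => if var (m + U_(i))%MM == Some i
    then f (m + U_(i))%MM else 0) : S) m = if var m == Some i then f m else 0.
  rewrite psX_mulE; case mi: (m i) => [|e]; last by rewrite submK // lep1mP mi.
  by rewrite /var; case: pickP => // j mj; case: eqP => // -[ji]; move: mj; rewrite ji mi.
apply: funext => m; rewrite ps_sumE; under eq_bigr do rewrite XF.
case vm: (var m) => [i|].
  rewrite (bigD1 i) //= eqxx big1 ?addr0 // => j ji.
  by case: eqP => // -[e]; rewrite e eqxx in ji.
rewrite big1 // sf //; move: vm; rewrite /var; case: pickP => // m0 _.
rewrite ltnS mdegE big1 // => i _; have := m0 i; by move/negbFE/eqP.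
Qed.

(** ** Derivations *)

Lemma psderivE i f m : psderiv i f m = f (m + U_(i))%MM *+ (m i).+1.
Proof. by []. Qed.

Fact psderiv_is_zmod i : zmod_morphism (@psderiv k n i).
Proof.
by move=> f g; apply: funext => m; rewrite psBE !psderivE psBE mulrnBl.
Qed.
HB.instance Definition _ i :=
  GRing.isZmodMorphism.Build S S (@psderiv k n i) (@psderiv_is_zmod i).

Lemma psderivM i f g :
  psderiv i (f * g) = psderiv i f * g + f * psderiv i g.
Proof.
apply: funext => m; pose s := (mdeg m).+2.
have der_tr (h : S) l : (mdeg l <= mdeg m)%N ->
    (mderiv i (ps_trunc s h))@_l = psderiv i h l.
  by move=> lm; rewrite mcoeff_deriv ps_truncE ?psderivE // mdegD mdeg1 addn1 ltnS.
have tr (h : S) l : (mdeg l <= mdeg m)%N -> (ps_trunc s h)@_l = h l.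
  by move=> lm; rewrite ps_truncE // ltnW.
rewrite psDE psderivE (@psM_trunc s); last by rewrite mdegD mdeg1 addn1.
rewrite -mcoeff_deriv mderivM mcoeffD; congr (_ + _).
  by symmetry; apply: psM_coef => l lm; [apply: der_tr|apply: tr].
by symmetry; apply: psM_coef => l lm; [apply: tr|apply: der_tr].
Qed.

Lemma psderivC i c : psderiv i (psC c : S) = 0.
Proof.
by apply: funext => m; rewrite psderivE /psC mnmD_eq0 mnm1_eq0 andbF mul0rn.
Qed.

Lemma psderiv_psX i j : psderiv i (psX j) = if i == j then 1 else 0.
Proof.
apply: funext => m; rewrite psderivE /psX; case: (eqVneq i j) => [->|ij].
  rewrite -{2}[U_(j)%MM]add0m eqm_add2r ps1E /psC.
  by case: eqP => [->|]; rewrite ?mnm0E ?mul0rn.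
case: eqP => [e|]; last by rewrite mul0rn.
have := congr1 (fun m : 'X_{1..n} => m i) e.
by rewrite mnmDE !mnm1E eqxx eq_sym (negPf ij) addn1.
Qed.

Lemma psderivX i f s :
  psderiv i (f ^+ s.+1) = f ^+ s * psderiv i f *+ s.+1.
Proof.
elim: s => [|s IH]; first by rewrite expr0 mul1r.
by rewrite exprS psderivM IH [RHS]mulrS mulrnAr mulrA -exprS mulrC.
Qed.

Lemma ord_ge_deriv s i f : ord_ge s.+1 f -> ord_ge s (psderiv i f).
Proof.
by move=> sf m ms; rewrite psderivE sf ?mul0rn // mdegD mdeg1 addn1.
Qed.

(** ** Killing a set of variables *)

Definition ps_kill (K : pred 'I_n) f : S :=
  fun m => if [forall (i | K i), m i == 0%N] then f m else 0.

Fact ps_kill_is_zmod K : zmod_morphism (ps_kill K).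
Proof.
by move=> f g; apply: funext => m; rewrite psBE /ps_kill; case: ifP; rewrite ?subr0.
Qed.

Fact ps_kill_is_monoid K : monoid_morphism (ps_kill K).
Proof.
split=> [|f g]; apply: funext => m.
  rewrite /ps_kill !ps1E /psC; case: ifPn => //; case: eqP => // ->.
  by case/negP; apply/forall_inP => i _; rewrite mnm0E.
rewrite /ps_kill psME; case: ifPn => [/forall_inP mK|].
  rewrite psME; apply: eq_bigr => -[c1 c2] /= /eqP em.
  have cK i : K i -> (c1 i == 0%N) && (c2 i == 0%N).
    move=> /mK; have := congr1 (fun l : 'X_{1..n} => l i) em.
    by rewrite mnmDE => ->; rewrite addn_eq0.
  rewrite !ifT //; apply/forall_inP => i /cK /andP[] //.
move=> /forall_inPn[i Ki mi]; rewrite psME big1 // => -[c1 c2] /= /eqP em.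
have : (c1 i != 0%N) || (c2 i != 0%N).
  have := congr1 (fun l : 'X_{1..n} => l i) em.
  by move: mi; rewrite mnmDE => /[swap] ->; rewrite addn_eq0 negb_and.
case/orP => ci; [rewrite ifN ?mul0r //|rewrite [X in _ * X]ifN ?mulr0 //];
  by apply/forall_inPn; exists i.
Qed.

HB.instance Definition _ K :=
  GRing.isZmodMorphism.Build S S (ps_kill K) (ps_kill_is_zmod K).
HB.instance Definition _ K :=
  GRing.isMonoidMorphism.Build S S (ps_kill K) (ps_kill_is_monoid K).

Lemma ps_kill_psX K i : ps_kill K (psX i) = if K i then 0 else psX i.
Proof.
apply: funext => m; rewrite /ps_kill.
case: (eqVneq m U_(i)%MM) => [->|ne]; last first.
  by rewrite /psX (negPf ne) if_same; case: (K i); rewrite ?(negPf ne).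
case: ifPn => [/forall_inP all0|/forall_inPn[j Kj]].
  by case: ifPn => // /all0; rewrite mnm1E eqxx.
by rewrite mnm1E; case: (eqVneq i j) => // -> _; rewrite [K j]Kj.
Qed.

Lemma ps_kill_coef (K : pred 'I_n) f m : (forall i, K i -> m i = 0%N) -> ps_kill K f m = f m.
Proof. by move=> mK; rewrite /ps_kill ifT //; apply/forall_inP => i /mK->. Qed.

Lemma ps_kill_deriv (K : pred 'I_n) i f : ~~ K i ->
  psderiv i (ps_kill K f) = ps_kill K (psderiv i f).
Proof.
move=> Ki; apply: funext => m; rewrite psderivE /ps_kill psderivE.
rewrite (_ : [forall (j | K j), (m + U_(i))%MM j == 0%N] = [forall (j | K j), m j == 0%N]).
  by case: ifP; rewrite ?mul0rn.
apply: eq_forallb => j; case Kj: (K j) => //=.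
by rewrite mnmDE mnm1E; case: (eqVneq i j) Ki => [->|_]; rewrite ?Kj // addn0.
Qed.

(** ** Evaluation of polynomials and substitution *)

Definition ps_eval N (v : 'I_N -> S) (p : {mpoly k[N]}) : S := mmap (@psC k n) v p.
HB.instance Definition _ N (v : 'I_N -> S) :=
  GRing.RMorphism.copy (ps_eval v) (mmap (@psC k n) v).

Lemma ps_evalC N (v : 'I_N -> S) c : ps_eval v c%:MP = psC c.
Proof. exact: mmapC. Qed.

Lemma ps_evalX N (v : 'I_N -> S) (i : 'I_N) : ps_eval v 'X_i = v i.
Proof. by rewrite /ps_eval mmapX mmap1U. Qed.

Lemma ps_evalD N (v : 'I_N -> S) p q : ps_eval v (p + q) = ps_eval v p + ps_eval v q.
Proof. exact: rmorphD. Qed.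

Lemma ps_evalM N (v : 'I_N -> S) p q : ps_eval v (p * q) = ps_eval v p * ps_eval v q.
Proof. exact: rmorphM. Qed.

Lemma ps_eval_deriv N (v : 'I_N -> S) i p :
  psderiv i (ps_eval v p) = \sum_(j < N) ps_eval v (mderiv j p) * psderiv i (v j).
Proof.
elim/mpoly_ring_ind: p => [c|j|p q ep eq|p q ep eq].
- rewrite ps_evalC psderivC big1 // => j _.
  by rewrite mderivC -mpolyC0 ps_evalC rmorph0 mul0r.
- rewrite ps_evalX (bigD1 j) //= big1 ?addr0 => [|l lj].
    have U0 : (U_(j) - U_(j) = 0 :> 'X_{1..N})%MM.
      by apply/mnmP => l; rewrite mnmBE subnn mnm0E.
    rewrite mderivX mnm1E eqxx scale1r U0 mpolyX0 -mpolyC1 ps_evalC.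
    by rewrite rmorph1 mul1r.
  rewrite mderivX mnm1E eq_sym (negPf lj) scale0r -mpolyC0 ps_evalC.
  by rewrite rmorph0 mul0r.
- rewrite ps_evalD raddfD /= ep eq -big_split; apply: eq_bigr => j _.
  by rewrite mderivD ps_evalD mulrDl.
- rewrite ps_evalM psderivM ep eq mulr_suml mulr_sumr -big_split.
  apply: eq_bigr => j _ /=; rewrite mderivM ps_evalD !ps_evalM; ring.
Qed.

Lemma ps_eval0 N (v : 'I_N -> S) p : (forall i : 'I_N, ord_ge 1 (v i)) ->
  ps_eval v p 0%MM = p@_0%MM.
Proof.
move=> v0; elim/mpoly_ring_ind: p => [c|j|p q ep eq|p q ep eq].
- by rewrite ps_evalC mcoeffC eqxx mulr1 /psC eqxx.
- by rewrite ps_evalX mcoeffX mnm1_eq0; apply/ord_ge1/v0.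
- by rewrite ps_evalD psDE mcoeffD ep eq.
- by rewrite ps_evalM ps_coef0M mcoeff0M ep eq.
Qed.

Lemma mpolyX_split N (m : 'X_{1..N}) s : mdeg m = s.+1 ->
  exists (i : 'I_N) (l : 'X_{1..N}), m = (U_(i) + l)%MM /\ mdeg l = s.
Proof.
move=> dm; have : m != 0%MM by rewrite -mdeg_eq0 dm.
case: (pickP (fun i : 'I_N => m i != 0%N)) => [i mi _|m0]; last first.
  by case/eqP; apply/mnmP => i; rewrite mnm0E; apply/eqP; have := m0 i => /negbFE.
have e : m = (U_(i) + (m - U_(i)))%MM by rewrite addmC submK // lep1mP.
exists i, (m - U_(i))%MM; split=> //.
by move: dm; rewrite {1}e mdegD mdeg1 add1n => -[].
Qed.

Lemma ord_ge_eval N (v : 'I_N -> S) (p : {mpoly k[N]}) s :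
  (forall i : 'I_N, ord_ge 1 (v i)) ->
  (forall m : 'X_{1..N}, (mdeg m < s)%N -> p@_m = 0) ->
  ord_ge s (ps_eval v p).
Proof.
move=> v0 sp; rewrite [p]mpolyE rmorph_sum big_seq; apply: ord_ge_sum => m.
rewrite mcoeff_msupp => pm; rewrite -mul_mpolyC rmorphM /=; apply: ord_ge_mull.
have /ord_ge_le : (s <= mdeg m)%N by rewrite leqNgt; apply/negP => /sp/eqP; rewrite (negPf pm).
apply; move: {-2}(mdeg m) (erefl (mdeg m)) => d.
elim: d m {pm} => [|d IH] m dm; first exact: ord_ge0.
have [i [l [-> dl]]] := mpolyX_split (esym dm).
rewrite mpolyXD ps_evalM -add1n; apply: ord_geM; last exact: IH.
by rewrite ps_evalX.
Qed.

End PowerSeries.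

(** * Principal gradient ideals of power series *)

Section CharZero.
Variables (k : fieldType) (hk : [pchar k] =i pred0).

Lemma natf_neq0_char0 s : s.+1%:R != 0 :> k.
Proof. by rewrite natf_neq0_pchar; apply/pnatP => // p _ _; rewrite inE /= hk. Qed.

End CharZero.

Section Flow.
Variables (k : fieldType) (n : nat) (hk : [pchar k] =i pred0).
Local Notation S := (pseries k n).
Variables (i l : 'I_n) (li : l != i) (a : S).

(** The derivation [d_l - a d_i]; since it maps [x_l] to [1], a series
    annihilated by it is determined by its restriction to [x_l = 0], which can
    be arbitrary. *)
Definition flow (F : S) : S := psderiv l F - a * psderiv i F.

Lemma flowM F G : flow (F * G) = flow F * G + F * flow G.
Proof. by rewrite /flow !psderivM; ring. Qed.

Lemma flowD F G : flow (F + G) = flow F + flow G.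
Proof. by rewrite /flow !raddfD /=; ring. Qed.

Lemma flowN F : flow (- F) = - flow F.
Proof. by rewrite /flow !raddfN /=; ring. Qed.

Lemma flowC c : flow (psC c) = 0.
Proof. by rewrite /flow !psderivC mulr0 subr0. Qed.

Lemma flowX : flow (psX k l) = 1.
Proof.
by rewrite /flow !psderiv_psX eqxx eq_sym (negPf li) mulr0 subr0.
Qed.

Lemma flow_exp F s : flow (F ^+ s.+1) = F ^+ s * flow F *+ s.+1.
Proof. by rewrite /flow !psderivX mulrBr mulrnBl; congr (_ - _); rewrite mulrnAr mulrCA. Qed.

Lemma ord_ge_flow s F : ord_ge s.+1 F -> ord_ge s (flow F).
Proof.
by move=> sF; apply: ord_geB; [|apply: ord_ge_mull]; apply: ord_ge_deriv.
Qed.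

Lemma ps_mulrnE (F : S) s : F *+ s = psC s%:R * F.
Proof. by rewrite rmorph_nat mulr_natl. Qed.

(** The restriction is extended by the exponential of [- x_l] times the flow. *)
Lemma flow_exists F : exists2 G, flow G = 0 & forall m : 'X_{1..n}, m l = 0%N -> G m = F m.
Proof.
pose c s : k := (s`!%:R)^-1.
have cS s : s.+1%:R * c s.+1 = c s.
  by rewrite /c factS natrM invfM mulrA divff ?mul1r // natf_neq0_char0.
pose H s := (- psX k l) ^+ s * (psC (c s) * iter s flow F).
have [s|G GP] := @ps_series k n H.
  rewrite -[s in ord_ge s]addn0; apply: ord_geM => //.
  by rewrite -[s in ord_ge s]mul1n; apply/ord_geX/ord_geN/ord_ge_X.
have flowH s : flow (\sum_(j < s.+1) H j) =
    (- psX k l) ^+ s * (psC (c s) * iter s.+1 flow F).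
  elim: s => [|s IH].
    rewrite big_ord1 /H !expr0 !mul1r flowM flowC mul0r add0r //.
  rewrite big_ord_recr /= flowD IH /H flowM flow_exp.
  have -> : flow (- psX k l) = -1 by rewrite flowN flowX.
  rewrite flowM flowC mul0r add0r ps_mulrnE -(cS s) rmorphM /=; ring.
exists G.
  apply: ord_ge_eq0 => s; rewrite -[G](subrK (\sum_(j < s.+1) H j)) flowD flowH.
  apply: ord_geD; first exact/ord_ge_flow/GP.
  rewrite -[s in ord_ge s]addn0; apply: ord_geM => //.
  by rewrite -[s in ord_ge s]mul1n; apply/ord_geX/ord_geN/ord_ge_X.
move=> m ml; rewrite (ord_ge_trunc_eq (GP (mdeg m).+1)) // ps_sumE big_ord_recl.
rewrite big1 ?addr0 => [|j _].
  by rewrite /H /= expr0 mul1r psC_mulE /c fact0 invr1 mul1r.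
by rewrite /H /= exprS !mulNr -mulrA psNE psX_mulE ml oppr0.
Qed.

(** If [x_l ^ s] divides [G], with [s > 0], then the terms of lowest order of the
    flow of [G] show that [x_l] divides the quotient, in characteristic zero. *)
Lemma flow_unique G : flow G = 0 -> (forall m : 'X_{1..n}, m l = 0%N -> G m = 0) -> G = 0.
Proof.
move=> DG Gl; suff H s : exists G', G = psX k l ^+ s * G'.
  apply: ord_ge_eq0 => s; have [G' ->] := H s.
  rewrite -[s in ord_ge s]addn0; apply: ord_geM => //.
  by rewrite -[s in ord_ge s]mul1n; apply/ord_geX/ord_ge_X.
have [G1 eG1] := ps_divX Gl.
elim: s => [|[|s] [G' eG]]; first by exists G; rewrite mul1r.
  by exists G1; rewrite expr1.
have := DG; rewrite {1}eG flowM flow_exp flowX mulr1.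
rewrite mulrnAl -mulrnAr exprSr -mulrA -mulrDr => /ps_domain[/ps_expf_neq0|]; first by case; apply: psX_neq0.
rewrite ps_mulrnE => e.
exists (- psC s.+1%:R^-1 * flow G'); rewrite {1}eG [in RHS]exprSr -mulrA; congr (_ * _).
have : psC s.+1%:R^-1 * (psC s.+1%:R * G' + psX k l * flow G') = 0 by rewrite e mulr0.
rewrite mulrDr mulrA -rmorphM mulVf ?natf_neq0_char0 // rmorph1 mul1r => /eqP.
by rewrite addr_eq0 => /eqP e'; rewrite {1}e'; ring.
Qed.

End Flow.

Section PrincipalGradient.
Variables (k : fieldType) (n : nat) (hk : [pchar k] =i pred0).
Local Notation S := (pseries k n).
Variable i : 'I_n.

(** Up to a unit and a change of coordinates, [F] is a power of [x_i]. *)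
Definition param_power (F : S) : Prop := exists (u y : S) e,
  [/\ u 0%MM != 0, y 0%MM = 0, y U_(i)%MM != 0 & F = u * y ^+ e].

(** The hypothesis expresses that [F] involves the variable [x_i] only; the
    exponent is the order of [F]. *)
Lemma param_power_univariate (F : S) :
  (forall m : 'X_{1..n}, F m != 0 -> m = (U_(i) *+ m i)%MM) -> F <> 0 -> param_power F.
Proof.
move=> Fi F0; have ex : exists e, F (U_(i) *+ e)%MM != 0.
  apply: contrapT => none; apply: F0; apply: funext => m; apply/eqP.
  by apply: contrapT => /negP Fm; apply: none; exists (m i); rewrite -Fi.
case: (ex_minnP ex) => e Fe emin.
suff [u [eF u0]] : exists u : S, F = psX k i ^+ e * u /\ u 0%MM != 0.
  exists u, (psX k i), e; split=> //; last by rewrite mulrC.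
    by rewrite /psX eq_sym mnm1_eq0.
  by rewrite /psX eqxx oner_neq0.
suff H d : (d <= e)%N -> exists u : S, F = psX k i ^+ d * u /\
    forall m, u m = F (m + U_(i) *+ d)%MM.
  by have [//|u [eF uE]] := H e; exists u; rewrite uE add0m.
elim: d => [|d IH] de.
  by exists F; rewrite expr0 mul1r; split=> // m; rewrite mulm0n addm0.
have [u [eF uE]] := IH (ltnW de).
have [m mi|v ev] := @ps_divX k n i u.
  rewrite uE; apply/eqP; apply: contrapT => /negP Fm.
  have := Fi _ Fm; rewrite mnmDE mi mulmnE mnm1E eqxx mul1n add0n => em.
  by rewrite em in Fm; have := emin _ Fm; rewrite leqNgt de.
exists v; split; first by rewrite eF ev mulrA -exprSr.
move=> m; rewrite mulmS addmA -uE ev psX_mulE mnmDE mnm1E eqxx addn1 addmK.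
by [].
Qed.

(** If all partial derivatives of [f] are multiples of [d_i f], then [f] is
    annihilated by the flows [d_l - a_l d_i].  It is recovered from its
    restriction to the [x_i]-axis by adding the other variables one at a time,
    and the form unit times power of a parameter is preserved by the extension
    along each flow. *)
Lemma gradient_multiple_param_power (f : S) (a : 'I_n -> S) :
  (forall l, psderiv l f = a l * psderiv i f) -> f = 0 \/ param_power f.
Proof.
move=> fa; suff H (K : seq 'I_n) : uniq K -> i \notin K ->
    ps_kill (fun l => (l != i) && (l \notin K)) f = 0 \/
    param_power (ps_kill (fun l => (l != i) && (l \notin K)) f).
  have := H (rem i (enum 'I_n)) (rem_uniq _ (enum_uniq _)).
  rewrite mem_rem_uniq ?enum_uniq // inE eqxx /= => /(_ isT).
  suff -> : ps_kill (fun l => (l != i) && (l \notin rem i (enum 'I_n))) f = f by [].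
  apply: funext => m; apply: ps_kill_coef => l.
  by rewrite mem_rem_uniq ?enum_uniq // !inE mem_enum andbT negbK => /andP[/negPf->].
elim: K => [|l K IH] /=.
  move=> _ _; have [->|/eqP F0] := eqVneq (ps_kill (fun l => (l != i) && (l \notin [::])) f) 0.
    by left.
  right; apply: param_power_univariate => // m; rewrite /ps_kill.
  case: ifP => [/forall_inP mK _|_]; last by rewrite eqxx.
  apply/mnmP => l; rewrite mulmnE mnm1E; case: (eqVneq i l) => [->|il].
    by rewrite mul1n.
  by rewrite mul0n; apply/eqP/mK; rewrite eq_sym il.
move=> /andP[lK uK]; rewrite inE negb_or => /andP[il iK].
have {IH} := IH uK iK; set F := ps_kill _ f; set F' := ps_kill _ f => FP.
have li : l != i by rewrite eq_sym.
pose D := flow i l (ps_kill (fun j => (j != i) && (j \notin l :: K)) (a l)).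
have DF : D F' = 0.
  rewrite /D /flow /F' !ps_kill_deriv ?inE ?eqxx ?andbF //.
  by rewrite fa rmorphM subrr.
have FF' (m : 'X_{1..n}) : m l = 0%N -> F m = F' m.
  move=> ml; rewrite /F /F' /ps_kill.
  suff -> : [forall (j | (j != i) && (j \notin K)), m j == 0%N] =
     [forall (j | (j != i) && (j \notin l :: K)), m j == 0%N] by [].
  apply/forall_inP/forall_inP => H j; rewrite ?inE => /andP[ji jK]; apply/eqP.
    by apply/eqP/H; rewrite ji; move: jK; rewrite negb_or => /andP[].
  case: (eqVneq j l) => [->//|jl]; apply/eqP/H.
  by rewrite ji inE negb_or jl.
have uniqF' G : D G = 0 -> (forall m : 'X_{1..n}, m l = 0%N -> G m = F m) -> F' = G.
  move=> DG GF; apply/eqP; rewrite -subr_eq0; apply/eqP.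
  apply: (flow_unique hk li (a := ps_kill (fun j => (j != i) && (j \notin l :: K)) (a l))).
    by rewrite flowD flowN; move: DF DG; rewrite /D => -> ->; rewrite subrr.
  by move=> m ml; rewrite psBE GF // FF' // subrr.
case: FP => [F0|[u0 [y0 [e [u00 y00 yU eF]]]]].
  left; apply: uniqF' => [|m _]; last by rewrite F0.
  by rewrite /D /flow !raddf0 mulr0 subrr.
right; have [u Du ul] := flow_exists hk li (ps_kill (fun j => (j != i) && (j \notin l :: K)) (a l)) u0.
have [y Dy yl] := flow_exists hk li (ps_kill (fun j => (j != i) && (j \notin l :: K)) (a l)) y0.
exists u, y, e; split.
- by rewrite ul ?mnm0E.
- by rewrite yl ?mnm0E.
- by rewrite yl // mnm1E (negPf il).
apply: uniqF' => [|m ml].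
  rewrite /D flowM Du mul0r add0r; case: (e) => [|e'].
    by rewrite expr0 -(rmorph1 (@psC k n)) flowC mulr0.
  by rewrite flow_exp Dy mulr0 mul0rn mulr0.
have killE (G G' : S) : (forall m : 'X_{1..n}, m l = 0%N -> G m = G' m) ->
    ps_kill (pred1 l) G = ps_kill (pred1 l) G'.
  move=> GG'; apply: funext => m'; rewrite /ps_kill; case: ifP => // /forall_inP ml'.
  by apply: GG'; apply/eqP/ml' => /=.
have : ps_kill (pred1 l) (u * y ^+ e) = ps_kill (pred1 l) F.
  by rewrite eF !rmorphM !rmorphXn /= (killE _ _ ul) (killE _ _ yl).
move/(congr1 (fun G : S => G m)); rewrite !ps_kill_coef //.
  by move=> j /eqP->.
by move=> j /eqP->.
Qed.

End PrincipalGradient.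

(** As [d_i f = a_i g] and the [d_i f] generate [(g)], one of the [a_i] is a unit,
    so that all partial derivatives are multiples of this [d_i f].  Then
    [f - f(0)] is a unit times [y ^ e.+2] for a parameter [y] with a linear term
    in [x_i], and [d_i f] is a unit times [y ^ e.+1] in characteristic zero. *)
Theorem principal_gradient_ideal (k : fieldType) n (g f : pseries k n) :
  [pchar k] =i pred0 -> g <> 0 ->
  ideal_gen [set g] = gradient_ideal_of f -> ~ ideal_gen [set g] 1 ->
  exists (i : 'I_n) (y : pseries k n) e, [/\ y 0%MM = 0, y U_(i)%MM != 0 &
    ideal_gen [set g] = ideal_gen [set y ^+ e.+1]].
Proof.
move=> hk g0 eI I1.
have ga i : exists a, psderiv i f = a * g.
  by apply/ideal_gen1P; rewrite eI; apply: ideal_gen_sub; exists i.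
have [a fa] := choice ga.
have [b eg] : exists b : 'I_n -> pseries k n, g = \sum_i b i * psderiv i f.
  by apply/ideal_genP; rewrite -[ideal_gen _]/(gradient_ideal_of f) -eI; apply: ideal_gen_sub.
have ab1 : \sum_i b i * a i = 1.
  apply: (ps_mulI g0); rewrite mulr1 [RHS]eg mulr_sumr; apply: eq_bigr => i _.
  by rewrite fa; ring.
have [i ai] : exists i, a i 0%MM != 0.
  apply: contrapT => none; have := congr1 (fun h : pseries k n => h 0%MM) ab1.
  rewrite ps_sumE big1 => [|i _]; last first.
    rewrite ps_coef0M; case: (eqVneq (a i 0%MM) 0) => [->|ai]; first by rewrite mulr0.
    by case: none; exists i.
  by rewrite ps1E /psC eqxx => /esym/eqP; rewrite oner_eq0.
have [c ac] := ps_unit ai.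
have eg' : g = c * psderiv i f by rewrite fa mulrA [c * _]mulrC ac mul1r.
pose f1 := f - psC (f 0%MM).
have df1 j : psderiv j f1 = psderiv j f by rewrite /f1 raddfB /= psderivC subr0.
have [|f10|[u [y [e [u0 y0 yU ef]]]]] := @gradient_multiple_param_power k n hk i f1 (fun j => a j * c).
- by move=> j; rewrite !df1 -mulrA -eg' fa.
- by case: g0; rewrite eg' -df1 f10 raddf0 mulr0.
case: e ef => [|e] ef.
  have := congr1 (fun h : pseries k n => h 0%MM) ef.
  by rewrite expr0 mulr1 /f1 psBE /psC eqxx subrr => /esym/eqP; rewrite (negPf u0).
have eder : psderiv i f = y ^+ e * (u * psderiv i y *+ e.+1 + psderiv i u * y).
  rewrite -df1 ef psderivM psderivX exprS mulrDr addrC mulrnAr mulrnAr; congr (_ *+ _ + _); ring.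
have w0 : (c * (u * psderiv i y *+ e.+1 + psderiv i u * y)) 0%MM != 0.
  rewrite ps_coef0M mulf_neq0 //.
    have := congr1 (fun h : pseries k n => h 0%MM) ac.
    rewrite ps_coef0M ps1E /psC eqxx => ac1; apply/eqP => c0.
    by move: ac1; rewrite c0 mulr0 => /esym/eqP; rewrite oner_eq0.
  rewrite psDE (ps_coef0M (psderiv i u)) y0 mulr0 addr0 ps_mulrnE psC_mulE ps_coef0M.
  rewrite psderivE add0m mnm0E mulr1n !mulf_neq0 //.
  exact: natf_neq0_char0.
have [v wv] := ps_unit w0.
have egy : ideal_gen [set g] = ideal_gen [set y ^+ e].
  apply: idealP => h; split=> /ideal_gen1P[q ->]; apply/ideal_gen1P.
    rewrite eg' eder; exists (q * (c * (u * psderiv i y *+ e.+1 + psderiv i u * y))); ring.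
  exists (q * v); rewrite eg' eder.
  have -> : q * v * (c * (y ^+ e * (u * psderiv i y *+ e.+1 + psderiv i u * y))) =
    q * y ^+ e * (c * (u * psderiv i y *+ e.+1 + psderiv i u * y) * v) by ring.
  by rewrite wv mulr1.
case: e egy {ef eder w0 wv} => [|e] egy.
  by case: I1; rewrite egy expr0; apply: ideal_gen_sub.
by exists i, y, e.
Qed.

(** * Formal changes of coordinates *)

Section Substitution.
Variables (k : fieldType) (n : nat).
Local Notation S := (pseries k n).

Definition ps_subst (v : 'I_n -> S) (F : S) : S :=
  fun m => ps_eval v (ps_trunc (mdeg m).+1 F) m.

Lemma ps_subst_poly (v : 'I_n -> S) F s (p : {mpoly k[n]}) :
  (forall i, ord_ge 1 (v i)) -> (forall m, (mdeg m < s)%N -> p@_m = F m) ->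
  ord_ge s (ps_subst v F - ps_eval v p).
Proof.
move=> v0 pF m ms; rewrite psBE /ps_subst -psBE -rmorphB /=.
apply: (ord_ge_eval v0 (s := (mdeg m).+1)) => // l lm.
by rewrite mcoeffB ps_truncE // pF ?subrr // (leq_trans lm).
Qed.

Lemma ps_eval_psX (p : {mpoly k[n]}) m : ps_eval (@psX k n) p m = p@_m.
Proof.
elim/mpoly_ring_ind: p m => [c|i|p q ep eq|p q ep eq] m.
- by rewrite ps_evalC mcoeffC /psC; case: eqP; rewrite ?mulr1 ?mulr0.
- by rewrite ps_evalX mcoeffX /psX eq_sym; case: eqP.
- by rewrite ps_evalD psDE mcoeffD ep eq.
- by rewrite ps_evalM (psM_coef (p := p) (q := q)).
Qed.

Lemma ps_eval_trunc s F : ord_ge s (F - ps_eval (@psX k n) (ps_trunc s F)).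
Proof. by move=> m ms; rewrite psBE ps_eval_psX ps_truncE // subrr. Qed.

Section SubstHom.
Variables (v : 'I_n -> S) (v0 : forall i, ord_ge 1 (v i)).

Let sub_tr s F := @ps_subst_poly v F s (ps_trunc s F) v0 (fun m => @ps_truncE k n s F m).

Lemma ps_substB : {morph ps_subst v : F G / F - G}.
Proof.
move=> F G; apply/eqP; rewrite -subr_eq0; apply/eqP/ord_ge_eq0 => s.
have FG : ord_ge s (ps_subst v (F - G) - ps_eval v (ps_trunc s F - ps_trunc s G)).
  by apply: ps_subst_poly => // m ms; rewrite mcoeffB !ps_truncE.
have -> : ps_subst v (F - G) - (ps_subst v F - ps_subst v G) =
  (ps_subst v (F - G) - ps_eval v (ps_trunc s F - ps_trunc s G)) -
  ((ps_subst v F - ps_eval v (ps_trunc s F)) -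
   (ps_subst v G - ps_eval v (ps_trunc s G))) by rewrite rmorphB /=; ring.
by apply: ord_geB => //; apply: ord_geB; apply: sub_tr.
Qed.

Lemma ps_substM : {morph ps_subst v : F G / F * G}.
Proof.
move=> F G; apply/eqP; rewrite -subr_eq0; apply/eqP/ord_ge_eq0 => s.
have FG : ord_ge s (ps_subst v (F * G) - ps_eval v (ps_trunc s F * ps_trunc s G)).
  by apply: ps_subst_poly => // m ms; rewrite -psM_trunc.
have -> : ps_subst v (F * G) - (ps_subst v F * ps_subst v G) =
  (ps_subst v (F * G) - ps_eval v (ps_trunc s F * ps_trunc s G)) -
  (ps_subst v F * (ps_subst v G - ps_eval v (ps_trunc s G)) +
   ps_eval v (ps_trunc s G) * (ps_subst v F - ps_eval v (ps_trunc s F))).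
  by rewrite ps_evalM; ring.
by apply: ord_geB => //; apply: ord_geD; apply: ord_ge_mull; apply: sub_tr.
Qed.

Lemma ps_substC c : ps_subst v (psC c) = psC c.
Proof.
apply/eqP; rewrite -subr_eq0; apply/eqP/ord_ge_eq0 => s.
rewrite -[X in _ - X](ps_evalC v); apply: ps_subst_poly => // m _.
by rewrite mcoeffC /psC; case: eqP; rewrite ?mulr1 ?mulr0.
Qed.

Lemma ps_substX i : ps_subst v (psX k i) = v i.
Proof.
apply/eqP; rewrite -subr_eq0; apply/eqP/ord_ge_eq0 => s.
rewrite -(ps_evalX v); apply: ps_subst_poly => // m _.
by rewrite mcoeffX /psX eq_sym; case: eqP.
Qed.

Lemma ps_subst_zero : ps_subst v 0 = 0.
Proof. by rewrite -[X in ps_subst v X](subrr 0) ps_substB subrr. Qed.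

Lemma ps_substD : {morph ps_subst v : F G / F + G}.
Proof.
move=> F G; have -> : F + G = F - (0 - G) by rewrite sub0r opprK.
by rewrite !ps_substB ps_subst_zero sub0r opprK.
Qed.

Lemma ord_ge_subst s F : ord_ge s F -> ord_ge s (ps_subst v F).
Proof.
move=> sF; rewrite -[ps_subst v F]subr0 -(rmorph0 (ps_eval v)).
by apply: ps_subst_poly => // m ms; rewrite mcoeff0 sF.
Qed.

Lemma ps_subst0 F : ps_subst v F 0%MM = F 0%MM.
Proof.
have := @ps_subst_poly v F 1 (ps_trunc 1 F) v0 (fun m => @ps_truncE k n 1 F m).
move=> /ord_ge_trunc_eq/(_ 0%MM); rewrite mdeg0 => -> //.
by rewrite ps_eval0 // ps_truncE // mdeg0.
Qed.

(** On truncations, both maps are the evaluation of the same polynomial. *)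
Lemma ps_subst_unique (sigma : S -> S) :
  {morph sigma : F G / F + G} -> {morph sigma : F G / F * G} ->
  (forall c, sigma (psC c) = psC c) -> (forall i, sigma (psX k i) = v i) ->
  (forall s F, ord_ge s F -> ord_ge s (sigma F)) -> sigma =1 ps_subst v.
Proof.
move=> sD sM sC sX so F; apply/eqP; rewrite -subr_eq0; apply/eqP/ord_ge_eq0 => s.
have ev p : sigma (ps_eval (@psX k n) p) = ps_eval v p.
  elim/mpoly_ring_ind: p => [c|i|p q ep eq|p q ep eq].
  - by rewrite !ps_evalC.
  - by rewrite !ps_evalX.
  - by rewrite !ps_evalD sD ep eq.
  - by rewrite !ps_evalM sM ep eq.
have eF : sigma F = sigma (F - ps_eval (@psX k n) (ps_trunc s F)) +
    ps_eval v (ps_trunc s F) by rewrite -ev -sD subrK.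
have -> : sigma F - ps_subst v F = sigma (F - ps_eval (@psX k n) (ps_trunc s F))
   - (ps_subst v F - ps_eval v (ps_trunc s F)).
  by rewrite eF; ring.
by apply: ord_geB; [apply/so/ps_eval_trunc|apply: sub_tr].
Qed.

End SubstHom.

Lemma ps_subst_comp (v w : 'I_n -> S) : (forall i, ord_ge 1 (v i)) ->
  (forall i, ord_ge 1 (w i)) ->
  ps_subst v \o ps_subst w =1 ps_subst (fun i => ps_subst v (w i)).
Proof.
move=> v0 w0; apply: ps_subst_unique => [i|F G|F G|c|i|s F sF] /=.
- exact: ord_ge_subst.
- by rewrite !ps_substD.
- by rewrite !ps_substM.
- by rewrite !ps_substC.
- by rewrite ps_substX.
- by do 2 apply: ord_ge_subst => //.
Qed.

Section TangentToIdentity.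
Variables (v : 'I_n -> S) (vX : forall i, ord_ge 2 (v i - psX k i)).

Lemma tangent_ord i : ord_ge 1 (v i).
Proof.
rewrite -[v i](subrK (psX k i)); apply: ord_geD; last exact: ord_ge_X.
exact: ord_ge_le (vX i).
Qed.
Let v0 := tangent_ord.

Lemma tangent_monomial (m : 'X_{1..n}) :
  ord_ge (mdeg m).+1 (ps_eval v 'X_[m] - ps_eval (@psX k n) 'X_[m]).
Proof.
have ordX (l : 'X_{1..n}) : ord_ge (mdeg l) (ps_eval v 'X_[l]).
  apply: ord_ge_eval => // l' ll'; rewrite mcoeffX; case: eqP => // e.
  by rewrite e ltnn in ll'.
move: {1}(mdeg m) (erefl (mdeg m)) => d.
elim: d m => [|d IH] m dm.
  move/esym/eqP: dm; rewrite mdeg_eq0 => /eqP->.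
  by rewrite mpolyX0 !rmorph1 subrr; apply: ord_ge_zero.
have [i [l [em dl]]] := mpolyX_split (esym dm).
rewrite em mdegD mdeg1 dl add1n mpolyXD !ps_evalM !ps_evalX.
set A := ps_eval v _; set B := ps_eval _ _.
rewrite (_ : _ - _ = (v i - psX k i) * A + psX k i * (A - B)); last first.
  by rewrite mulrBl mulrBr addrA subrK.
apply: ord_geD.
  by rewrite -[d.+2]add2n; apply: ord_geM => //; rewrite -dl; apply: ordX.
rewrite -[d.+2]add1n; apply: ord_geM; first exact: ord_ge_X.
by have := IH l (esym dl); rewrite dl.
Qed.

Lemma tangent_subst s F : ord_ge s F -> ord_ge s.+1 (ps_subst v F - F).
Proof.
move=> sF; set p := ps_trunc s.+1 F.
rewrite (_ : _ - F = (ps_subst v F - ps_eval v p) -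
  (F - ps_eval (@psX k n) p) + (ps_eval v p - ps_eval (@psX k n) p)); last first.
  by rewrite opprB [RHS]addrAC !subrKA.
apply: ord_geD; first apply: ord_geB.
- by apply: ps_subst_poly => // m ms; rewrite ps_truncE.
- exact: ps_eval_trunc.
rewrite [p in ps_eval v p]mpolyE [p in _ - _ p]mpolyE !rmorph_sum /= -sumrB big_seq.
apply: ord_ge_sum => m; rewrite mcoeff_msupp => pm.
rewrite -mul_mpolyC !ps_evalM !ps_evalC -mulrBr; apply: ord_ge_mull.
have ms : (s <= mdeg m)%N; last exact: ord_ge_le (@tangent_monomial m).
rewrite leqNgt; apply/negP => ms.
by case/eqP: pm; rewrite ps_truncE ?sF // ltnS ltnW.
Qed.

Lemma tangent_subst_ord s F : ord_ge s (ps_subst v F) -> ord_ge s F.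
Proof.
elim: s => [|s IH] sF; first exact: ord_ge0.
rewrite -[F](subKr (ps_subst v F)); apply: ord_geB => //.
exact/tangent_subst/IH/(ord_ge_le (leqnSn s)).
Qed.

Lemma tangent_subst_inj F : ps_subst v F = 0 -> F = 0.
Proof.
move=> F0; apply: ord_ge_eq0; elim=> [|s IH]; first exact: ord_ge0.
by rewrite -[F]opprK -[- F]add0r -F0; apply/ord_geN/tangent_subst.
Qed.

(** The substitution differs from the identity by an operator raising the order,
    so that it is inverted by a geometric series. *)
Lemma tangent_subst_surj G : exists F, ps_subst v F = G.
Proof.
pose T F := F - ps_subst v F.
have ordT s : ord_ge s (iter s T G).
  elim: s => [|s IH]; first exact: ord_ge0.
  by rewrite iterS /T -opprB; apply/ord_geN/tangent_subst.
have [F FP] := ps_series ordT; exists F.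
apply/eqP; rewrite -subr_eq0; apply/eqP/ord_ge_eq0 => s.
have sumT : ps_subst v (\sum_(i < s) iter i T G) = G - iter s T G.
  elim: s => [|s IH]; first by rewrite big_ord0 subrr ps_subst_zero.
  rewrite big_ord_recr /= ps_substD // IH /T; ring.
rewrite -[F](subrK (\sum_(i < s) iter i T G)) ps_substD // sumT addrA addrAC addrK.
by apply: ord_geB => //; apply: ord_ge_subst.
Qed.

End TangentToIdentity.

Definition ps_lin (F : S) : S := \sum_j psC (F U_(j)%MM) * psX k j.

Lemma ps_linE F m : mdeg m = 1%N -> ps_lin F m = F m.
Proof.
move=> /eqP/mdeg1P[j /eqP->]; rewrite /ps_lin ps_sumE (bigD1 j) //= big1 ?addr0.
  by rewrite psC_mulE /psX eqxx mulr1.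
by move=> l lj; rewrite psC_mulE /psX eq_mnm1 eq_sym (negPf lj) mulr0.
Qed.

Lemma ord_ge_sub_lin F : ord_ge 1 F -> ord_ge 2 (F - ps_lin F).
Proof.
move=> F1 m; case dm: (mdeg m) => [|[|d]] // _; rewrite psBE.
  rewrite F1 ?dm // sub0r /ps_lin ps_sumE big1 ?oppr0 // => j _.
  by rewrite psC_mulE ord_ge_X ?mulr0 // dm.
by rewrite ps_linE // subrr.
Qed.

(** The case needed below: a parameter [v i] with a linear term in [x_i] replaces
    [x_i], and the other variables are unchanged to first order. *)
Section ReplaceVariable.
Variables (v : 'I_n -> S) (i : 'I_n) (vi : v i 0%MM = 0) (vU : v i U_(i)%MM != 0).
Hypothesis vX : forall j, j != i -> ord_ge 2 (v j - psX k j).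

Let v0 j : ord_ge 1 (v j).
Proof.
case: (eqVneq j i) => [->|ji]; first exact/ord_ge1.
rewrite -[v j](subrK (psX k j)); apply: ord_geD; last exact: ord_ge_X.
exact: ord_ge_le (vX ji).
Qed.

Let w j : S := if j == i then psC (v i U_(i)%MM)^-1 *
  (psX k i - \sum_(l | l != i) psC (v i U_(l)%MM) * psX k l) else psX k j.

Let w0 j : ord_ge 1 (w j).
Proof.
rewrite /w; case: eqP => _; last exact: ord_ge_X.
apply/ord_ge_mull/ord_geB; first exact: ord_ge_X.
by apply: ord_ge_sum => l _; apply/ord_ge_mull/ord_ge_X.
Qed.

Let subst_sum (u : 'I_n -> S) (P : pred 'I_n) (c : 'I_n -> k) :
  (forall j, ord_ge 1 (u j)) ->
  ps_subst u (\sum_(l | P l) psC (c l) * psX k l) = \sum_(l | P l) psC (c l) * u l.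
Proof.
move=> u0; rewrite (big_morph _ (ps_substD u0) (ps_subst_zero u0)); apply: eq_bigr => l _.
by rewrite ps_substM // ps_substC // ps_substX.
Qed.

Let vw j : ord_ge 2 (ps_subst v (w j) - psX k j).
Proof.
rewrite /w; case: (eqVneq j i) => [->|ji]; last by rewrite ps_substX //; apply: vX.
rewrite ps_substM // ps_substC // ps_substB // ps_substX // subst_sum //.
have -> : psC (v i U_(i)%MM)^-1 * (v i - \sum_(l | l != i) psC (v i U_(l)%MM) * v l)
    - psX k i = psC (v i U_(i)%MM)^-1 * (v i - ps_lin (v i)
    - \sum_(l | l != i) psC (v i U_(l)%MM) * (v l - psX k l)).
  have e1 : psC (v i U_(i)%MM)^-1 * psC (v i U_(i)%MM) = 1 :> S.
    by rewrite -rmorphM mulVf // rmorph1.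
  have eS : \sum_(l | l != i) psC (v i U_(l)%MM) * (v l - psX k l) =
      \sum_(l | l != i) psC (v i U_(l)%MM) * v l -
      \sum_(l | l != i) psC (v i U_(l)%MM) * psX k l.
    by rewrite -sumrB; apply: eq_bigr => l _; rewrite mulrBr.
  have eL : ps_lin (v i) = psC (v i U_(i)%MM) * psX k i +
      \sum_(l | l != i) psC (v i U_(l)%MM) * psX k l by rewrite /ps_lin (bigD1 i).
  rewrite eS eL opprD opprB -[in RHS]addrA subrKA.
  by rewrite [in RHS]addrA [in RHS]addrAC [RHS]mulrBr mulrA e1 mul1r.
apply/ord_ge_mull/ord_geB; first exact: ord_ge_sub_lin.
by apply: ord_ge_sum => l li; apply/ord_ge_mull/vX.
Qed.

Let wv j : ord_ge 2 (ps_subst w (v j) - psX k j).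
Proof.
rewrite -{1}[v j](subrK (ps_lin (v j))) ps_substD // -addrA.
apply: ord_geD; first exact/ord_ge_subst/ord_ge_sub_lin.
rewrite /ps_lin subst_sum //; case: (eqVneq j i) => [->|ji].
  rewrite (bigD1 i) //= {1}/w eqxx mulrA -rmorphM mulfV // rmorph1 mul1r.
  rewrite addrAC -!addrA [X in _ + X]addrA.
  have -> : \sum_(l | l != i) psC (v i U_(l)%MM) * w l =
            \sum_(l | l != i) psC (v i U_(l)%MM) * psX k l.
    by apply: eq_bigr => l li; rewrite /w (negPf li).
  by rewrite addrCA [X in _ + X]addrC; rewrite [X in ord_ge 2 X](_ : _ = 0) //; ring.
have vjU l : v j U_(l)%MM = (j == l)%:R.
  rewrite (ord_ge_trunc_eq (vX ji)) ?mdeg1 // /psX eq_mnm1 eq_sym.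
  by case: eqP.
rewrite (bigD1 j) //= big1 ?addr0 => [|l lj]; last first.
  by rewrite vjU eq_sym (negPf lj) rmorph0 mul0r.
by rewrite vjU eqxx rmorph1 mul1r /w (negPf ji) subrr.
Qed.

Lemma replace_variable_ord s F : ord_ge s (ps_subst v F) -> ord_ge s F.
Proof.
move=> sF; apply: (tangent_subst_ord wv); rewrite -(ps_subst_comp w0 v0) /=.
exact: ord_ge_subst.
Qed.

Lemma replace_variable_inj F : ps_subst v F = 0 -> F = 0.
Proof.
move=> F0; apply: (tangent_subst_inj wv); rewrite -(ps_subst_comp w0 v0) /= F0.
exact: ps_subst_zero.
Qed.

Lemma replace_variable_surj G : exists F, ps_subst v F = G.
Proof.
have [F <-] := tangent_subst_surj vw G; exists (ps_subst w F).
by rewrite -(ps_subst_comp v0 w0).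
Qed.

End ReplaceVariable.

End Substitution.

(** * Lifting elements of a local ring to power series *)

(** [Lam r F] means that [r] and [F] have the same image in [k[[x]] / (g)], for a
    homomorphism from [R] to this ring that reflects the powers of the maximal
    ideals.  Working with this relation instead of the homomorphism makes
    changes of coordinates in [k[[x]]] transparent. *)
Record lift_relation (k : fieldType) n (R : comPzRingType) (m : ideal R)
    (sc : k -> R) (Lam : R -> pseries k n -> Prop) (g : pseries k n) : Prop :=
  LiftRelation {
  lr_total : forall r, exists F, Lam r F;
  lr_add : forall r r' F F', Lam r F -> Lam r' F' -> Lam (r + r') (F + F');
  lr_mul : forall r r' F F', Lam r F -> Lam r' F' -> Lam (r * r') (F * F');
  lr_const : forall c, Lam (sc c) (psC c);
  lr_zero : forall F, Lam 0 F <-> exists q, F = q * g;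
  lr_ord : forall s r F, Lam r F -> ord_ge s F -> ideal_exp m s r;
  lr_max : forall r F, m r -> Lam r F -> ord_ge 1 F
}.

Section PolynomialOrder.
Variables (k : fieldType) (N : nat).
Implicit Types p q : {mpoly k[N]}.

Definition poly_ord s p : Prop := forall m, (mdeg m < s)%N -> p@_m = 0.

Lemma poly_ordE s p : poly_ord s p <-> ord_ge s (ps_eval (@psX k N) p).
Proof. by split=> H m /H; rewrite ps_eval_psX. Qed.

Lemma poly_ordD s p q : poly_ord s p -> poly_ord s q -> poly_ord s (p + q).
Proof. by move=> sp sq m ms; rewrite mcoeffD sp // sq // addr0. Qed.

Lemma poly_ordM s t p q : poly_ord s p -> poly_ord t q -> poly_ord (s + t) (p * q).
Proof.
move=> /poly_ordE sp /poly_ordE tq; apply/poly_ordE; rewrite ps_evalM.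
exact: ord_geM.
Qed.

Lemma poly_ord_mull s p q : poly_ord s q -> poly_ord s (p * q).
Proof. by rewrite -[s]add0n; apply: poly_ordM. Qed.

Lemma poly_ord_le s t p : (s <= t)%N -> poly_ord t p -> poly_ord s p.
Proof. by move=> st tp m ms; apply/tp/(leq_trans ms). Qed.

Lemma poly_ordX i : poly_ord 1 'X_i.
Proof.
move=> m; rewrite ltnS leqn0 mdeg_eq0 => /eqP->.
by rewrite mcoeffX mnm1_eq0.
Qed.

Lemma poly_ordXn i e : poly_ord e ('X_i ^+ e).
Proof.
elim: e => [//|e IH]; rewrite exprS -add1n; apply: poly_ordM => //.
exact: poly_ordX.
Qed.

Lemma mcoeffU_mulX i j q : ('X_i * q)@_U_(j) = (i == j)%:R * q@_0%MM.
Proof.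
rewrite -ps_eval_psX ps_evalM ps_evalX psX_mulE mnm1E eq_sym.
case: (eqVneq i j) => [->|_]; last by rewrite mul0r.
rewrite mul1r ps_eval_psX; congr (_@__).
by apply/mnmP => l; rewrite mnmBE subnn mnm0E.
Qed.

Lemma mderiv0 i q : (mderiv i q)@_0%MM = q@_U_(i).
Proof. by rewrite mcoeff_deriv add0m mnm0E. Qed.

End PolynomialOrder.

Lemma ideal_exp_frac (k : fieldType) N (R : comPzRingType) (m : ideal R)
    (phi : {rmorphism {mpoly k[N]} -> R}) (lp : local_presentation m phi) s r :
  ideal_exp m s r ->
  exists q P, [/\ q@_0%MM != 0, poly_ord s P & phi q * r = phi P].
Proof.
elim: s r => [|s IH] r.
  by move=> _; have [p [q [q0 e]]] := lp_frac lp r; exists q, p.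
have @J : ideal R.
  exists [set r : R | exists q P,
     [/\ q@_0%MM != 0, poly_ord s.+1 P & phi q * r = phi P]].
  - exists 1, 0; rewrite mcoeff1 eqxx oner_neq0 mulr0 rmorph0; split=> //.
    by move=> l _; rewrite mcoeff0.
  - move=> x y [q [P [q0 oP e]]] [q' [P' [q'0 oP' e']]].
    exists (q * q'), (q' * P + q * P'); split.
    + by rewrite mcoeff0M mulf_neq0.
    + by apply: poly_ordD; apply: poly_ord_mull.
    + rewrite (rmorphD phi) !(rmorphM phi) -e -e'; ring.
  - move=> a x [q [P [q0 oP e]]]; have [p' [q' [q'0 e']]] := lp_frac lp a.
    exists (q' * q), (p' * P); split.
    + by rewrite mcoeff0M mulf_neq0.
    + exact: poly_ord_mull.
    + rewrite !(rmorphM phi) -e -e'; ring.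
apply: (ideal_exp_ind (J := J)) => x y /(lp_mem_frac lp)[p [q [q0 e p0]]].
move=> /IH[q' [P [q'0 oP e']]]; exists (q * q'), (p * P); split.
- by rewrite mcoeff0M mulf_neq0.
- rewrite -add1n; apply: poly_ordM => // l.
  by rewrite ltnS leqn0 mdeg_eq0 => /eqP->.
- by rewrite !(rmorphM phi) -e -e' mulrACA.
Qed.

Section LiftRelation.
Variables (k : fieldType) (n N : nat) (R : comPzRingType) (m : ideal R).
Variables (phi : {rmorphism {mpoly k[N]} -> R}) (lp : local_presentation m phi).
Variables (Lam : R -> pseries k n -> Prop) (g : pseries k n).
Hypothesis lr : lift_relation m (fun c => phi c%:MP) Lam g.

Lemma lift_opp r F : Lam r F -> Lam (- r) (- F).
Proof.
move=> rF; have := lr_mul lr (lr_const lr (-1)) rF.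
by rewrite mpolyCN mpolyC1 !rmorphN !rmorph1 !mulN1r.
Qed.

Lemma lift_sub r r' F F' : Lam r F -> Lam r' F' -> Lam (r - r') (F - F').
Proof. by move=> rF rF'; apply: (lr_add lr) => //; apply: lift_opp. Qed.

Lemma lift_exp r F s : Lam r F -> Lam (r ^+ s) (F ^+ s).
Proof.
move=> rF; elim: s => [|s IH]; last by rewrite !exprS; apply: (lr_mul lr).
by have := lr_const lr 1; rewrite mpolyC1 !rmorph1 !expr0.
Qed.

Lemma lift_zero0 : Lam 0 0.
Proof. by apply/(lr_zero lr); exists 0; rewrite mul0r. Qed.

Lemma lift_sum (T : Type) (l : seq T) (P : pred T) (a : T -> R)
    (F : T -> pseries k n) : (forall i, Lam (a i) (F i)) ->
  Lam (\sum_(i <- l | P i) a i) (\sum_(i <- l | P i) F i).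
Proof.
move=> aF; apply: (big_ind2 (fun x y => Lam x y)) => //; first exact: lift_zero0.
by move=> x1 x2 y1 y2; apply: (lr_add lr).
Qed.

Lemma lift_unique r F F' : Lam r F -> Lam r F' -> exists q, F - F' = q * g.
Proof.
by move=> rF rF'; apply/(lr_zero lr); rewrite -(subrr r); apply: lift_sub.
Qed.

Lemma lift_ord s r F q : Lam r F -> ord_ge s (F + q * g) -> ideal_exp m s r.
Proof.
move=> rF; apply: (lr_ord lr); rewrite -[r]addr0; apply: (lr_add lr) => //.
by apply/(lr_zero lr); exists q.
Qed.

Lemma lift_eq0 r q : Lam r (q * g) -> r = 0.
Proof.
move=> rqg; apply: (krull_zero lp) => s; apply: (lift_ord (q := - q) rqg).
by rewrite mulNr subrr; apply: ord_ge_zero.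
Qed.

Lemma lift_eval (tau : 'I_N -> pseries k n) p :
  (forall v, Lam (phi 'X_v) (tau v)) -> Lam (phi p) (ps_eval tau p).
Proof.
move=> tauP; elim/mpoly_ring_ind: p => [c|v|p q ep eq|p q ep eq].
- by rewrite ps_evalC; apply: (lr_const lr).
- by rewrite ps_evalX.
- by rewrite ps_evalD rmorphD; apply: (lr_add lr).
- by rewrite ps_evalM rmorphM; apply: (lr_mul lr).
Qed.

Lemma lift_subst (v : 'I_n -> pseries k n) (g' : pseries k n) :
  (forall i, ord_ge 1 (v i)) -> (forall F, ps_subst v F = 0 -> F = 0) ->
  (forall G, exists F, ps_subst v F = G) -> ps_subst v g' = g ->
  lift_relation m (fun c => phi c%:MP) (fun r F => Lam r (ps_subst v F)) g'.
Proof.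
move=> v0 inj surj eg; split.
- by move=> r; have [F rF] := lr_total lr r; have [G eG] := surj F; exists G; rewrite eG.
- by move=> r r' F F' rF rF'; rewrite ps_substD //; apply: (lr_add lr).
- by move=> r r' F F' rF rF'; rewrite ps_substM //; apply: (lr_mul lr).
- by move=> c; rewrite ps_substC //; apply: (lr_const lr).
- move=> F; split=> [/(lr_zero lr)[q eF]|[q ->]]; last first.
    by rewrite ps_substM // eg; apply/(lr_zero lr); exists (ps_subst v q).
  have [q' eq'] := surj q; exists q'; apply/eqP; rewrite -subr_eq0; apply/eqP/inj.
  by rewrite ps_substB // ps_substM // eg eq' eF subrr.
- by move=> s r F rF sF; apply: (lr_ord lr) rF _; apply: ord_ge_subst.
- by move=> r F mr /(lr_max lr mr)/ord_ge1; rewrite ps_subst0 // => F0; apply/ord_ge1.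
Qed.

End LiftRelation.

(** ** A nilpotent element of order one *)

Section Nilpotent.
Variables (k : fieldType) (hk : [pchar k] =i pred0) (n N : nat).
Variables (R : comPzRingType) (m : ideal R).
Variables (phi : {rmorphism {mpoly k[n + N]} -> R}) (lp : local_presentation m phi).
Variables (Lam : R -> pseries k n -> Prop) (i : 'I_n) (e : nat) (e2 : (2 <= e)%N).
Hypothesis lr : lift_relation m (fun c => phi c%:MP) Lam (psX k i ^+ e).
Variables (tau : 'I_(n + N) -> pseries k n).
Hypotheses (tauP : forall v, Lam (phi 'X_v) (tau v))
  (tau_a : forall j, j != i -> tau (lshift N j) = psX k j)
  (tau_ai : ord_ge 2 (tau (lshift N i) - psX k i))
  (tau_b : forall l, ord_ge 2 (tau (rshift n l))).

Local Notation x := (psX k i).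
Local Notation ev := (ps_eval tau).
Local Notation da := (mderiv (lshift N i)).
Local Notation db l := (mderiv (rshift n l)).

Let tau1 v : ord_ge 1 (tau v).
Proof.
case: (splitP v) => j vj; last first.
  by rewrite (_ : v = rshift n j); [apply: ord_ge_le (tau_b j)|apply: val_inj].
have -> : v = lshift N j by apply: val_inj.
case: (eqVneq j i) => [->|ji]; last by rewrite tau_a //; apply: ord_ge_X.
rewrite -[tau _](subrK x); apply: ord_geD; last exact: ord_ge_X.
exact: ord_ge_le tau_ai.
Qed.

Let ev0 p : ev p 0%MM = p@_0%MM. Proof. exact: ps_eval0. Qed.

(* The coordinates of the second group lie in [m ^ 2], so that each of them
   satisfies a relation whose linear term is this coordinate. *)
Let relations : exists h : 'I_N -> {mpoly k[n + N]}, forall l, phi (h l) = 0 /\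
  forall l', (db l' (h l))@_0%MM = (l == l')%:R.
Proof.
suff H l : exists h : {mpoly k[n + N]}, phi h = 0 /\
    forall l', (db l' h)@_0%MM = (l == l')%:R by have [f fP] := choice H; exists f.
have ml : ideal_exp m 2 (phi 'X_(rshift n l)).
  by apply: (lr_ord lr) (tauP _) _.
have [q [P [q0 oP eP]]] := ideal_exp_frac lp ml.
exists ((q@_0%MM)^-1%:MP * ('X_(rshift n l) * q - P)); split.
  by rewrite rmorphM rmorphB rmorphM [phi 'X_ _ * _]mulrC eP subrr mulr0.
move=> l'; rewrite mderiv0 mcoeffCM mcoeffB mcoeffU_mulX oP ?mdeg1 // subr0.
by rewrite mulrCA mulVf // mulr1 (inj_eq (@rshift_inj _ _)).
Qed.

(* The power [e] of the coordinate lifting to [x], up to order two, vanishes up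
   to an element of [m ^ e.+1]; this gives a relation of order at least two,
   whose value generates the ideal of [x ^ e]. *)
Let generator : exists g0 gam, [/\ phi g0 = 0, poly_ord 2 g0,
  ev g0 = x ^+ e * gam & gam 0%MM != 0].
Proof.
set al := tau (lshift N i).
have al_e s : ord_ge s.+1 (al ^+ s - x ^+ s).
  elim: s => [|s IH]; first by rewrite subrr; apply: ord_ge_zero.
  rewrite !exprS (_ : _ - _ = (al - x) * al ^+ s + x * (al ^+ s - x ^+ s)); last first.
    by rewrite mulrBl mulrBr addrA subrK.
  apply: ord_geD.
    rewrite -[s.+2]add2n; apply: ord_geM => //.
    by rewrite -[s in ord_ge s]mul1n; apply/ord_geX/tau1.
  by rewrite -[s.+2]add1n; apply: ord_geM => //; apply: ord_ge_X.
have me : ideal_exp m e.+1 (phi ('X_(lshift N i) ^+ e)).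
  apply: (lift_ord lr (F := al ^+ e) (q := -1)); last by rewrite mulN1r.
  by rewrite rmorphXn; apply: (lift_exp lr).
have [q [P [q0 oP eP]]] := ideal_exp_frac lp me.
pose g0 := q * 'X_(lshift N i) ^+ e - P.
have g00 : phi g0 = 0 by rewrite rmorphB rmorphM eP subrr.
have [gam eg] : exists gam, ev g0 = gam * x ^+ e.
  by apply/(lr_zero lr); rewrite -g00; apply: (lift_eval lr).
exists g0, gam; split=> //; last 2 first.
- by rewrite mulrC.
- have xE (F : pseries k n) s : (x ^+ s * F) (U_(i) *+ s)%MM = F 0%MM.
    elim: s => [|s IH]; first by rewrite mul1r mulm0n.
    rewrite exprS -mulrA psX_mulE mulmnE mnm1E eqxx mul1n -IH; congr (_ _).
    by rewrite mulmS addmC addmK.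
  have oP' : ord_ge e.+1 (ev g0 - x ^+ e * ev q).
    have -> : ev g0 - x ^+ e * ev q = ev q * (al ^+ e - x ^+ e) - ev P.
      rewrite /g0 rmorphB rmorphM rmorphXn /= ps_evalX mulrBr [x ^+ e * _]mulrC.
      by rewrite addrAC.
    apply: ord_geB; first exact/ord_ge_mull/al_e.
    exact: ord_ge_eval.
  have := ord_ge_trunc_eq oP' (m := (U_(i) *+ e)%MM).
  by rewrite mdegMn mdeg1 mul1n ltnSn eg mulrC !xE => -> //; rewrite ev0.
- rewrite /g0 -mulN1r; apply: poly_ordD.
    apply: poly_ord_mull; apply: (@poly_ord_le _ _ 2 e) => //.
    exact: poly_ordXn.
  by apply: poly_ord_mull; apply: (@poly_ord_le _ _ 2 e.+1) => //; apply: ltnW.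
Qed.

(** The nilpotent element is obtained by applying [e - 1] times a derivation [V] of the
    polynomial ring to a relation [g0] with value a unit times [x ^ e].  The
    coefficients of [V] are minors of the Jacobian matrix of the relations
    [h l], so that [V] kills the [h l]; hence on the values at [tau] it is, up
    to units and multiples of [x ^ (e - 1)], the derivation with respect to
    [x], and lowers the exponent of [x] by one. *)
Lemma nilpotent_of_order_one :
  exists z gam, [/\ Lam z (x * gam), gam 0%MM != 0 & z ^+ e = 0].
Proof.
have [h hP] := relations; have [g0 [gam0 [g00 og0 eg0 gam00]]] := generator.
pose M : 'M[{mpoly k[n + N]}]_N := \matrix_(l, l') db l' (h l).
pose c l := \sum_l' (\adj M) l l' * da (h l').
pose V p := \det M * da p - \sum_l c l * db l p.
pose eps := psderiv i (tau (lshift N i)).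
have chain p : psderiv i (ev p) = ev (da p) * eps +
    \sum_l ev (db l p) * psderiv i (tau (rshift n l)).
  rewrite ps_eval_deriv big_split_ord /=; congr (_ + _).
  rewrite (bigD1 i) //= big1 ?addr0 // => j ji.
  by rewrite tau_a // psderiv_psX eq_sym (negPf ji) mulr0.
have eps0 : eps 0%MM != 0.
  rewrite /eps psderivE add0m mnm0E mulr1n.
  by rewrite (ord_ge_trunc_eq tau_ai) ?mdeg1 // /psX eqxx oner_neq0.
have [ieps epsK] := ps_unit eps0.
have [w hw] : exists w : 'I_N -> pseries k n, forall l,
    psderiv i (ev (h l)) = x ^+ e.-1 * w l.
  suff H l : exists w, psderiv i (ev (h l)) = x ^+ e.-1 * w by have [f fP] := choice H; exists f.
  have [q eq] : exists q, ev (h l) = q * x ^+ e.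
    by apply/(lr_zero lr); rewrite -(hP l).1; apply: (lift_eval lr).
  exists (psderiv i q * x + q *+ e.-1.+1); rewrite eq -{1}(ltn_predK e2).
  rewrite psderivM psderivX psderiv_psX eqxx mulr1 mulrDr exprS; congr (_ + _).
    by rewrite mulrA mulrC.
  by rewrite !mulrnAr mulrC.
pose w' l := \sum_l' ev ((\adj M) l l') * w l'.
have betaE l : ev (\det M) * psderiv i (tau (rshift n l)) =
    x ^+ e.-1 * w' l - eps * ev (c l).
  have : \sum_l' ev ((\adj M) l l') * psderiv i (ev (h l')) = x ^+ e.-1 * w' l.
    rewrite mulr_sumr; apply: eq_bigr => l' _; rewrite hw mulrCA //.
  move=> <-; apply/eqP; rewrite eq_sym subr_eq addrC; apply/eqP.
  under eq_bigr do rewrite chain mulrDr; rewrite big_split /=; congr (_ + _).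
    rewrite rmorph_sum mulr_sumr; apply: eq_bigr => l' _.
    by rewrite /= ps_evalM mulrA mulrC.
  under eq_bigr do rewrite mulr_sumr; rewrite exchange_big /=.
  have adjE l' : ev ((\adj M *m M) l l') =
     \sum_j ev ((\adj M) l j) * ev (db l' (h j)).
    rewrite mxE rmorph_sum; apply: eq_bigr => j _.
    by rewrite /= ps_evalM [M _ _]mxE.
  have -> : ev (\det M) * psderiv i (tau (rshift n l)) =
     \sum_l' ev ((\adj M *m M) l l') * psderiv i (tau (rshift n l')).
    rewrite mul_adj_mx (bigD1 l) //= !mxE eqxx mulr1n big1 ?addr0 // => l' ll'.
    by rewrite !mxE eq_sym (negPf ll') mulr0n rmorph0 mul0r.
  apply: eq_bigr => l' _; rewrite adjE mulr_suml; apply: eq_bigr => j _.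
  by rewrite mulrA.
have VE p : eps * ev (V p) = ev (\det M) * psderiv i (ev p) -
    x ^+ e.-1 * \sum_l ev (db l p) * w' l.
  have eV : ev (V p) = ev (\det M) * ev (da p) - \sum_l ev (c l) * ev (db l p).
    rewrite /V rmorphB rmorph_sum /= ps_evalM; congr (_ - _).
    by apply: eq_bigr => l _; rewrite /= ps_evalM.
  have eS : ev (\det M) * (\sum_l ev (db l p) * psderiv i (tau (rshift n l))) =
      x ^+ e.-1 * (\sum_l ev (db l p) * w' l) -
      eps * (\sum_l ev (c l) * ev (db l p)).
    rewrite !mulr_sumr -sumrB; apply: eq_bigr => l _.
    by rewrite mulrCA betaE; ring.
  rewrite chain mulrDr eS eV; ring.
have adj0 : (\det M)@_0%MM = 1.
  rewrite -det_map_mx (_ : map_mx _ M = 1%:M) ?det1 //.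
  by apply/matrixP => l l'; rewrite !mxE; apply: (hP l).2.
have step p gam s : (0 < s)%N -> (s <= e)%N -> ev p = x ^+ s * gam ->
    gam 0%MM != 0 -> (s = e -> poly_ord 2 p) ->
    exists gam', ev (V p) = x ^+ s.-1 * gam' /\ gam' 0%MM != 0.
  move=> s0 se ep gam0' op; pose W := \sum_l ev (db l p) * w' l.
  exists (ieps * (ev (\det M) * (gam *+ s.-1.+1 + x * psderiv i gam) -
                  x ^+ (e.-1 - s.-1) * W)); split.
    rewrite -[ev (V p)]mul1r -epsK [eps * ieps]mulrC -mulrA VE ep.
    rewrite -{1}(prednK s0) psderivM psderivX psderiv_psX eqxx mulr1.
    have -> : x ^+ e.-1 = x ^+ s.-1 * x ^+ (e.-1 - s.-1).
      by rewrite -exprD subnKC //; case: (s) (e) se => [|s'] [|e'].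
    rewrite -/W exprS mulrnAl -mulrnAr; ring.
  have ieps0 : ieps 0%MM != 0.
    have := congr1 (fun F : pseries k n => F 0%MM) epsK.
    rewrite ps_coef0M ps1E /psC eqxx => e1; apply/eqP => c0.
    by move: e1; rewrite c0 mulr0 => /esym/eqP; rewrite oner_eq0.
  rewrite ps_coef0M mulf_neq0 // psBE !ps_coef0M ps_coef0X ev0 adj0 mul1r.
  rewrite psDE ps_coef0M ps_mulrnE psC_mulE.
  have x0 : x 0%MM = 0 by rewrite /psX eq_sym mnm1_eq0.
  rewrite x0 mul0r addr0 [_ * W 0%MM](_ : _ = 0) ?subr0; last first.
    move: se; rewrite leq_eqVlt => /predU1P[es|se]; last first.
      have -> : (e.-1 - s.-1)%N = (e - s).-1.+1 by lia.
      by rewrite exprS !mul0r.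
    rewrite /W ps_sumE big1 ?mulr0 // => l _; rewrite ps_coef0M ev0 mderiv0.
    by rewrite (op es) ?mul0r // mdeg1.
  by rewrite mulf_neq0 // natf_neq0_char0.
have iterV s : (s < e)%N -> exists gam, ev (iter s V g0) = x ^+ (e - s) * gam /\
    gam 0%MM != 0.
  elim: s => [|s IH] se; first by exists gam0; rewrite subn0.
  have [gam [egam gam0']] := IH (ltnW se).
  have [||gam' [eV gam'0]] := step _ _ (e - s)%N _ (leq_subr _ _) egam gam0'.
  - by rewrite subn_gt0 ltnW.
  - by move=> es; have -> : s = 0%N by lia.
  by exists gam'; rewrite iterS eV subnS.
have [|gam [eV gam_0]] := iterV e.-1; first by rewrite prednK // ltnW.
have e1 : (e - e.-1)%N = 1%N by lia.
rewrite e1 expr1 in eV.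
have zP : Lam (phi (iter e.-1 V g0)) (x * gam) by rewrite -eV; apply: (lift_eval lr).
exists (phi (iter e.-1 V g0)), gam; split=> //.
apply: (lift_eq0 lp lr (q := gam ^+ e)); rewrite -exprMn [gam * x]mulrC.
exact: (lift_exp lr).
Qed.

End Nilpotent.

(** * Parameters of the reduced ring *)

Section LiftChain.
Variables (k : fieldType) (n N : nat) (R : comPzRingType) (m : ideal R).
Variables (phi : {rmorphism {mpoly k[N]} -> R}).
Variables (Lam : R -> pseries k n -> Prop) (g : pseries k n).
Hypothesis lr : lift_relation m (fun c => phi c%:MP) Lam g.

Section KillPrime.
Variables (K : pred 'I_n) (Kg : ps_kill K g = 0).

Lemma lift_kill r F F' : Lam r F -> Lam r F' -> ps_kill K F = ps_kill K F'.
Proof.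
move=> rF rF'; have [q e] := lift_unique lr rF rF'.
by apply/eqP; rewrite -subr_eq0 -rmorphB /= e rmorphM /= Kg mulr0.
Qed.

(** The preimage of the prime ideal generated by the variables in [K]. *)
Definition lift_prime : prime_ideal R.
Proof.
unshelve econstructor.
- exists [set r : R | exists2 F, Lam r F & ps_kill K F = 0].
  + by exists 0; [apply: lift_zero0 lr|rewrite rmorph0].
  + move=> x y [F xF KF] [G yG KG]; exists (F + G); first exact: (lr_add lr).
    by rewrite rmorphD /= KF KG addr0.
  + move=> a x [F xF KF]; have [G aG] := lr_total lr a.
    exists (G * F); first exact: (lr_mul lr).
    by rewrite rmorphM /= KF mulr0.
- move=> /= [F F1 KF]; have := lr_const lr 1; rewrite mpolyC1 !rmorph1 => L1.
  have := lift_kill F1 L1; rewrite KF rmorph1 => /esym/eqP.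
  by rewrite oner_eq0.
- move=> x y /= [H xyH KH]; have [F xF] := lr_total lr x.
  have [G yG] := lr_total lr y.
  have := lift_kill xyH (lr_mul lr xF yG); rewrite KH rmorphM => /esym/ps_domain.
  by case=> K0; [left; exists F|right; exists G].
Defined.

End KillPrime.

(** The variables in the range of [iota] are killed one after the other; the
    elements [u j], which lift these variables exactly, show that the chain
    remains strict in [R]. *)
Lemma lift_prime_chain d (iota : 'I_d -> 'I_n) (u : 'I_d -> R) :
  injective iota -> ps_kill (fun j => j \notin codom iota) g = 0 ->
  (forall j, Lam (u j) (psX k (iota j))) ->
  exists p : nat -> prime_ideal R, prime_chain d p.
Proof.
move=> iota_inj Kg uP.
pose K s : pred 'I_n := fun j => [forall l : 'I_d, (s <= l)%N ==> (iota l != j)].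
have Kg' s : ps_kill (K s) g = 0.
  apply: funext => l; have := congr1 (fun F : pseries k n => F l) Kg.
  rewrite /ps_kill; case: ifP => [_ ->|/negbT]; first by rewrite if_same.
  move=> /forall_inPn[j jc lj] _; rewrite ifN //; apply/forall_inPn; exists j => //.
  apply/forall_inP => l' _; apply: contraNneq jc => <-; exact: codom_f.
exists (fun s => lift_prime (Kg' s)) => s sd; split=> [r [F rF KF]|].
  exists F => //; apply: funext => l.
  have := congr1 (fun F : pseries k n => F l) KF.
  rewrite /ps_kill; case: ifP => [_ ->|/negbT]; first by rewrite if_same.
  move=> /forall_inPn[j Kj lj] _; rewrite ifN //; apply/forall_inPn; exists j => //.
  apply/forall_inP => l' sl'; move/forall_inP: Kj; apply; exact: ltnW.
move=> /(_ (u (Ordinal sd)))[].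
  exists (psX k (iota (Ordinal sd))) => //; rewrite ps_kill_psX ifT //.
  apply/forall_inP => l' sl'; rewrite (inj_eq iota_inj) -val_eqE /=.
  by rewrite gtn_eqF.
move=> F uF KF; have := lift_kill (Kg' s) uF (uP _); rewrite KF ps_kill_psX ifN.
  by move/esym/psX_neq0.
by apply/forall_inPn; exists (Ordinal sd); [exact: (leqnn s)|rewrite eqxx].
Qed.

End LiftChain.

Definition nilpotent (R : comPzRingType) (z : R) : Prop := exists s, z ^+ s = 0.

(** The reduction of [R] has dimension at least [d] and embedding dimension at most
    [d]. *)
Definition regular_data (R : comPzRingType) (m : ideal R) (d : nat) : Prop :=
  exists (u : 'I_d -> R) (p : nat -> prime_ideal R),
  [/\ prime_chain d p, forall j, m (u j) &
    forall r, m r -> exists (c : 'I_d -> R) z,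
      nilpotent z /\ ideal_exp m 2 (r - \sum_j c j * u j - z)].

Section RegularData.
Variables (k : fieldType) (n N : nat) (R : comPzRingType) (m : ideal R).
Variables (phi : {rmorphism {mpoly k[N]} -> R}).
Variables (Lam : R -> pseries k n -> Prop) (g : pseries k n).
Hypothesis lr : lift_relation m (fun c => phi c%:MP) Lam g.

Lemma regular_data_smooth : g = 0 ->
  (forall j, exists A F, Lam (phi A) (psX k j + F) /\ ord_ge 2 F) ->
  regular_data m n.
Proof.
move=> g0 H; have [A HA] := choice H; have [F AF] := choice HA.
pose v j := psX k j + F j.
have vX j : ord_ge 2 (v j - psX k j) by rewrite /v addrC addKr; apply: (AF j).2.
have v0 := tangent_ord vX.
have lr' := lift_subst lr v0 (@tangent_subst_inj _ _ _ vX) (@tangent_subst_surj _ _ _ vX)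
  (g' := 0) (etrans (ps_subst_zero v0) (esym g0)).
have uP j : Lam (phi (A j)) (ps_subst v (psX k j)).
  by rewrite ps_substX //; apply: (AF j).1.
have [|p pP] := lift_prime_chain lr' (iota := id) (fun _ _ => id) _ uP.
  by rewrite rmorph0.
exists (fun j => phi (A j)), p; split=> // [j|r mr].
  exact/ideal_exp1E/(lr_ord lr' (uP j))/ord_ge_X.
have [G rG] := lr_total lr' r.
exists (fun j => phi (G U_(j)%MM)%:MP), 0; split; first by exists 1%N; rewrite expr1.
rewrite subr0; apply: (lr_ord lr' (F := G - ps_lin G)).
  apply: (lift_sub lr') => //; apply: (lift_sum lr') => j.
  by apply: (lr_mul lr') => //; apply: (lr_const lr').
exact/ord_ge_sub_lin/(lr_max lr' mr).
Qed.

End RegularData.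

Section Adjoin.
Variables (k : fieldType) (n N : nat) (B : 'I_n -> {mpoly k[N]}) (c : 'I_N -> 'I_n -> k).

(** Polynomials in additional variables [a_j], standing for [B j], and in the old
    variables corrected by linear combinations of the [a_j]. *)
Definition adjoin (p : {mpoly k[n + N]}) : {mpoly k[N]} :=
  mmap (@mpolyC N k) (fun v => match split v with
    | inl j => B j | inr l => 'X_l - \sum_j (c l j)%:MP * B j end) p.
HB.instance Definition _ := GRing.RMorphism.copy adjoin
  (mmap (@mpolyC N k) (fun v => match split v with
    | inl j => B j | inr l => 'X_l - \sum_j (c l j)%:MP * B j end)).

Definition adjoin_section (p : {mpoly k[N]}) : {mpoly k[n + N]} :=
  mmap (@mpolyC (n + N) k) (fun l =>
    'X_(rshift n l) + \sum_j (c l j)%:MP * 'X_(lshift N j)) p.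
HB.instance Definition _ := GRing.RMorphism.copy adjoin_section
  (mmap (@mpolyC (n + N) k) (fun l =>
    'X_(rshift n l) + \sum_j (c l j)%:MP * 'X_(lshift N j))).

Lemma adjoinC a : adjoin a%:MP = a%:MP. Proof. exact: mmapC. Qed.
Lemma adjoinX v : adjoin 'X_v = match split v with
    | inl j => B j | inr l => 'X_l - \sum_j (c l j)%:MP * B j end.
Proof. by rewrite /adjoin mmapX mmap1U. Qed.

Lemma adjoin_sectionK p : adjoin (adjoin_section p) = p.
Proof.
apply: (mpoly_hom_eq (f := adjoin \o adjoin_section) (g := idfun)) => [a|l].
  by rewrite /= /adjoin_section mmapC adjoinC.
rewrite /= /adjoin_section mmapX mmap1U rmorphD rmorph_sum /= adjoinX.
rewrite (unsplitK (inr l)) [X in _ + X](_ : _ = \sum_j (c l j)%:MP * B j) ?subrK //.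
apply: eq_bigr => j _; by rewrite rmorphM /= adjoinC adjoinX (unsplitK (inl j)).
Qed.

Lemma adjoin_section0 p : (adjoin_section p)@_0%MM = p@_0%MM.
Proof.
apply: (mpoly_hom_eq (f := mcoeff 0%MM \o adjoin_section) (g := mcoeff 0%MM)) => [a|l].
  by rewrite /= /adjoin_section mmapC !mcoeffC !eqxx.
rewrite /= /adjoin_section mmapX mmap1U mcoeffD raddf_sum /= !mcoeffX !mnm1_eq0.
rewrite add0r big1 // => j _.
by rewrite mcoeffCM mcoeffX mnm1_eq0 mulr0.
Qed.

End Adjoin.

Section RegularDataMultiple.
Variables (k : fieldType) (hk : [pchar k] =i pred0) (n N : nat).
Variables (R : comPzRingType) (m : ideal R).
Variables (phi : {rmorphism {mpoly k[N]} -> R}) (lp : local_presentation m phi).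
Variables (Lam : R -> pseries k n -> Prop) (i : 'I_n) (e : nat).
Hypothesis lr : lift_relation m (fun c => phi c%:MP) Lam (psX k i ^+ e.+1).
Variables (B : 'I_n -> {mpoly k[N]}) (F : pseries k n).
Hypotheses (BP : forall j, j != i -> Lam (phi (B j)) (psX k j))
  (BiP : Lam (phi (B i)) F) (Fi : ord_ge 2 (F - psX k i)).

(* When [e > 0], the nilpotent element found above can be used as the parameter
   corresponding to [x_i]. *)
Lemma lift_nilpotent : (0 < e)%N -> exists z gam,
  [/\ Lam z (psX k i * gam), gam 0%MM != 0 & nilpotent z].
Proof.
move=> e0; have [tau tauP] := choice (fun l => lr_total lr (phi 'X_l)).
pose c l j := tau l U_(j)%MM.
pose al j := if j == i then F else psX k j.
have alP j : Lam (phi (B j)) (al j).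
  by rewrite /al; case: (eqVneq j i) => [->|/BP].
have alX j : ord_ge 2 (psX k j - al j).
  rewrite /al; case: (eqVneq j i) => [->|_].
    by rewrite -opprB; apply: ord_geN.
  by rewrite subrr; apply: ord_ge_zero.
pose phi' : {rmorphism {mpoly k[n + N]} -> R} := phi \o adjoin B c.
pose tau' v := match split v with
  | inl j => al j | inr l => tau l - \sum_j psC (c l j) * al j end.
have tau'P v : Lam (phi' 'X_v) (tau' v).
  rewrite /phi' /= adjoinX /tau'; case: (split v) => [j|l] //.
  rewrite (rmorphB phi) (rmorph_sum phi); apply: (lift_sub lr) => //.
  apply: (lift_sum lr) => j; rewrite (rmorphM phi); apply: (lr_mul lr) => //.
  exact: (lr_const lr).
have tau_b l : ord_ge 2 (tau' (rshift n l)).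
  rewrite /tau' (unsplitK (inr l)).
  have -> : tau l - \sum_j psC (c l j) * al j = (tau l - ps_lin (tau l)) +
     \sum_j psC (c l j) * (psX k j - al j).
    have -> : \sum_j psC (c l j) * (psX k j - al j) =
        ps_lin (tau l) - \sum_j psC (c l j) * al j.
      by rewrite /ps_lin -sumrB; apply: eq_bigr => j _; rewrite mulrBr.
    by rewrite addrA subrK.
  apply: ord_geD; first exact/ord_ge_sub_lin/(lr_max lr (lp_var lp l)).
  by apply: ord_ge_sum => j _; apply: ord_ge_mull.
have lr' : lift_relation m (fun c => phi' c%:MP) Lam (psX k i ^+ e.+1).
  case: lr => *; split=> // a; rewrite /phi' /= adjoinC; exact: (lr_const lr).
have lp' : local_presentation m phi'.
  split; [exact: lp_one lp|exact: lp_unit lp| |].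
    move=> v; apply: ideal_exp1E; apply: (lr_ord lr (tau'P v)).
    rewrite /tau'; case: splitP => [j _|l vl].
      rewrite -[al j](subKr (psX k j)); apply: ord_geB; first exact: ord_ge_X.
      exact: ord_ge_le (alX j).
    by have := tau_b l; rewrite /tau' (unsplitK (inr l)); apply: ord_ge_le.
  move=> r; have [p [q [q0 epq]]] := lp_frac lp r.
  exists (adjoin_section c p), (adjoin_section c q).
  by rewrite adjoin_section0 /phi' /= !adjoin_sectionK.
have [||||z [gam [zP gam0 z0]]] :=
  nilpotent_of_order_one hk lp' (i := i) (e := e.+1) _ lr' tau'P.
- by [].
- by move=> j ji; rewrite /tau' (unsplitK (inl j)) /al (negPf ji).
- by rewrite /tau' (unsplitK (inl i)) /al eqxx.
- exact: tau_b.
by exists z, gam; split=> //; exists e.+1.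
Qed.

Lemma regular_data_multiple : regular_data m n.-1.
Proof.
have uP j : Lam (phi (B (lift i j))) (psX k (lift i j)).
  by apply: BP; rewrite eq_sym neq_lift.
have [|p pP] := lift_prime_chain lr (@lift_inj _ i) _ uP.
  rewrite rmorphXn /= ps_kill_psX ifT ?exprS ?mul0r //.
  by apply/negP => /codomP[j /eqP]; rewrite (negPf (neq_lift _ _)).
exists (fun j => phi (B (lift i j))), p; split=> // [j|r mr].
  exact/ideal_exp1E/(lr_ord lr (uP j))/ord_ge_X.
have [G rG] := lr_total lr r.
have eG : ps_lin G = psC (G U_(i)%MM) * psX k i +
    \sum_j psC (G U_(lift i j)%MM) * psX k (lift i j).
  by rewrite /ps_lin (bigD1_ord i).
have oG : ord_ge 2 (G - \sum_j psC (G U_(lift i j)%MM) * psX k (lift i j) -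
   psC (G U_(i)%MM) * psX k i).
  by rewrite -addrA -opprD [X in _ - X]addrC -eG; apply/ord_ge_sub_lin/(lr_max lr mr).
have rG' : Lam (r - \sum_j phi (G U_(lift i j)%MM)%:MP * phi (B (lift i j)))
    (G - \sum_j psC (G U_(lift i j)%MM) * psX k (lift i j)).
  apply: (lift_sub lr) => //; apply: (lift_sum lr) => j.
  by apply: (lr_mul lr) => //; apply: (lr_const lr).
exists (fun j => phi (G U_(lift i j)%MM)%:MP).
have [e0|] := posnP e.
  exists 0; split; first by exists 1%N; rewrite expr1.
  rewrite subr0; apply: (lift_ord lr (q := - psC (G U_(i)%MM)) rG').
  by rewrite e0 expr1 mulNr.
move=> /lift_nilpotent[z [gam [zP gam0 nz]]].
pose a := G U_(i)%MM / gam 0%MM; exists (phi a%:MP * z); split.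
  by case: nz => s zs; exists s; rewrite exprMn zs mulr0.
apply: (lr_ord lr (lift_sub lr rG' (lr_mul lr (lr_const lr a) zP))).
set G' := G - _ in oG *.
have -> : G' - psC a * (psX k i * gam) = (G' - psC (G U_(i)%MM) * psX k i) +
    psX k i * (psC (G U_(i)%MM) - psC a * gam) by ring.
apply: ord_geD => //; rewrite -[2%N]/(1 + 1)%N; apply: ord_geM; first exact: ord_ge_X.
apply/ord_ge1; rewrite psBE psC_mulE /a divfK // /psC eqxx subrr //.
Qed.

End RegularDataMultiple.

Section RegularDataPower.
Variables (k : fieldType) (hk : [pchar k] =i pred0) (n N : nat).
Variables (R : comPzRingType) (m : ideal R).
Variables (phi : {rmorphism {mpoly k[N]} -> R}) (lp : local_presentation m phi).
Variables (Lam : R -> pseries k n -> Prop) (i : 'I_n) (y : pseries k n) (e : nat).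
Hypothesis lr : lift_relation m (fun c => phi c%:MP) Lam (y ^+ e.+1).

(** Parameters lifting the variables other than [x_i], together with [y], are
    new coordinates, in which the ideal is generated by a power of a variable. *)
Lemma regular_data_power : y 0%MM = 0 -> y U_(i)%MM != 0 ->
  (forall j, exists A F, Lam (phi A) (psX k j + F) /\ ord_ge 2 F) ->
  regular_data m n.-1.
Proof.
move=> y0 yU H; have [A HA] := choice H; have [F AF] := choice HA.
pose v j := if j == i then y else psX k j + F j.
have vi : v i = y by rewrite /v eqxx.
have vi0 : v i 0%MM = 0 by rewrite vi.
have viU : v i U_(i)%MM != 0 by rewrite vi.
have vX j : j != i -> ord_ge 2 (v j - psX k j).
  by move=> /negPf ji; rewrite /v ji addrC addKr; apply: (AF j).2.
have v0 j : ord_ge 1 (v j).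
  case: (eqVneq j i) => [->|ji]; first exact/ord_ge1.
  rewrite -[v j](subrK (psX k j)); apply: ord_geD; last exact: ord_ge_X.
  exact: ord_ge_le (vX _ ji).
have eg : ps_subst v (psX k i ^+ e.+1) = y ^+ e.+1.
  elim: (e.+1) => [|s IH]; first by rewrite !expr0 -(rmorph1 (@psC k n)) ps_substC.
  by rewrite !exprS ps_substM // IH ps_substX // vi.
have lr' := lift_subst lr v0 (replace_variable_inj vi0 viU vX)
  (replace_variable_surj vi0 viU vX) eg.
have [G eG] := replace_variable_surj vi0 viU vX
  (\sum_j psC (y U_(j)%MM) * (psX k j + F j)).
apply: (@regular_data_multiple _ hk _ _ _ _ _ lp _ i e lr'
  (fun j => if j == i then \sum_l (y U_(l)%MM)%:MP * A l else A j) G).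
- by move=> j ji; rewrite (negPf ji) ps_substX // /v (negPf ji); apply: (AF j).1.
- rewrite eqxx eG rmorph_sum; apply: (lift_sum lr) => j; rewrite rmorphM.
  by apply: (lr_mul lr); [apply: (lr_const lr)|apply: (AF j).1].
- apply: (replace_variable_ord vi0 viU vX); rewrite ps_substB // ps_substX // vi eG.
  have -> : \sum_j psC (y U_(j)%MM) * (psX k j + F j) - y =
      \sum_j psC (y U_(j)%MM) * F j - (y - ps_lin y).
    rewrite opprB /ps_lin addrA -big_split /=; congr (_ - _).
    by apply: eq_bigr => j _; rewrite mulrDr addrC.
  apply: ord_geB; last exact/ord_ge_sub_lin/ord_ge1.
  by apply: ord_ge_sum => j _; apply: ord_ge_mull; apply: (AF j).2.
Qed.

End RegularDataPower.

(** * Lifts defined by a presentation of the completion *)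

Section Completion.
Variables (k : fieldType) (n N : nat) (R : comPzRingType) (m : ideal R).
Variables (phi : {rmorphism {mpoly k[N]} -> R}) (lp : local_presentation m phi).
Local Notation S := (pseries k n).
Local Notation Rhat := (completion m).
Variables (I : ideal S) (psi : {rmorphism Rhat -> quot I}).
Hypothesis psi_bij : bijective psi.
Hypothesis psiC : forall c, psi (to_completion m (phi c%:MP)) = quot_pi I (psC c).

Local Notation toR := (to_completion m).
Implicit Types (xi eta : Rhat) (F G : S).

Definition comp_at xi s : quot (ideal_exp m s) := subring_val xi s.

Lemma comp_ext xi eta : (forall s, comp_at xi s = comp_at eta s) -> xi = eta.
Proof.
by move=> H; apply: subring_val_inj; apply: functional_extensionality_dep => s; apply: H.
Qed.

Lemma comp_atB xi eta s : comp_at (xi - eta) s = comp_at xi s - comp_at eta s.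
Proof. by []. Qed.
Lemma comp_atD xi eta s : comp_at (xi + eta) s = comp_at xi s + comp_at eta s.
Proof. by []. Qed.
Lemma comp_atM xi eta s : comp_at (xi * eta) s = comp_at xi s * comp_at eta s.
Proof. by []. Qed.
Lemma comp_at1 s : comp_at 1 s = 1. Proof. by []. Qed.
Lemma comp_at_to r s : comp_at (toR r) s = quot_pi _ r. Proof. by []. Qed.

Lemma comp_at_sum (T : Type) (l : seq T) (P : pred T) (f : T -> Rhat) s :
  comp_at (\sum_(i <- l | P i) f i) s = \sum_(i <- l | P i) comp_at (f i) s.
Proof. exact: (big_morph (comp_at^~ s)). Qed.

Lemma to_completionD r r' : toR (r + r') = toR r + toR r'.
Proof. by apply: comp_ext => s; rewrite comp_atD !comp_at_to (rmorphD (quot_pi _)). Qed.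
Lemma to_completionM r r' : toR (r * r') = toR r * toR r'.
Proof. by apply: comp_ext => s; rewrite comp_atM !comp_at_to (rmorphM (quot_pi _)). Qed.
Lemma to_completion0 : toR 0 = 0.
Proof. by apply: comp_ext => s; rewrite comp_at_to rmorph0. Qed.

Lemma quot_pi_surj (T : comPzRingType) (J : ideal T) (x : quot J) :
  exists a, x = quot_pi J a.
Proof. by exists (sr_repr (S := quot_setoid J) x); rewrite /quot_pi sr_reprK. Qed.

Lemma quot_pi0P (T : comPzRingType) (J : ideal T) a : quot_pi J a = 0 <-> J a.
Proof. by rewrite -(rmorph0 (quot_pi J)); split=> [/quot_piP|Ja]; [|apply/quot_piP]; rewrite subr0. Qed.

Lemma comp_at_le xi s t a : (s <= t)%N -> comp_at xi t = quot_pi _ a ->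
  comp_at xi s = quot_pi _ a.
Proof.
move=> st; rewrite -(subnK st); elim: (t - s)%N => [|d IH] //= xia.
apply: IH; have [b xib xib'] := subring_valP xi (d + s)%N.
rewrite /comp_at xib'; apply/quot_piP.
move: xia; rewrite /comp_at addSn xib => /quot_piP.
exact/ideal_exp_le/leqnSn.
Qed.

Let psi_inj : injective psi. Proof. exact: bij_inj. Qed.

Let psi_surj F : exists xi, psi xi = quot_pi I F.
Proof. by have [inv _ psiK] := psi_bij; exists (inv (quot_pi I F)). Qed.

Let zero_neq1 : (0 : quot (ideal_exp m 1)) <> 1.
Proof.
rewrite -(rmorph1 (quot_pi _)) => /esym/quot_pi0P/ideal_exp1E.
exact: lp_one lp.
Qed.

Lemma presentation_proper : ~ I 1.
Proof.
move=> I1; suff e : 0 = 1 :> Rhat by exact: zero_neq1 (congr1 (comp_at^~ 1%N) e).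
apply: psi_inj; rewrite rmorph0 rmorph1 -(rmorph1 (quot_pi I)); apply/esym.
exact/quot_pi0P.
Qed.

(** Both rings are local and [psi] preserves units; hence [psi] matches the
    series without constant term with the elements of the completion that
    vanish modulo [m]. *)
Lemma comp_at1_const xi F : psi xi = quot_pi I F ->
  comp_at xi 1 = 0 <-> F 0%MM = 0.
Proof.
move=> xiF; have unit_at eta G : psi eta = quot_pi I G -> G 0%MM != 0 ->
    comp_at eta 1 <> 0.
  move=> etaG /ps_unit[G' GG'] eta0; have [eta' e'] := psi_surj G'.
  suff e : eta * eta' = 1.
    by apply: zero_neq1; rewrite -(comp_at1 1) -e comp_atM eta0 mul0r.
  apply: psi_inj.
  by rewrite (rmorphM psi) etaG e' -(rmorphM (quot_pi I)) GG' !rmorph1.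
split=> [xi0|F0].
  by apply/eqP; apply: contrapT => /negP F0; apply: unit_at xiF F0 xi0.
have [a xia] := quot_pi_surj (comp_at xi 1); have [c mc] := lp_residue lp a.
have ca : comp_at (xi - toR (phi c%:MP)) 1 = 0.
  rewrite comp_atB comp_at_to xia -(rmorphB (quot_pi _)).
  exact/quot_pi0P/ideal_exp1.
have [c0|c0] := eqVneq c 0; last first.
  exfalso; apply: (unit_at (xi - toR (phi c%:MP)) (F - psC c) _ _ ca).
    by rewrite (rmorphB psi) xiF psiC -(rmorphB (quot_pi I)).
  by rewrite psBE F0 sub0r /psC eqxx oppr_eq0.
by move: ca; rewrite c0 mpolyC0 rmorph0 to_completion0 subr0.
Qed.

Lemma comp_at_ord s xi F : psi xi = quot_pi I F -> ord_ge s F -> comp_at xi s = 0.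
Proof.
elim: s xi F => [|s IH] xi F xiF sF.
  by have [a ->] := quot_pi_surj (comp_at xi 0); apply/quot_pi0P.
have [G [eF oG]] := ord_ge_split sF.
have [al alP] := choice (fun j => psi_surj (psX k j)).
have [be beP] := choice (fun j => psi_surj (G j)).
have -> : xi = \sum_j al j * be j.
  apply: psi_inj; rewrite xiF eF (rmorph_sum (quot_pi I)) (rmorph_sum psi).
  by apply: eq_bigr => j _; rewrite (rmorphM (quot_pi I)) (rmorphM psi) alP beP.
rewrite comp_at_sum big1 // => j _; rewrite comp_atM.
have [a aP] := quot_pi_surj (comp_at (al j) s.+1).
have [b bP] := quot_pi_surj (comp_at (be j) s.+1).
rewrite aP bP -(rmorphM (quot_pi _)); apply/quot_pi0P; apply: ideal_expS.
  apply/ideal_exp1E/quot_pi0P; rewrite -(comp_at_le _ aP) //.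
  by apply/(comp_at1_const (alP j)); rewrite /psX eq_sym mnm1_eq0.
by apply/quot_pi0P; rewrite -(comp_at_le (leqnSn s) bP); apply: IH (beP j) (oG j).
Qed.

Definition completion_lift (r : R) F : Prop := psi (toR r) = quot_pi I F.

Lemma completion_lift_relation g : (forall F, I F <-> exists q, F = q * g) ->
  lift_relation m (fun c => phi c%:MP) completion_lift g.
Proof.
move=> Ig; split=> [r|r r' F F' rF rF'|r r' F F' rF rF'|c|F|s r F rF sF|r F mr rF].
- exact: quot_pi_surj.
- by rewrite /completion_lift to_completionD (rmorphD psi) rF rF' (rmorphD (quot_pi I)).
- by rewrite /completion_lift to_completionM (rmorphM psi) rF rF' (rmorphM (quot_pi I)).
- exact: psiC.
- rewrite -Ig /completion_lift to_completion0 rmorph0; split=> [/esym/quot_pi0P //|IF].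
  exact/esym/quot_pi0P.
- by apply/quot_pi0P; rewrite -comp_at_to; apply: comp_at_ord rF sF.
- apply/ord_ge1/(comp_at1_const rF); rewrite comp_at_to.
  exact/quot_pi0P/ideal_exp1.
Qed.

Lemma ideal_exp_coords s r : ideal_exp m s.+1 r ->
  exists b : 'I_N -> R, r = \sum_j phi 'X_j * b j /\ forall j, ideal_exp m s (b j).
Proof.
have @J : ideal R.
  exists [set r : R | exists b : 'I_N -> R,
    r = \sum_j phi 'X_j * b j /\ forall j, ideal_exp m s (b j)].
  - exists (fun=> 0); split; first by rewrite big1 // => j _; rewrite mulr0.
    by move=> j; apply: ideal0.
  - move=> x y [b [-> mb]] [b' [-> mb']]; exists (fun j => b j + b' j).
    split; last by move=> j; apply: idealD.
    by rewrite -big_split; apply: eq_bigr => j _; rewrite mulrDr.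
  - move=> a x [b [-> mb]]; exists (fun j => a * b j).
    split; last by move=> j; apply: idealM.
    by rewrite mulr_sumr; apply: eq_bigr => j _; rewrite mulrCA.
apply: (ideal_exp_ind (J := J)) => x y /(lp_mem_frac lp)[p [q [q0 e p0]]] my.
have [qi qqi] := lp_unitP lp q0.
have [c ep] := mpoly_const_split p; rewrite p0 mpolyC0 add0r in ep.
exists (fun j => qi * phi (c j) * y); split; last by move=> j; apply: idealM.
have -> : x * y = qi * (phi q * x) * y by rewrite mulrA [qi * _]mulrC qqi mul1r.
rewrite e ep rmorph_sum mulr_sumr mulr_suml; apply: eq_bigr => j _.
by rewrite rmorphM; ring.
Qed.

(** The coefficients are obtained by summing decompositions of the successive
    differences of a sequence of elements of [R] that converges to [xi]. *)
Lemma comp_at2_decomp xi : comp_at xi 2 = 0 -> exists eta : 'I_N -> Rhat,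
  xi = \sum_j toR (phi 'X_j) * eta j /\ forall j, comp_at (eta j) 1 = 0.
Proof.
move=> xi2; have [a aP] := choice (fun s => quot_pi_surj (comp_at xi s)).
have da s : ideal_exp m s.+2 (a s.+3 - a s.+2).
  by apply/quot_piP; rewrite -aP -(comp_at_le (leqnSn _) (aP s.+3)).
have [b0 [eb0 mb0]] : exists b : 'I_N -> R,
    a 2%N = \sum_j phi 'X_j * b j /\ forall j, ideal_exp m 1 (b j).
  by apply: ideal_exp_coords; apply/quot_pi0P; rewrite -aP.
have [b bP] := choice (fun s => ideal_exp_coords (da s)).
pose c j s := b0 j + \sum_(l < s) b l j.
have cP j : coherent (fun s => quot_pi (ideal_exp m s) (c j s)).
  move=> s; exists (c j s.+1) => //; apply/quot_piP.
  rewrite /c big_ord_recr /= addrA opprD addrA subrr sub0r; apply: idealN.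
  by apply: ideal_exp_le (leqnSn s) _ _; apply: (bP s).2.
exists (fun j => @SubringElt _ (coherent_subring m) _ (cP j)); split; last first.
  move=> j; apply/quot_pi0P; rewrite /c big_ord1; apply: idealD; first exact: mb0.
  exact: (bP 0%N).2.
apply: comp_ext => s; rewrite comp_at_sum (comp_at_le _ (aP s.+2)); last first.
  by rewrite ltnW // ltnW.
have -> : a s.+2 = \sum_j phi 'X_j * c j s.
  elim: s => [|s IH].
    by rewrite eb0; apply: eq_bigr => j _; rewrite /c big_ord0 addr0.
  rewrite -[LHS](subrK (a s.+2)) (bP s).1 IH -big_split /=; apply: eq_bigr => j _.
  rewrite -mulrDr; congr (_ * _).
  by rewrite /c big_ord_recr /= [LHS]addrC [RHS]addrA.
rewrite (rmorph_sum (quot_pi _)); apply: eq_bigr => j _.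
by rewrite comp_atM comp_at_to (rmorphM (quot_pi _)).
Qed.

(** The element of the completion that corresponds to [x_j] is approximated by an
    element of [R] modulo [m ^ 2]; the error corresponds to a series of order
    two, by the decomposition above.  Dividing by the constant term of its
    denominator turns this element into the value of a polynomial. *)
Lemma completion_lift_coord g (j : 'I_n) : (forall F, I F <-> exists q, F = q * g) ->
  exists A F, completion_lift (phi A) (psX k j + F) /\ ord_ge 2 F.
Proof.
move=> Ig; have lr := completion_lift_relation Ig.
have [xi xiX] := psi_surj (psX k j).
have [a aP] := quot_pi_surj (comp_at xi 2).
have [eta [exi eta1]] : exists eta : 'I_N -> Rhat, xi - toR a =
    \sum_l toR (phi 'X_l) * eta l /\ forall l, comp_at (eta l) 1 = 0.
  by apply: comp_at2_decomp; rewrite comp_atB comp_at_to aP subrr.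
have [tau tauP] := choice (fun l => lr_total lr (phi 'X_l)).
have [G GP] := choice (fun l => quot_pi_surj (psi (eta l))).
pose H := \sum_l tau l * G l.
have H2 : ord_ge 2 H.
  apply: ord_ge_sum => l _; rewrite -[2%N]/(1 + 1)%N; apply: ord_geM.
    exact: (lr_max lr (lp_var lp l) (tauP l)).
  by apply/ord_ge1; apply/(comp_at1_const (GP l)).
have aH : completion_lift a (psX k j - H).
  rewrite /completion_lift -[toR a](subKr xi) (rmorphB psi) xiX exi.
  rewrite (rmorphB (quot_pi I)) (rmorph_sum psi) (rmorph_sum (quot_pi I)).
  congr (_ - _); apply: eq_bigr => l _.
  by rewrite (rmorphM psi) GP (tauP l) (rmorphM (quot_pi I)).
have [p [q [q0 epq]]] := lp_frac lp a.
have [Q qQ] := lr_total lr (phi q).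
have Q0 : Q 0%MM = q@_0%MM.
  have := lr_max lr (lp_const lp q) (lift_sub lr qQ (lr_const lr _)).
  by move/ord_ge1/eqP; rewrite psBE subr_eq0 /psC eqxx => /eqP.
exists ((q@_0%MM)^-1%:MP * p), ((psC (q@_0%MM)^-1 * Q - 1) * (psX k j - H) - H).
split.
  have -> : psX k j + ((psC (q@_0%MM)^-1 * Q - 1) * (psX k j - H) - H) =
     psC (q@_0%MM)^-1 * (Q * (psX k j - H)) by ring.
  rewrite (rmorphM phi) -epq; apply: (lr_mul lr); first exact: (lr_const lr).
  exact: (lr_mul lr).
apply: ord_geB => //; rewrite -[2%N]/(1 + 1)%N; apply: ord_geM.
  apply/ord_ge1; rewrite psBE psC_mulE Q0 mulVf // ps1E /psC eqxx subrr //.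
by apply: ord_geB; [apply: ord_ge_X|apply: ord_ge_le H2].
Qed.

End Completion.

(** * Stalks of schemes *)

Section StalkOfOpenImmersion.
Variables (A : comPzRingType) (X : ringed_space).
Variables (j : morphism (spec_ringed_space A) X) (jP : open_immersion j).
Variable p : spec A.
Local Notation Y := (spec_ringed_space A).
Local Notation pre U := (opens_preimage (mor_cont j) U).

Lemma frac_eqP a s b t (ps : ~ p s) (pt : ~ p t) :
  Defs.frac a ps = Defs.frac b pt <-> exists2 u, ~ p u & u * (a * t) = u * (b * s).
Proof. exact: (@sr_piP (localization_setoid p)). Qed.

Lemma frac_surj (x : localization p) : exists a s (ps : ~ p s), x = Defs.frac a ps.
Proof.
exists (fnum (sr_repr (S := localization_setoid p) x)).
exists (fden (sr_repr (S := localization_setoid p) x)).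
exists (@fdenP _ _ (sr_repr (S := localization_setoid p) x)).
rewrite -[x in LHS](@sr_reprK (localization_setoid p)) /Defs.frac.
by case: (sr_repr _).
Qed.

Lemma fracM a s b t (ps : ~ p s) (pt : ~ p t) :
  Defs.frac a ps * Defs.frac b pt = Defs.frac (a * b) (prime_compl_mul ps pt).
Proof. by rewrite /Defs.frac -(@sr_piM (localization_setoid p)). Qed.

Definition basic_open (u : A) : opens Y.
Proof.
exists [set q : spec A | ~ q u].
have : zariski_open [set q : spec A | ~ q u].
  by apply/zariski_openP => q qu; exists u.
by [].
Defined.

Definition image_open (V : opens Y) : opens X.
Proof.
exists (j @` V); case: jP => _ jo _; apply: jo; exact: opensP.
Defined.

Lemma image_open_mem (V : opens Y) q : image_open V (j q) -> V q.
Proof. by case: jP => inj _ _ [q' Vq' /inj <-]. Qed.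

Definition section_value (s : local_section (j p)) : localization p :=
  subring_val (mor_sharp j (ls_dom s) (ls_sect s)) (exist _ p (ls_domP s)).

Lemma section_value_res (U W : opens X) (WU : W `<=` U) (s : rs_sect U) q
    (Wq : pre W q) (Uq : pre U q) :
  subring_val (mor_sharp j W (rs_res WU s)) (exist _ q Wq) =
  subring_val (mor_sharp j U s) (exist _ q Uq).
Proof.
have fWU : pre W `<=` pre U by move=> y; apply: WU.
rewrite (@mor_sharp_res _ _ j U W WU fWU s).
exact: (@spec_val_irr A (pre U) (mor_sharp j U s) q).
Qed.

Lemma section_value_germ s t : same_germ s t -> section_value s = section_value t.
Proof.
move=> [W [Ws [Wt [Wp e]]]]; rewrite /section_value.
rewrite -(section_value_res Ws _ (Wp : pre W p)) e.
exact: section_value_res.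
Qed.

Definition stalk_value (r : stalk (j p)) : localization p :=
  section_value (sr_repr (S := stalk_setoid (j p)) r).

Lemma stalk_valueE s : stalk_value (@sr_pi (stalk_setoid (j p)) s) = section_value s.
Proof. by apply: section_value_germ; apply: (@sr_pi_repr (stalk_setoid (j p))). Qed.

Lemma stalk_ind (Q : stalk (j p) -> Prop) :
  (forall s, Q (@sr_pi (stalk_setoid (j p)) s)) -> forall r, Q r.
Proof. by move=> H r; rewrite -(@sr_reprK (stalk_setoid (j p)) r). Qed.

Fact stalk_valueD x y : stalk_value (x + y) = stalk_value x + stalk_value y.
Proof.
elim/stalk_ind: x => s; elim/stalk_ind: y => t.
rewrite -(@sr_piD (stalk_setoid (j p))) !stalk_valueE /section_value /=.
rewrite (rmorphD (mor_sharp j _)) /=; congr (_ + _); exact: section_value_res.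
Qed.

Fact stalk_valueN x : stalk_value (- x) = - stalk_value x.
Proof.
elim/stalk_ind: x => s; rewrite -(@sr_piN (stalk_setoid (j p))) !stalk_valueE.
by rewrite /section_value /= (rmorphN (mor_sharp j _)).
Qed.

Fact stalk_valueM x y : stalk_value (x * y) = stalk_value x * stalk_value y.
Proof.
elim/stalk_ind: x => s; elim/stalk_ind: y => t.
rewrite -(@sr_piM (stalk_setoid (j p))) !stalk_valueE /section_value /=.
rewrite (rmorphM (mor_sharp j _)) /=; congr (_ * _); exact: section_value_res.
Qed.

Fact stalk_value1 : stalk_value 1 = 1.
Proof.
rewrite -(@sr_pi1 (stalk_setoid (j p))) stalk_valueE /section_value /=.
by rewrite (rmorph1 (mor_sharp j _)).
Qed.

(** A section whose value at [p] vanishes is [a / f] near [p] with [u a = 0] for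
    some [u] outside [p], hence vanishes near [p]. *)
Lemma stalk_value_eq0 x : stalk_value x = 0 -> x = 0.
Proof.
elim/stalk_ind: x => -[U UP sec]; rewrite stalk_valueE /section_value /= => v0.
have [V [Vp VU [a [f tE]]]] := subring_valP (mor_sharp j U sec) (exist _ p UP).
have [pf vE] := tE (exist _ p UP) Vp.
have /frac_eqP[u pu ua] : Defs.frac a pf = Defs.frac 0 (@prime_ideal1 _ p).
  by rewrite -vE; exact: v0.
pose V' := opensI V (basic_open u).
have V'U : image_open V' `<=` U by move=> _ [q [/VU Uq _] <-].
rewrite -(@sr_pi0 (stalk_setoid (j p))); apply/(@sr_piP (stalk_setoid (j p))).
apply: (@same_germ_on _ _ _ _ (image_open V')); [by exists p|exact: V'U|by []|].
- move=> W1 W2; rewrite [RHS](rmorph0 (rs_res W2)).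
  have [inj _ bij] := jP; apply: (bij_inj (bij (image_open V') _)).
    by move=> _ [q _ <-]; exists q.
  rewrite (rmorph0 (mor_sharp j _)); apply: spec_sect_ext => q V'q.
  have [Vq qu] := image_open_mem V'q.
  rewrite (section_value_res _ _ _ (V'U _ V'q : pre U q)).
  have [qf ->] := tE (exist _ q (V'U _ V'q)) Vq.
  by apply/(@sr_piP (localization_setoid q)); exists u.
Qed.

Lemma stalk_value_surj x : exists r, stalk_value r = x.
Proof.
have [a [s [ps ->]]] := frac_surj x.
have t_sub : spec_subring (basic_open s)
    (fun q : {q | basic_open s q} => Defs.frac a (svalP q)).
  move=> q; exists (basic_open s); split=> //; first exact: svalP.
  by exists a, s => y _; exists (svalP y).
pose W := image_open (basic_open s).
have WV : pre W `<=` basic_open s by move=> q; apply: image_open_mem.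
have [inj _ bij] := jP; have WP : W (j p) by exists p.
have [|inv _ invK] := bij W; first by move=> _ [q _ <-]; exists q.
exists (germ WP (inv (spec_res WV (SubringElt t_sub)))).
rewrite /germ stalk_valueE /section_value /= invK /=.
by apply/frac_eqP; exists 1 => //; apply: prime_ideal1.
Qed.

End StalkOfOpenImmersion.

Definition mpoly_translate (k : fieldType) M (c : 'I_M -> k)
    (q : {mpoly k[M]}) : {mpoly k[M]} :=
  mmap (@mpolyC M k) (fun i => 'X_i + (c i)%:MP) q.
HB.instance Definition _ (k : fieldType) M (c : 'I_M -> k) :=
  GRing.RMorphism.copy (mpoly_translate c)
    (mmap (@mpolyC M k) (fun i => 'X_i + (c i)%:MP)).

Lemma mpoly_translateC (k : fieldType) M (c : 'I_M -> k) a :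
  mpoly_translate c a%:MP = a%:MP.
Proof. exact: mmapC. Qed.

Lemma mpoly_translateX (k : fieldType) M (c : 'I_M -> k) i :
  mpoly_translate c 'X_i = 'X_i + (c i)%:MP.
Proof. by rewrite /mpoly_translate mmapX mmap1U. Qed.

Lemma mpoly_translateK (k : fieldType) M (c : 'I_M -> k) q :
  mpoly_translate (fun i => - c i) (mpoly_translate c q) = q.
Proof.
apply: (mpoly_hom_eq (f := mpoly_translate (fun i => - c i) \o mpoly_translate c)
  (g := idfun)) => [a|i] /=; first by rewrite !mpoly_translateC.
rewrite mpoly_translateX rmorphD /= mpoly_translateC mpoly_translateX.
by rewrite mpolyCN subrK.
Qed.

Section LocalPresentationOfPoint.
Variables (k : fieldType) (X : scheme) (f : morphism X (spec_ringed_space k)).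
Variables (A : comPzRingType) (j : morphism (spec_ringed_space A) X).
Variables (jP : open_immersion j) (p : spec A).
Local Notation R := (stalk (j p)).
Local Notation val := (@stalk_value A X j p).
Variables (h : {rmorphism k -> A}) (M : nat) (psi : {rmorphism {mpoly k[M]} -> A}).
Hypothesis hscalar :
  forall c, mor_sharp j (opensT X) (Defs.scalar f c) = spec_const _ (h c).
Hypotheses (psiC : forall c, psi c%:MP = h c) (psi_surj : forall a, exists q, psi q = a).
Hypothesis rat : rational_point f (j p).
Local Notation m := (lrs_max (j p)).
Local Notation one := (@prime_ideal1 A p).

Let val_inj x y : val x = val y -> x = y.
Proof.
move=> xy; apply/eqP; rewrite -subr_eq0; apply/eqP/(stalk_value_eq0 jP).
by rewrite stalk_valueD stalk_valueN xy subrr.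
Qed.

Let lift_elem a : {r | val r = Defs.frac a one}.
Proof. exact/cid/(stalk_value_surj jP). Qed.

Definition germ_of (a : A) : R := sval (lift_elem a).

Lemma germ_ofE a : val (germ_of a) = Defs.frac a one.
Proof. exact: svalP (lift_elem a). Qed.

Fact germ_of_is_zmod : zmod_morphism germ_of.
Proof.
move=> a b; apply: val_inj; rewrite stalk_valueD stalk_valueN !germ_ofE.
rewrite /Defs.frac -(@sr_piN (localization_setoid p)) -(@sr_piD (localization_setoid p)).
by apply/frac_eqP; exists 1; [exact: one|rewrite /=; ring].
Qed.

Fact germ_of_is_monoid : monoid_morphism germ_of.
Proof.
split=> [|a b]; apply: val_inj; first by rewrite germ_ofE stalk_value1.
rewrite stalk_valueM !germ_ofE fracM.
by apply/frac_eqP; exists 1; [exact: one|rewrite /=; ring].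
Qed.

HB.instance Definition _ :=
  GRing.isZmodMorphism.Build A R germ_of germ_of_is_zmod.
HB.instance Definition _ :=
  GRing.isMonoidMorphism.Build A R germ_of germ_of_is_monoid.

Let germ_ofD a b : germ_of (a + b) = germ_of a + germ_of b.
Proof. exact: rmorphD. Qed.
Let germ_ofB a b : germ_of (a - b) = germ_of a - germ_of b.
Proof. exact: rmorphB. Qed.
Let germ_ofM a b : germ_of (a * b) = germ_of a * germ_of b.
Proof. exact: rmorphM. Qed.

Lemma germ_of_frac r : exists a s, ~ p s /\ germ_of s * r = germ_of a.
Proof.
have [a [s [ps e]]] := frac_surj (val r); exists a, s; split=> //.
apply: val_inj; rewrite stalk_valueM !germ_ofE e fracM.
by apply/frac_eqP; exists 1; [exact: one|rewrite /=; ring].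
Qed.

Lemma germ_of_unit s : ~ p s -> is_unit (germ_of s).
Proof.
move=> ps; have [r rE] := stalk_value_surj jP (Defs.frac 1 ps); exists r.
apply: val_inj; rewrite stalk_valueM germ_ofE rE fracM stalk_value1.
by apply/frac_eqP; exists 1; [exact: one|rewrite /=; ring].
Qed.

(** The elements [germ_of a / germ_of s] with [a] in [p] form an ideal containing
    all elements that are not invertible, so that it is the maximal ideal. *)
Lemma max_germ_of r : m r <-> exists a s, [/\ p a, ~ p s & germ_of s * r = germ_of a].
Proof.
have @J : ideal R.
  exists [set r : R | exists a s, [/\ p a, ~ p s & germ_of s * r = germ_of a]].
  - by exists 0, 1; rewrite rmorph0 mulr0; split=> //; [exact: ideal0|exact: one].
  - move=> x y [a [s [pa ps e]]] [b [t [pb pt e']]].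
    exists (t * a + s * b), (s * t); split.
    + by apply: idealD; apply: idealM.
    + exact: prime_compl_mul.
    + rewrite germ_ofD !germ_ofM -e -e'; ring.
  - move=> c x [a [s [pa ps e]]]; have [b [t [pt e']]] := germ_of_frac c.
    exists (b * a), (t * s); split; first exact: idealM.
      exact: prime_compl_mul.
    rewrite !germ_ofM -e -e'; ring.
have J1 : ~ J 1.
  move=> [a [s [pa ps]]]; rewrite mulr1 => /(congr1 val); rewrite !germ_ofE.
  move=> /frac_eqP[u pu]; rewrite !mulr1 => e.
  by apply: (prime_compl_mul pu ps); rewrite e; apply: idealM.
have Junit x : ~ J x -> is_unit x.
  move=> Jx; have [a [s [ps e]]] := germ_of_frac x.
  have pa : ~ p a by move=> pa; apply: Jx; exists a, s.
  have [y ay] := germ_of_unit pa; exists (germ_of s * y).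
  by rewrite mulrA [x * _]mulrC e ay.
have Jmax : maximal_ideal J.
  split=> // J' JJ' J'1; apply: idealP => x; split=> [J'x|/JJ' //].
  by apply: contrapT => /Junit ux; apply: J'1; apply: unit_ideal ux J'x.
by rewrite -((lrs_local (j p)).2 _ Jmax).
Qed.

Lemma max_germ_ofE a : m (germ_of a) -> p a.
Proof.
move=> /max_germ_of[b [s [pb ps]]]; rewrite -germ_ofM.
move=> /(congr1 val); rewrite !germ_ofE => /frac_eqP[u pu]; rewrite !mulr1 => e.
apply: contrapT => pa; apply: (prime_compl_mul pu (prime_compl_mul ps pa)).
by rewrite e; apply: idealM.
Qed.

Lemma stalk_scalarE c : stalk_scalar f (j p) c = germ_of (h c).
Proof.
apply: val_inj; rewrite germ_ofE /stalk_scalar /germ stalk_valueE.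
by rewrite /section_value /= hscalar /=; apply/frac_eqP; exists 1; [exact: one|].
Qed.

(** As the point is rational, the generators of the algebra can be translated to the
    origin. *)
Lemma point_local_presentation : exists phi : {rmorphism {mpoly k[M]} -> R},
  (forall c, phi c%:MP = stalk_scalar f (j p) c) /\ local_presentation m phi.
Proof.
have [cst cstP] : exists c : 'I_M -> k,
    forall i, m (germ_of (psi 'X_i) - stalk_scalar f (j p) (c i)).
  have H i : exists c, m (germ_of (psi 'X_i) - stalk_scalar f (j p) c).
    have [inv _ invK] := rat.
    by exists (inv (quot_pi m (germ_of (psi 'X_i)))); apply/quot_piP; rewrite invK.
  by have [c cP] := choice H; exists c.
pose phi : {rmorphism {mpoly k[M]} -> R} := 
  germ_of \o (psi \o mpoly_translate (fun i => - cst i)).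
have phiE q : phi q = germ_of (psi (mpoly_translate (fun i => - cst i) q)) by [].
have phiC c : phi c%:MP = stalk_scalar f (j p) c.
  by rewrite phiE mpoly_translateC psiC stalk_scalarE.
have mX i : m (phi 'X_i).
  rewrite phiE mpoly_translateX mpolyCN (rmorphB psi) germ_ofB psiC -stalk_scalarE.
  exact: cstP.
exists phi; split=> //; split=> //.
- exact: (lrs_local (j p)).1.1.
- move=> x mx; have [a [s [ps e]]] := germ_of_frac x.
  have pa : ~ p a by move=> pa; apply: mx; apply/max_germ_of; exists a, s.
  have [y ay] := germ_of_unit pa; exists (germ_of s * y).
  by rewrite mulrA [x * _]mulrC e ay.
move=> r; have [a [s [ps e]]] := germ_of_frac r.
have [q qs] := psi_surj s; have [q' qa] := psi_surj a.
exists (mpoly_translate cst q'), (mpoly_translate cst q).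
rewrite !phiE !mpoly_translateK qs qa; split=> //.
apply/eqP => q0; apply: ps; apply: max_germ_ofE.
rewrite -qs -[q](mpoly_translateK cst) -phiE.
have [c ->] := mpoly_const_split (mpoly_translate cst q).
rewrite q0 mpolyC0 add0r (rmorph_sum phi); apply: ideal_sum => i _.
by rewrite (rmorphM phi); apply: idealM.
Qed.

End LocalPresentationOfPoint.

(** * The reduced local ring *)

Section Reduction.
Variables (k : fieldType) (N : nat) (R : comPzRingType) (m : ideal R).
Variables (phi : {rmorphism {mpoly k[N]} -> R}) (lp : local_presentation m phi).
Local Notation nil := (nilradical R).
Local Notation Q := (quot nil).
Local Notation pi := (quot_pi nil).

Lemma prime_nil (p : prime_ideal R) z : nil z -> p z.
Proof.
move=> [s]; elim: s => [|s IH].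
  by rewrite expr0 => e; case: (@prime_ideal1 _ p); rewrite e; apply: ideal0.
rewrite exprS => zs; apply: contrapT => pz.
have : p (z * z ^+ s) by rewrite zs; apply: ideal0.
move=> /prime_idealM[//|]; elim: (s) {zs IH} => [|t IH].
  by rewrite expr0; apply: prime_ideal1.
by rewrite exprS => /prime_idealM[].
Qed.

Lemma max_nil z : nil z -> m z.
Proof.
move=> [s zs]; apply: contrapT => /(lp_unit lp)[y zy]; apply: (lp_one lp).
have <- : (z * y) ^+ s = 1 by rewrite zy expr1n.
by rewrite exprMn zs mul0r; apply: ideal0.
Qed.

Lemma quot_pi_onto (x : Q) : exists r, x = pi r.
Proof. by exists (sr_repr (S := quot_setoid nil) x); rewrite /quot_pi sr_reprK. Qed.

Definition quot_image (I : ideal R) : ideal Q.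
Proof.
exists [set x : Q | exists2 r, I r & x = pi r].
- by exists 0; [apply: ideal0|rewrite rmorph0].
- move=> _ _ [r Ir ->] [r' Ir' ->]; exists (r + r'); first exact: idealD.
  by rewrite (rmorphD pi).
- move=> a _ [r Ir ->]; have [b ->] := quot_pi_onto a.
  by exists (b * r); [apply: idealM|rewrite (rmorphM pi)].
Defined.

Lemma quot_imageE (I : ideal R) r : (forall z, nil z -> I z) ->
  quot_image I (pi r) <-> I r.
Proof.
move=> nI; split=> [[r' Ir' /quot_piP/nI Irr']|Ir]; last by exists r.
by rewrite -(subrK r' r); apply: idealD.
Qed.

Definition quot_preimage (I : ideal Q) : ideal R.
Proof.
exists [set r : R | I (pi r)].
- by rewrite /mkset rmorph0; apply: ideal0.
- by move=> r r' Ir Ir'; rewrite /mkset (rmorphD pi); apply: idealD.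
- by move=> a r Ir; rewrite /mkset (rmorphM pi); apply: idealM.
Defined.

Lemma quot_noetherian : noetherian Q.
Proof.
move=> I; have [r [g eI]] := lp_noetherian lp (quot_preimage I).
exists r, (fun i => pi (g i)); apply: idealP => x; have [a ->] := quot_pi_onto x.
split=> [Ia|/ideal_genP[c ->]].
  have : quot_preimage I a by [].
  rewrite eI => /ideal_genP[c ->]; apply/ideal_genP; exists (fun i => pi (c i)).
  by rewrite (rmorph_sum pi); apply: eq_bigr => i _; rewrite (rmorphM pi).
apply: ideal_sum => i _; apply: idealM.
have : quot_preimage I (g i) by rewrite eI; apply: ideal_gen_sub; exists i.
by [].
Qed.

Lemma quot_is_local : is_local (quot_image m).
Proof.
have m1 : ~ quot_image m 1.
  by rewrite -(rmorph1 pi) => /quot_imageE H; apply/(lp_one lp)/H/max_nil.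
have unitQ x : ~ quot_image m x -> is_unit x.
  have [r ->] := quot_pi_onto x => mr.
  have [|y ry] := lp_unit lp (x := r).
    by move=> mr'; apply/mr; exists r.
  by exists (pi y); rewrite -(rmorphM pi) ry rmorph1.
have proper_sub (J : ideal Q) : ~ J 1 -> J `<=` quot_image m.
  by move=> J1 x Jx; apply: contrapT => /unitQ ux; apply/J1/(unit_ideal ux).
split=> [|m' [m'1 m'max]]; last exact/esym/m'max/m1/proper_sub.
split=> // J mJ J1; apply: idealP => x; split; [exact: proper_sub|exact: mJ].
Qed.

Definition quot_prime_image (p : prime_ideal R) : prime_ideal Q.
Proof.
exists (quot_image p).
- by rewrite -(rmorph1 pi) => /(quot_imageE _ (@prime_nil p)); apply: prime_ideal1.
- move=> x y; have [a ->] := quot_pi_onto x; have [b ->] := quot_pi_onto y.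
  rewrite -(rmorphM pi) => /(quot_imageE _ (@prime_nil p))/prime_idealM.
  by case=> ?; [left|right]; apply/(quot_imageE _ (@prime_nil p)).
Defined.

Definition quot_prime_preimage (p : prime_ideal Q) : prime_ideal R.
Proof.
exists (quot_preimage p).
- by rewrite /= /mkset; change (~ p (pi 1)); rewrite rmorph1; apply: prime_ideal1.
- move=> x y; change (p (pi (x * y)) -> p (pi x) \/ p (pi y)).
  by rewrite (rmorphM pi); apply: prime_idealM.
Defined.

(** The chain of primes gives the lower bound for the dimension of the reduced
    ring; the upper bound and the generation of the maximal ideal follow from the
    parameters by Nakayama's lemma. *)
Theorem regular_reduction d : regular_data m d -> regular_local_ring Q.
Proof.
move=> [u [p [chain mu gen]]]; split; first exact: quot_noetherian.
exists (quot_image m); split; first exact: quot_is_local.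
have mI r : m r -> exists c : 'I_d -> R, nil (r - \sum_i c i * u i).
  pose I := ideal_add nil (ideal_gen (range u)).
  have Im x : I x -> m x.
    move=> [a [b [na /ideal_genP[c ->] ->]]]; apply: idealD; first exact: max_nil.
    by apply: ideal_sum => i _; apply: idealM.
  have I2 x : m x -> exists2 a, I a & ideal_exp m 2 (x - a).
    move=> /gen[c [z [nz mx]]]; exists (z + \sum_j c j * u j).
      by exists z, (\sum_j c j * u j); split=> //; apply/ideal_genP; exists c.
    by rewrite opprD addrA addrAC.
  move=> mr; have [a [b [na /ideal_genP[c eb] er]]] := nakayama_max lp Im I2 mr.
  by exists c; rewrite er eb addrK.
exists d; last first.
  exists (fun i => pi (u i)); apply: idealP => x; split=> [[r /mI[c nc] ->]|].
    apply/ideal_genP; exists (fun i => pi (c i)).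
    rewrite (_ : pi r = pi (\sum_i c i * u i)); last exact/quot_piP.
    by rewrite (rmorph_sum pi); apply: eq_bigr => i _; rewrite (rmorphM pi).
  move=> /ideal_genP[c ->]; apply: ideal_sum => i _; apply: idealM.
  by exists (u i).
split=> [|e q qchain].
  exists (fun s => quot_prime_image (p s)) => s sd; have [pS nS] := chain s sd.
  split=> [_ [r pr ->]|pS'].
    by exists r => //; apply: pS.
  apply: nS => r pr; apply/(quot_imageE r (@prime_nil (p s))).
  by apply: pS'; exists r.
apply: (chain_length_le lp mu mI (p := fun s => quot_prime_preimage (q s))).
  move=> z nz; change (q 0%N (pi z)).
  rewrite (_ : pi z = 0); first exact: ideal0.
  by rewrite -(rmorph0 pi); apply/quot_piP; rewrite subr0.
move=> s se; have [qS nS] := qchain s se; split=> [r qr|qS']; first exact: qS.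
by apply: nS => x; have [r ->] := quot_pi_onto x; apply: qS'.
Qed.

End Reduction.

Theorem theorem4p6 (k : fieldType) (hk : [pchar k] =i pred0)
    (X : scheme) (f : morphism X (spec_ringed_space k))
    (hX : scheme_finite_type f) (P : X) (hP : rational_point f P) :
  principal_gradient_scheme f P ->
  regular_local_ring (quot (nilradical (stalk P))).
Proof.
have [M [A [j [jP cover alg]]]] := hX.
have [i [p _ eP]] := cover P.
have [h [hsc [N [psi [psiC psi_surj]]]]] := alg i.
subst P.
have [phi [phiC lp]] :=
  point_local_presentation (jP i) hsc psiC psi_surj hP.
move=> [n [I [[F eF] [theta [theta_bij thetaC]] [g eI]]]].
have thetaC' c : theta (to_completion _ (phi c%:MP)) = quot_pi I (psC c).
  by rewrite phiC.
have Ig (g' : pseries k n) : I = ideal_gen [set g'] ->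
    forall G, I G <-> exists q, G = q * g'.
  by move=> -> G; apply: ideal_gen1P.
have [g0|/eqP g0] := eqVneq g 0.
  apply: (regular_reduction lp (d := n)).
  have IP := Ig _ eI; rewrite g0 in IP.
  apply: (regular_data_smooth
    (completion_lift_relation lp theta_bij thetaC' IP)) => // l.
  exact: completion_lift_coord IP.
have I1 := presentation_proper lp theta_bij.
rewrite eI in I1; rewrite {1}eF in eI.
have [l [y [e [y0 yU ey]]]] := principal_gradient_ideal hk g0 (esym eI) I1.
have IP := Ig (y ^+ e.+1) (etrans eF (etrans eI ey)).
apply: (regular_reduction lp (d := n.-1)).
apply: (regular_data_power hk lp
  (completion_lift_relation lp theta_bij thetaC' IP) y0 yU) => l'.
exact: completion_lift_coord IP.
Qed.
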